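(* Let $n\ge 1$ and $\alpha=(\alpha_1,\dots,\alpha_n)\in\mathbb{R}^n$ with $\alpha_i>-\tfrac12$ for all $i$. Let $m\in L_\alpha^2(\mathbb{R}_+^n)\cap L_\alpha^\infty(\mathbb{R}_+^n)$ satisfy the admissibility condition $$\int_0^\infty |m(\sigma x)|^2\,\frac{d\sigma}{\sigma}=1,\qquad x\in\mathbb{R}_+^n.$$ Then for every $f\in L_\alpha^2(\mathbb{R}_+^n)$, $$\|f\|_{\alpha,2}^2\le \frac{2}{2|\alpha|+n}\,\Big\|\,\|y\|\,\mathcal{F}_\alpha(f)\Big\|_{\alpha,2}\,\Big\|\,\|x\|\,T_{\alpha,m,\sigma}f\Big\|_{\sigma,\alpha,2}.$$
   Context: Notation. $\mathbb{R}_+^n=\{x=(x_1,\dots,x_n): x_1>0,\dots,x_n>0\}$, $\|x\|$ is the Euclidean norm, and $|\alpha|=\alpha_1+\dots+\alpha_n$. The measure $\mu_\alpha$ on $\mathbb{R}_+^n$ is $d\mu_\alpha(x)=c_\alpha\prod_{i=1}^n x_i^{2\alpha_i+1}dx_i$ with $c_\alpha=\frac{1}{2^{|\alpha|}\prod_{i=1}^n\Gamma(\alpha_i+1)}$. $L_\alpha^p(\mathbb{R}_+^n)$ is the $L^p$ space of $\mu_\alpha$, with norm $\|\cdot\|_{\alpha,p}$. On $(0,\infty)\times\mathbb{R}_+^n$ put $d\Omega_\alpha(\sigma,x)=\frac{d\sigma}{\sigma}\,d\mu_\alpha(x)$, and for measurable $g$ on this space $\|g\|_{\sigma,\alpha,p}=\big(\int_{\mathbb{R}_+^n}\int_0^\infty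 |g(\sigma,x)|^p\,d\Omega_\alpha(\sigma,x)\big)^{1/p}$ (here $\sigma$ in the subscript is only a symbol; it is integrated over). Norms of functions not in the corresponding space are $+\infty$. For $\nu>-\frac12$ the normalized Bessel function is $j_\nu(x)=\Gamma(\nu+1)\sum_{k=0}^\infty\frac{(-1)^k}{k!\,\Gamma(\nu+k+1)}\big(\frac{x}{2}\big)^{2k}$. The $n$-dimensional Bessel Fourier transform is $$\mathcal{F}_\alpha(f)(\lambda)=\int_{\mathbb{R}_+^n}f(x)\prod_{i=1}^n j_{\alpha_i}(\lambda_i x_i)\,d\mu_\alpha(x),\qquad \lambda\in\mathbb{R}_+^n,$$ for $f\in L^1_\alpha(\mathbb{R}_+^n)$, extended to $L_\alpha^2(\mathbb{R}_+^n)$ as an isometric isomorphism (Plancherel), with inverse $\mathcal{F}_\alpha^{-1}=\mathcal{F}_\alpha$. For $\sigma>0$ let $m_\sigma(x)=m(\sigma x)$. The Poly-axially $L^2_\alpha$-multiplier operators are $T_{\alpha,m,\sigma}f(x)=\mathcal{F}_\alpha^{-1}\big(m_\sigma\,\mathcal{F}_\alpha(f)\big)(x)$, $x\in\mathbb{R}_+^n$. In the norm $\|\cdot\|_{\sigma,\alpha,2}$, $T_{\alpha,m,\sigma}f$ is regarded as the function $(\sigma,x)\mapsto T_{\alpha,m,\sigma}f(x)$, and $\|x\|\,T_{\alpha,m,\sigma}f$ as $(\sigma,x)\mapsto\|x\|\,T_{\alpha,m,\sigma}f(x)$; $\|y\|\,\mathcal{F}_\alpha(f)$ is the function $y\mapsto\|y\|\,\mathcal{F}_\alpha(f)(y)$.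 *)

(* Defs.v *)
From HB Require Import structures.
From mathcomp Require Import all_boot all_order all_algebra.
From mathcomp Require Import all_classical all_reals all_analysis.
From mathcomp Require Import measurable_realfun ess_sup_inf.
From mathcomp.real_closed Require Import complex.

Set Implicit Arguments.
Unset Strict Implicit.
Unset Printing Implicit Defensive.
Import Order.TTheory GRing.Theory Num.Theory.
Import numFieldNormedType.Exports.
Local Open Scope classical_set_scope.
Local Open Scope ring_scope.

(* The measure [w dmu] on [D], extended by 0 outside [D]. *)
Section mdensity.
Context d (T : measurableType d) (R : realType).
Variables (mu : {sigma_finite_measure set T -> \bar R}) (D : set T) (w : T -> R).

Definition mdensity of measurable D & measurable_fun D w
  & (forall x, D x -> 0 <= w x) :=
  fun A : set T => (\int[mu]_(x in A `&` D) (w x)%:E)%E.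

Hypotheses (mD : measurable D) (mw : measurable_fun D w)
  (w0 : forall x, D x -> 0 <= w x).

Local Notation nu := (mdensity mD mw w0).

Let nu0 : nu set0 = 0%E.
Proof. by rewrite /mdensity set0I integral_set0. Qed.

Let nu_ge0 A : (0 <= nu A)%E.
Proof. by apply: integral_ge0 => x [_ Dx]; rewrite lee_fin w0. Qed.

Let nu_sigma_additive : semi_sigma_additive nu.
Proof.
move=> /= F mF tF mUF; rewrite /mdensity setI_bigcupl ge0_integral_bigcup//=.
- apply: is_cvg_ereal_nneg_natsum_cond => k _ _.
  by apply: integral_ge0 => x [_ Dx]; rewrite lee_fin w0.
- by move=> k; exact: measurableI.
- apply/measurable_EFinP; apply: measurable_funS mw => //.
  by move=> x [k _ []].
- by move=> x [k _ [_ Dx]]; rewrite lee_fin w0.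
- exact: trivIset_setIr.
Qed.

HB.instance Definition _ := isMeasure.Build _ _ _ nu
  nu0 nu_ge0 nu_sigma_additive.

Let nu_sigma_finite : sigma_finite setT nu.
Proof.
have [F TF Foo] := sigma_finiteT mu.
pose W k := ~` D `|` (D `&` [set x | w x <= k%:R]).
have mW k : measurable (W k).
  apply: measurableU; first exact: measurableC.
  exact: (measurable_fun_le mD mw (measurable_cst _)).
pose u n : nat * nat := odflt (0, 0)%N (unpickle n).
exists (fun n => F (u n).1 `&` W (u n).2).
  apply/seteqP; split=> // x _.
  have : (\bigcup_i F i) x by rewrite -TF.
  move=> [i _ Fix].
  have [j wj] : exists j : nat, w x <= j%:R.
    exists (Num.truncn (w x)).+1.
    by rewrite ltW// Num.Theory.truncnS_gt.
  exists (pickle (i, j)) => //=; rewrite /u pickleK; split=> //=.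
  by have [Dx|Dx] := pselect (D x); [right|left].
move=> n; have [mF Foon] := Foo (u n).1.
have mFW : measurable (F (u n).1 `&` W (u n).2) by exact: measurableI.
have mFWD : measurable (F (u n).1 `&` W (u n).2 `&` D) by exact: measurableI.
split=> //.
have le1 : (nu (F (u n).1 `&` W (u n).2) <=
    \int[mu]_(x in F (u n).1 `&` W (u n).2 `&` D) ((u n).2%:R)%:E)%E.
  rewrite /mdensity; apply: ge0_le_integral => //=.
  - by move=> x [_ Dx]; rewrite lee_fin w0.
  - by apply/measurable_EFinP; apply: measurable_funS mw => // x [].
  - by move=> x [[_ [//|[_ ?]]] _]; rewrite lee_fin.
apply: (le_lt_trans le1); rewrite integral_cst//.
apply: lte_mul_pinfty => //.
apply: le_lt_trans Foon; apply: le_measure; rewrite ?inE//.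
by move=> x [[]].
Qed.

HB.instance Definition _ := Measure_isSigmaFinite.Build _ _ _ nu
  nu_sigma_finite.

End mdensity.

Section sigma_finite.
Context d d' (T : measurableType d) (T' : measurableType d') (R : realType).

Lemma sigma_finite_pushforward (mu : set T -> \bar R)
    (f : T -> T') (g : T' -> T) :
  measurable_fun setT g -> cancel f g ->
  sigma_finite setT mu -> sigma_finite setT (pushforward mu f).
Proof.
move=> mg fK [F TF Foo].
exists (fun n => g @^-1` F n); first by rewrite -preimage_bigcup -TF.
move=> n; have [mF Foon] := Foo n; split.
  by rewrite -[X in measurable X]setTI; exact: mg.
rewrite /pushforward (_ : f @^-1` _ = F n)//.
by apply/seteqP; split=> x /=; rewrite fK.
Qed.

Lemma sigma_finite_product (m1 : {sigma_finite_measure set T -> \bar R})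
    (m2 : {sigma_finite_measure set T' -> \bar R}) :
  sigma_finite setT (m1 \x m2)%E.
Proof.
have /sigma_finiteP[F [TF ndF Foo]] := sigma_finiteT m1.
have /sigma_finiteP[G [TG ndG Goo]] := sigma_finiteT m2.
exists (fun n => F n `*` G n).
  rewrite -setXTT TF TG predeqE => -[x y]; split.
    move=> [/= [n _ Fnx] [k _ Gky]]; exists (maxn n k) => //; split.
    - by move: x Fnx; exact/subsetPset/ndF/leq_maxl.
    - by move: y Gky; exact/subsetPset/ndG/leq_maxr.
  by move=> [n _ []/= ? ?]; split; exists n.
move=> k; have [? ?] := Foo k; have [? ?] := Goo k.
split; first exact: measurableX.
by rewrite product_measure1E// lte_mul_pinfty// ge0_fin_numE.
Qed.

End sigma_finite.

Section lebesgue_tuple.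
Context (R : realType).
Local Notation RR := (measurableTypeR R).

Definition tuple_cons n (p : RR * n.-tuple R) : n.+1.-tuple R :=
  [tuple of p.1 :: p.2].

Definition tuple_uncons n (t : n.+1.-tuple R) : RR * n.-tuple R :=
  (thead t, [tuple of behead t]).

Lemma tuple_consK n : cancel (@tuple_cons n) (@tuple_uncons n).
Proof. by case=> x t; congr pair => //; exact: val_inj. Qed.

Lemma measurable_tuple_cons n : measurable_fun setT (@tuple_cons n).
Proof. exact: measurable_cons. Qed.

Lemma measurable_tuple_uncons n : measurable_fun setT (@tuple_uncons n).
Proof.
apply: measurable_fun_pair; last exact: measurable_behead.
exact: measurable_tnth.
Qed.

HB.instance Definition _ n := isMeasurableFun.Build _ _ _ _
  (@tuple_cons n) (@measurable_tuple_cons n).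

Section lebesgue_cons.
Variables (n : nat) (mu : {sigma_finite_measure set (n.-tuple R) -> \bar R}).

Definition lebesgue_cons : set (n.+1.-tuple R) -> \bar R :=
  pushforward (lebesgue_measure \x mu)%E (@tuple_cons n).

Let lebesgue_cons0 : lebesgue_cons set0 = 0%E.
Proof. exact: measure0. Qed.

Let lebesgue_cons_ge0 A : (0 <= lebesgue_cons A)%E.
Proof. exact: measure_ge0. Qed.

Let lebesgue_cons_sigma_additive : semi_sigma_additive lebesgue_cons.
Proof. exact: measure_semi_sigma_additive. Qed.

HB.instance Definition _ := isMeasure.Build _ _ _ lebesgue_cons
  lebesgue_cons0 lebesgue_cons_ge0 lebesgue_cons_sigma_additive.

Let lebesgue_cons_sigma_finite : sigma_finite setT lebesgue_cons.
Proof.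
apply: (sigma_finite_pushforward (@measurable_tuple_uncons n)
  (@tuple_consK n)).
exact: sigma_finite_product.
Qed.

HB.instance Definition _ := Measure_isSigmaFinite.Build _ _ _ lebesgue_cons
  lebesgue_cons_sigma_finite.

End lebesgue_cons.

(* Lebesgue measure on [R^n]. *)
Fixpoint lebesgue_tuple n : {sigma_finite_measure set (n.-tuple R) -> \bar R} :=
  match n with
  | 0 => \d_[tuple]
  | n'.+1 => lebesgue_cons (lebesgue_tuple n')
  end.

End lebesgue_tuple.

(* Gamma function, for positive arguments. *)
Definition Gamma (R : realType) (x : R) : R :=
  \int[lebesgue_measure]_(t in `]0%R, +oo[) (t `^ (x - 1) * expR (- t)).

Definition bessel_j (R : realType) (nu x : R) : R :=
  Gamma (nu + 1) * limn (series (fun k =>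
    (-1) ^+ k / (k`!%:R * Gamma (nu + k%:R + 1)) * (x / 2) ^+ (2 * k))).

Section vectors.
Context (R : realType) (n : nat).
Implicit Types x a : n.-tuple R.

Definition orthant : set (n.-tuple R) := [set x | forall i, 0 < tnth x i].

Definition euclid_norm x : R := Num.sqrt (\sum_(i < n) tnth x i ^+ 2).

Definition dilation (s : R) x : n.-tuple R := [tuple s * tnth x i | i < n].

Definition tsum a : R := \sum_(i < n) tnth a i.

Lemma measurable_orthant : measurable orthant.
Proof.
rewrite /orthant (_ : [set x | _] =
    \bigcap_(i in [set: 'I_n]) [set x | 0 < tnth x i]); last first.
  by apply/seteqP; split=> [x x0 i _|x x0 i]; exact: x0.
apply: fin_bigcap_measurable => [|i _]; first exact: finite_finset.
rewrite (_ : [set x | _] = setT `&` (fun x => tnth x i) @^-1` `]0, +oo[).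
  exact: (@measurable_tnth _ R n i).
by apply/seteqP; split=> x; rewrite setTI/= in_itv/= andbT.
Qed.

Definition bessel_weight a x : R :=
  (2 `^ tsum a * \prod_(i < n) Gamma (tnth a i + 1))^-1 *
  \prod_(i < n) tnth x i `^ (2 * tnth a i + 1).

Lemma measurable_bessel_weight a : measurable_fun orthant (bessel_weight a).
Proof.
apply: measurable_funTS; apply: measurable_funM => //.
apply: measurable_prod => i _.
exact: (measurableT_comp (measurable_powR _) (@measurable_tnth _ R n i)).
Qed.

Lemma bessel_weight_ge0 a x : orthant x -> 0 <= bessel_weight a x.
Proof.
move=> _; apply: mulr_ge0; last by apply: prodr_ge0 => i _; exact: powR_ge0.
rewrite invr_ge0 mulr_ge0 ?powR_ge0//; apply: prodr_ge0 => i _.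
apply: Rintegral_ge0 => t _; apply: mulr_ge0; first exact: powR_ge0.
exact: expR_ge0.
Qed.

(* The measure [mu_alpha]; it does not charge the complement of [orthant]. *)
Definition bessel_measure a := mdensity (lebesgue_tuple R n)
  measurable_orthant (measurable_bessel_weight a) (@bessel_weight_ge0 a).

HB.instance Definition _ a := SigmaFiniteMeasure.on (bessel_measure a).

End vectors.

(* The measure [d sigma / sigma] on the positive half-line. *)
Section log_measure.
Context (R : realType).

Let measurable_inv_pos : measurable_fun (`]0, +oo[%classic : set R) (fun s => s^-1).
Proof.
apply: open_continuous_measurable_fun; first exact: interval_open.
move=> s; rewrite inE/= in_itv/= andbT => s0.
by apply: inv_continuous; rewrite gt_eqF.
Qed.

Let inv_pos_ge0 s : (`]0, +oo[%classic : set R) s -> 0 <= s^-1.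
Proof. by rewrite /= in_itv/= andbT => s0; rewrite invr_ge0 ltW. Qed.

Definition log_measure := mdensity lebesgue_measure
  (measurable_itv `]0%R, +oo[) measurable_inv_pos inv_pos_ge0.

HB.instance Definition _ := SigmaFiniteMeasure.on log_measure.

End log_measure.

Section complex_valued.
Context d (T : measurableType d) (R : realType).
Variable mu : {measure set T -> \bar R}.
Implicit Types f : T -> R[i].

Definition cmeasurable f :=
  measurable_fun setT (fun x => complex.Re (f x)) /\
  measurable_fun setT (fun x => complex.Im (f x)).

Definition cintegral f : R[i] :=
  ((\int[mu]_x complex.Re (f x)) +i* (\int[mu]_x complex.Im (f x)))%C.

Definition cLnorm (p : \bar R) f : \bar R :=
  ('N[mu]_p[EFin \o (@Normc.normc R \o f)])%E.

Definition inLp (p : \bar R) f := cmeasurable f /\ (cLnorm p f < +oo)%E.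

End complex_valued.

Section bessel_transform.
Context (R : realType) (n : nat) (a : n.-tuple R).
Implicit Types f g m : n.-tuple R -> R[i].

Local Notation mu := (bessel_measure a).

Definition bessel_kernel (l x : n.-tuple R) : R :=
  \prod_(i < n) bessel_j (tnth a i) (tnth l i * tnth x i).

Definition bessel_transform1 f (l : n.-tuple R) : R[i] :=
  cintegral mu (fun x => f x * (bessel_kernel l x)%:C%C).

(* [g] represents the image of [f] under the continuous extension of
   [bessel_transform1] from [L^1 /\ L^2] to [L^2]. *)
Definition is_bessel_transform f g :=
  inLp mu 2%:E g /\
  exists u : nat -> n.-tuple R -> R[i],
    [/\ forall k, inLp mu 1%:E (u k) /\ inLp mu 2%:E (u k),
        (fun k => cLnorm mu 2%:E (fun x => u k x - f x)) @ \oo --> 0%E &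
        (fun k => cLnorm mu 2%:E (fun l => bessel_transform1 (u k) l - g l))
          @ \oo --> 0%E].

(* A representative of the almost-everywhere class of the transform. *)
Definition bessel_transform f : n.-tuple R -> R[i] :=
  xget (fun=> 0) [set g | is_bessel_transform f g].

(* The inverse transform on [L^2] is the transform itself. *)
Definition multiplier_op m (s : R) f : n.-tuple R -> R[i] :=
  bessel_transform (fun x => m (dilation s x) * bessel_transform f x).

Definition Omega_measure :
    {measure set (measurableTypeR R * n.-tuple R)%type -> \bar R} :=
  (@log_measure R \x bessel_measure a)%E.

End bessel_transform.

(* Main.v *)
From HB Require Import structures.
Require Import Defs.
From mathcomp Require Import all_boot all_order all_algebra.
From mathcomp Require Import all_classical all_reals all_analysis.
From mathcomp Require Import measurable_realfun.
From mathcomp.real_closed Require Import complex.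
From mathcomp Require Import ring lra zify.

(** The estimate is the Heisenberg inequality for the Bessel transform, applied at
    every scale and integrated over the scales.  Put [F] for the transform of
    [f], [h = |alpha| + n], and [h_s (y) = m (s y) F (y)], so that the multiplier
    operator at scale [s] sends [f] to the transform of [h_s].  The uncertainty
    inequality in additive form says that, for all [c > 0],
      [4 c h |h_s|^2 <= | |x| T_s f |^2 + 4 c^2 | |y| h_s |^2].
    Integrate against [ds / s].  By Tonelli and the admissibility of [m],
    [|h_s|^2] becomes [|F|^2 = |f|^2] and [| |y| h_s |^2] becomes
    [| |y| F |^2] ([integral_band], [multiplier_heisenberg]).  The best [c]
    gives the product inequality with constant [1 / (|alpha| + n)], which is at
    most [2 / (2 |alpha| + n)] ([geometric_of_arithmetic], [half_dim_inv_le]).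

    What remains is a theory of the transform on square integrable functions.
    All of it is extracted from one explicit formula, Weber's integral
    ([weber], [weberN]): the integral of [exp (- t |l|^2)] against the product
    of the kernels at [x] and [y] is a nonnegative function [p_t (x, y)].
    Integrating Gaussians against it gives Gaussians, and total mass 1, so
    [p_t] is the kernel of a symmetric Markov semigroup [P_t].  For integrable
    [u] with transform [v], Fubini yields
      [\int exp (- t |l|^2) v^2 = \iint p_t (x, y) u (x) u (y)],
    which is [ktransform_form].  Two consequences of it are used.

    - Plancherel ([sqint_ktransform]).  The right-hand side is at most
      [\int u^2], and for [u >= 0] the defect is half the quadratic form
      [\iint p_t (x, y) (u (x) - u (y))^2].  That form tends to 0 with [t]:
      for Gaussians by computation, and then for every square integrable
      function ([vanish_quad]), because the sets whose indicator has a vanishing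
      form are a sigma-algebra which contains the level sets of Gaussians.
    - Uncertainty ([heisenberg]).  For a positive weight [phi], the Schur test
      ([ktransform_schur]) bounds the left-hand side by [\int u^2 P_t phi / phi].
      Take [phi = exp (- c |x|^2) + delta].  Comparing the terms of first order
      in [t] as [t] tends to 0, and then letting [delta] tend to 0, gives the
      additive inequality without any differentiation of [u].

    The results are proved for real functions and an abstract kernel, and are
    transported to complex functions through real and imaginary parts. *)

Set Implicit Arguments.
Unset Strict Implicit.
Unset Printing Implicit Defensive.
Import Order.TTheory GRing.Theory Num.Theory.
Import numFieldNormedType.Exports.
Local Open Scope classical_set_scope.
Local Open Scope ring_scope.

(** * Gaussian moments and the Gamma function *)

Section gauss_moments.
Context (R : realType).
Local Notation leb := (@lebesgue_measure R).
Implicit Types p t x : R.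

(** A crude exponential bound, enough for the convergence of all Gaussian moments. *)
Lemma powR_le_expR p : 0 <= p -> exists2 C : R, 0 < C &
  forall x, 0 <= x -> x `^ p <= C * expR x.
Proof.
move=> p0; pose m := (Num.truncn p).
exists (m.+1`!%:R); first by rewrite ltr0n fact_gt0.
move=> x x0.
have m1 : 1 <= (m.+1`!%:R : R) by rewrite ler1n fact_gt0.
have e1 : 1 <= expR x by rewrite -expR0 ler_expR.
have pm : p <= m.+1%:R by exact/ltW/Num.Theory.truncnS_gt.
have [x1|x1] := leP 1 x.
  apply: (@le_trans _ _ (x `^ m.+1%:R)); first exact: ler_powR.
  rewrite powR_mulrn//; apply: (@le_trans _ _ (m.+1`!%:R * (x ^+ m.+1 / m.+1`!%:R))).
    by rewrite mulrCA divff ?mulr1// pnatr_eq0 -lt0n fact_gt0.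
  rewrite ler_wpM2l//; apply: le_trans (expR_ge1Dxn m x0).
  by rewrite lerDr.
apply: (@le_trans _ _ 1); last by rewrite -[X in X <= _]mulr1 ler_pM.
have <- : 1 `^ p = 1 :> R by rewrite powR1.
by apply: ge0_ler_powR => //; rewrite ?nnegrE// ltW.
Qed.

Definition gauss_moment_fun p t x : R := x `^ p * expR (- (t * x ^+ 2)).

Lemma gauss_moment_fun_ge0 p t x : 0 <= gauss_moment_fun p t x.
Proof. by rewrite mulr_ge0// ?powR_ge0 ?expR_ge0. Qed.

Lemma gauss_moment_fun_le p t : 0 <= p -> 0 < t -> exists2 C : R, 0 < C &
  forall x, 0 <= x -> gauss_moment_fun p t x <= C * expR (- x).
Proof.
move=> p0 t0; have [C C0 CP] := powR_le_expR p0.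
exists (C * expR (t^-1)); first by rewrite mulr_gt0// expR_gt0.
move=> x x0; rewrite /gauss_moment_fun.
apply: (@le_trans _ _ (C * expR x * expR (- (t * x ^+ 2)))).
  by rewrite ler_wpM2r ?expR_ge0// CP.
rewrite -!mulrA -!expRD ler_pM2l// ler_expR.
have : 0 <= t * (x - t^-1) ^+ 2 by rewrite mulr_ge0 ?sqr_ge0// ltW.
have -> : t * (x - t^-1) ^+ 2 = t * x ^+ 2 - 2 * x + t^-1 by field; rewrite gt_eqF.
lra.
Qed.

Definition gauss_moment p t : \bar R :=
  (\int[leb]_(x in `]0%R, +oo[) (gauss_moment_fun p t x)%:E)%E.

Lemma measurable_gauss_moment_fun p t : measurable_fun setT (gauss_moment_fun p t).
Proof.
apply: measurable_funM; first exact: measurable_powR.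
apply: measurableT_comp => //; apply: measurableT_comp => //.
by apply: measurable_funM => //; exact: measurable_funX.
Qed.

Lemma integral_expRN : (\int[leb]_(x in `]0%R, +oo[) (expR (- x))%:E = 1)%E.
Proof.
rewrite integral_itv_obnd_cbnd; last first.
  apply/measurable_EFinP; apply: measurable_funTS.
  by apply: measurableT_comp.
have -> : (1 = 0%:E - (- expR (- 0))%:E :> \bar R)%E.
  by rewrite oppr0 expR0 -EFinB opprK add0r.
apply: (@ge0_continuous_FTC2y _ (fun x => expR (- x)) (fun x => - expR (- x))).
- by move=> x _; exact: expR_ge0.
- apply: continuous_subspaceT => x.
  apply: continuous_comp; [exact: opp_continuous|exact: continuous_expR].
- by rewrite -oppr0; apply: cvgN; exact: cvgr_expR.
- by move=> x _; apply: ex_derive.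
- apply: cvg_at_right_filter; apply: cvgN.
  apply: (@continuous_comp _ _ _ (-%R) expR); [exact: opp_continuous|exact: continuous_expR].
- move=> x _; rewrite derive1E derive_val.
by rewrite ?mulrN1 ?mulN1r ?opprK.
Qed.

Lemma gauss_moment_lty p t : 0 <= p -> 0 < t -> (gauss_moment p t < +oo)%E.
Proof.
move=> p0 t0; have [C C0 CP] := gauss_moment_fun_le p0 t0.
apply: (@le_lt_trans _ _ (\int[leb]_(x in `]0%R, +oo[) (C%:E * (expR (- x))%:E))%E).
  apply: ge0_le_integral => //=.
  - by move=> x _; rewrite lee_fin gauss_moment_fun_ge0.
  - apply/measurable_EFinP; apply: measurable_funTS.
    exact: measurable_gauss_moment_fun.
  - by apply/measurable_EFinP; apply: measurable_funTS; apply: measurable_funM => //; apply: measurableT_comp.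
  - move=> x; rewrite in_itv/= andbT => x0.
    by rewrite -EFinM lee_fin CP// ltW.
rewrite ge0_integralZl//=.
- by rewrite integral_expRN mule1 ltry.
- by apply/measurable_EFinP; apply: measurable_funTS; apply: measurableT_comp.
- by rewrite lee_fin ltW.
Qed.

Lemma gauss_moment_fin_num p t : 0 <= p -> 0 < t -> gauss_moment p t \is a fin_num.
Proof.
move=> p0 t0; rewrite ge0_fin_numE ?gauss_moment_lty//.
by apply: integral_ge0 => x _; rewrite lee_fin gauss_moment_fun_ge0.
Qed.

Lemma gauss_moment_gt0 p t : 0 <= p -> 0 < t -> (0 < gauss_moment p t)%E.
Proof.
move=> p0 t0.
apply: (@lt_le_trans _ _ (\int[leb]_(x in `[1%R, 2%R]) (expR (- (t * 4)))%:E)%E).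
  rewrite integral_cst//= lebesgue_measure_itv/= lte_fin ltr1n/=.
  rewrite -EFinB -EFinM lte_fin mulr_gt0 ?expR_gt0// subr_gt0 ltr1n//.
apply: (@le_trans _ _ (\int[leb]_(x in `[1%R, 2%R]) (gauss_moment_fun p t x)%:E)%E).
  apply: ge0_le_integral => //=.
  - apply/measurable_EFinP; apply: measurable_funTS.
    exact: measurable_gauss_moment_fun.
  - move=> x; rewrite in_itv/= => /andP[x1 x2]; rewrite lee_fin.
    rewrite /gauss_moment_fun -[X in X <= _]mul1r ler_pM ?expR_ge0//.
      by rewrite -(powRr0 x) ler_powR.
    rewrite ler_expR lerN2 ler_wpM2l// ?(ltW t0)//.
    have -> : 4 = 2 ^+ 2 :> R by rewrite expr2 -natrM.
    by rewrite lerXn2r// nnegrE// (le_trans _ x1).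
apply: ge0_subset_integral => //=.
- apply/measurable_EFinP; apply: measurable_funTS.
  exact: measurable_gauss_moment_fun.
- by move=> x _; rewrite lee_fin gauss_moment_fun_ge0.
- by move=> x/=; rewrite !in_itv/= andbT => /andP[x1 _]; rewrite (lt_le_trans _ x1).
Qed.

Lemma continuous_gauss_moment_fun p t x : 0 < x ->
  {for x, continuous (gauss_moment_fun p t)}.
Proof.
move=> x0.
have c1 : {for x, continuous (@powR R ^~ p)}.
  apply: differentiable_continuous; apply/derivable1_diffP.
  by apply: derivable_powR; rewrite in_itv/= andbT.
have c2 : {for x, continuous (fun x : R => expR (- (t * x ^+ 2)))}.
  apply: (@continuous_comp _ _ _ (fun x : R => - (t * x ^+ 2)) expR); last exact: continuous_expR.
  by apply: cvgN; apply: cvgMr; exact: exprn_continuous.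
exact: (cvgM c1 c2).
Qed.

Lemma gauss_moment_fun_cvg0 p t : 0 < p ->
  gauss_moment_fun p t x @[x --> 0^'+] --> 0.
Proof.
move=> p0; rewrite -[X in _ --> X](mul0r (expR (- (t * 0 ^+ 2)))).
apply: cvgM; first exact: powR_cvg0.
apply: cvg_at_right_filter.
apply: (@continuous_comp _ _ _ (fun x => - (t * x ^+ 2)) expR); last exact: continuous_expR.
by apply: cvgN; apply: cvgMr; exact: exprn_continuous.
Qed.

Lemma gauss_moment_fun0 p t : 0 < p -> gauss_moment_fun p t 0 = 0.
Proof. by move=> p0; rewrite /gauss_moment_fun powR0 ?mul0r// gt_eqF. Qed.

Lemma powRD_gt0 (x r s : R) : 0 < x -> x `^ (r + s) = x `^ r * x `^ s.
Proof. by move=> x0; rewrite powRD// (gt_eqF x0) implybT. Qed.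

Lemma is_derive_gauss_moment_fun p t x : 0 < x ->
  is_derive x 1 (gauss_moment_fun (p + 1) t)
    ((p + 1) * gauss_moment_fun p t x - 2 * t * gauss_moment_fun (p + 2) t x).
Proof.
move=> x0; rewrite /gauss_moment_fun.
have h1 : is_derive x (1 : R) (fun x : R => x `^ (p + 1)) ((p + 1) * x `^ (p + 1 - 1)).
  exact: is_derive1_powR.
have h3 : is_derive x (1 : R) (fun x : R => - (t * x ^+ 2)) (- (t * (2 * x))).
  apply: is_derive_eq.
  by rewrite /GRing.scale/= !mulr1 -mulr2n mulr_natl.
have h2 : is_derive x (1 : R) (expR \o (fun x : R => - (t * x ^+ 2)))
   (- (t * (2 * x)) * expR (- (t * x ^+ 2))).
  by rewrite mulrC; apply: is_derive1_comp.
have h := is_deriveM h1 h2.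
apply: is_derive_eq.
rewrite addrK /= /GRing.scale/=.
have -> : x `^ (p + 1) = x `^ p * x.
  by rewrite powRD_gt0// powRr1// ltW.
have -> : x `^ (p + 2) = x `^ p * x ^+ 2.
  by rewrite powRD_gt0// powR_mulrn// ltW.
ring.
Qed.

(** Integration by parts.  The exponential [K exp (- x)] is added to the integrand
    to make it nonnegative, which puts the fundamental theorem of calculus for
    nonnegative integrands on half-lines within reach. *)
Lemma gauss_momentS p t : 0 < p -> 0 < t ->
  ((p + 1)%:E * gauss_moment p t = (2 * t)%:E * gauss_moment (p + 2) t)%E.
Proof.
move=> p0 t0; have p20 : 0 <= p + 2 by lra.
have p10 : 0 <= p + 1 by lra.
have [C C0 CP] := gauss_moment_fun_le p20 t0.
have [C1 C10 C1P] := gauss_moment_fun_le p10 t0.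
pose K := 2 * t * C.
have K0 : 0 < K by rewrite !mulr_gt0.
pose f x := (p + 1) * gauss_moment_fun p t x -
  2 * t * gauss_moment_fun (p + 2) t x + K * expR (- x).
pose F x := gauss_moment_fun (p + 1) t x - K * expR (- x).
have f0 x : 0 <= x -> 0 <= f x.
  move=> x0; rewrite /f -addrA addr_ge0//.
    by rewrite mulr_ge0 ?gauss_moment_fun_ge0.
  by rewrite addrC subr_ge0 /K -!mulrA !ler_wpM2l// ?CP// ltW.
have cexp x : {for x, continuous (fun x : R => K * expR (- x))}.
  apply: cvgMr; apply: (@continuous_comp _ _ _ (-%R) expR); [exact: opp_continuous|exact: continuous_expR].
have cf x : 0 < x -> {for x, continuous f}.
  move=> x0.
  have cg c q : {for x, continuous (fun x : R => c * gauss_moment_fun q t x)}.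
    by apply: cvgMr; exact: continuous_gauss_moment_fun.
  exact: (cvgD (cvgB (cg _ _) (cg _ _)) (cexp x)).
have F0 : F 0 = - K.
  by rewrite /F gauss_moment_fun0 ?oppr0 ?expR0 ?mulr1 ?sub0r//; lra.
have mexp : measurable_fun (`]0%R, +oo[%classic : set R) (fun x : R => (K * expR (- x))%:E).
  apply/measurable_EFinP; apply: measurable_funTS; apply: measurable_funM => //.
  exact: measurableT_comp.
have mgm c q : measurable_fun (`]0%R, +oo[%classic : set R) (fun x : R => (c * gauss_moment_fun q t x)%:E).
  apply/measurable_EFinP; apply: measurable_funTS; apply: measurable_funM => //.
  exact: measurable_gauss_moment_fun.
have mf : measurable_fun (`]0%R, +oo[%classic : set R) (fun x : R => (f x)%:E).
  apply/measurable_EFinP; apply: measurable_funD.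
    by apply: measurable_funB; apply/measurable_EFinP; exact: mgm.
  exact/measurable_EFinP.
have If : (\int[leb]_(x in `]0%R, +oo[) (f x)%:E = K%:E)%E.
  rewrite integral_itv_obnd_cbnd//.
  have -> : (K%:E = 0%:E - (F 0)%:E)%E by rewrite F0 -EFinB opprK add0r.
  apply: ge0_continuous_FTC2y => //.
  - apply/continuous_within_itvcyP; split; first by move=> x; rewrite in_itv/= andbT; exact: cf.
    rewrite /f gauss_moment_fun0// gauss_moment_fun0; last lra.
    apply: cvgD; last by apply: cvg_at_right_filter; exact: cexp.
    by apply: cvgB; apply: cvgMr; apply: gauss_moment_fun_cvg0 => //; lra.
  - rewrite -[X in _ --> X](subr0 0); apply: cvgB; last first.
      by rewrite -(mulr0 K); apply: cvgMr; exact: cvgr_expR.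
    apply: (@squeeze_cvgr _ _ _ _ (fun=> 0) (fun x => C1 * expR (- x))).
    + near=> x; rewrite gauss_moment_fun_ge0/= C1P//; near: x; exact: nbhs_pinfty_ge.
    + exact: cvg_cst.
    + by rewrite -(mulr0 C1); apply: cvgMr; exact: cvgr_expR.
  - move=> x x0; have := is_derive_gauss_moment_fun p t x0 => dG.
    exact: ex_derive.
  - rewrite F0 -[- K]add0r; apply: cvgB; first by apply: gauss_moment_fun_cvg0; lra.
    have : K * expR (- x) @[x --> 0^'+] --> K * expR (- (0 : R)).
      by apply: cvg_at_right_filter; exact: cexp.
    by rewrite oppr0 expR0 mulr1.
  - move=> x; rewrite in_itv/= andbT => x0.
    have := is_derive_gauss_moment_fun p t x0 => dG.
    by rewrite derive1E derive_val /f /GRing.scale/=; ring.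
have e1 : (\int[leb]_(x in `]0%R, +oo[) (f x + 2 * t * gauss_moment_fun (p + 2) t x)%:E
   = K%:E + (2 * t)%:E * gauss_moment (p + 2) t)%E.
  under eq_integral do rewrite EFinD.
  rewrite ge0_integralD//=.
  - rewrite If; congr (_ + _)%E.
    under eq_integral do rewrite EFinM.
    rewrite ge0_integralZl//=.
    + apply/measurable_EFinP; apply: measurable_funTS; exact: measurable_gauss_moment_fun.
    + by move=> x _; rewrite lee_fin gauss_moment_fun_ge0.
    + by rewrite lee_fin mulr_ge0// ltW.
  - by move=> x; rewrite in_itv/= andbT => x0; rewrite lee_fin f0// ltW.
  - move=> x _; rewrite lee_fin; apply: mulr_ge0; last exact: gauss_moment_fun_ge0.
    by rewrite mulr_ge0// ltW.
  - exact: mgm.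
have e2 : (\int[leb]_(x in `]0%R, +oo[) (f x + 2 * t * gauss_moment_fun (p + 2) t x)%:E
   = K%:E + (p + 1)%:E * gauss_moment p t)%E.
  have fE x : f x + 2 * t * gauss_moment_fun (p + 2) t x =
    K * expR (- x) + (p + 1) * gauss_moment_fun p t x by rewrite /f; ring.
  under eq_integral do rewrite fE EFinD.
  rewrite ge0_integralD//=.
  - congr (_ + _)%E.
      under eq_integral do rewrite EFinM.
      rewrite ge0_integralZl//=.
      + by rewrite integral_expRN mule1.
      + by apply/measurable_EFinP; apply: measurable_funTS; apply: measurableT_comp.
      + by rewrite lee_fin ltW.
    under eq_integral do rewrite EFinM.
    rewrite ge0_integralZl//=.
    + apply/measurable_EFinP; apply: measurable_funTS; exact: measurable_gauss_moment_fun.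
    + by move=> x _; rewrite lee_fin gauss_moment_fun_ge0.
  - by move=> x _; rewrite lee_fin mulr_ge0 ?expR_ge0// ltW.
  - move=> x _; rewrite lee_fin; apply: mulr_ge0; last exact: gauss_moment_fun_ge0.
    by lra.
  - exact: mgm.
have := e2; rewrite e1 -(fineK (gauss_moment_fin_num (ltW p0) t0)).
by rewrite -(fineK (gauss_moment_fin_num p20 t0)) -!EFinM -!EFinD => -[/addrI ->].
Unshelve. all: end_near. Qed.

(** Isolates the possible singularity at 0, so that substitution on closed
    half-lines applies. *)
Lemma cvg_integral_oy (f : R -> R) (e : nat -> R) :
  (forall x, 0 < x -> 0 <= f x) -> measurable_fun setT f ->
  (forall n, 0 < e n) -> {homo e : m n / (m <= n)%N >-> n <= m} ->
  e n @[n --> \oo] --> 0 ->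
  (\int[leb]_(x in `[e n, +oo[) (f x)%:E @[n --> \oo] -->
   \int[leb]_(x in `]0%R, +oo[) (f x)%:E)%E.
Proof.
move=> f0 mf e0 eni ecvg.
have -> : `]0%R, +oo[%classic = \bigcup_n (`[e n, +oo[%classic : set R).
  apply/seteqP; split=> x /=; rewrite in_itv/= andbT; last first.
    by move=> [n _] /=; rewrite in_itv/= andbT; exact: lt_le_trans.
  move=> x0; have : \forall n \near \oo, e n <= x.
    by apply: (cvgr_le 0).
  by move=> [N _ HN]; exists N => //=; rewrite in_itv/= andbT; apply: HN => /=.
apply: ge0_nondecreasing_set_cvg_integral => //.
- move=> m n mn; rewrite subsetEset => x /=; rewrite !in_itv/= !andbT.
  by apply: le_trans; exact: eni.
- by move=> n; apply/measurable_EFinP; apply: measurable_funTS.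
- move=> n x /=; rewrite in_itv/= andbT => ex; rewrite lee_fin f0//.
  exact: lt_le_trans ex.
Qed.

Definition Gamma_integral (s : R) : \bar R :=
  (\int[leb]_(u in `]0%R, +oo[) (u `^ (s - 1) * expR (- u))%:E)%E.

Lemma cvgy_powR_half : (fun u : R => u `^ (2^-1)) x @[x --> +oo] --> +oo.
Proof.
apply/cvgryPge => A; near=> u.
have [A0|A0] := leP A 0; first by rewrite (le_trans A0)// powR_ge0.
have -> : A = (A ^+ 2) `^ 2^-1.
  by rewrite -powR_mulrn ?(ltW A0)// -powRrM mulfV// powRr1// ltW.
apply: ge0_ler_powR; rewrite ?nnegrE ?invr_ge0 ?sqr_ge0//.
Unshelve. all: end_near. Qed.

Lemma cvgy_powRN_half : (fun u : R => u `^ (- 2^-1)) x @[x --> +oo] --> 0.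
Proof.
apply: (@cvg_trans _ ((fun u : R => (u `^ (2^-1))^-1) x @[x --> +oo])).
  by apply: near_eq_cvg; near=> u; rewrite powRN.
apply/gtr0_cvgV0.
  by near=> u; rewrite powR_gt0//; near: u; exact: nbhs_pinfty_gt.
exact: cvgy_powR_half.
Unshelve. all: end_near. Qed.

(** The substitution [u = t x^2], on the half-lines that exhaust the open one. *)
Lemma Gamma_gauss_moment s t : 2^-1 < s -> 0 < t ->
  (Gamma_integral s = (2 * t `^ s)%:E * gauss_moment (2 * s - 1) t)%E.
Proof.
move=> s0 t0.
pose h (u : R) := u `^ (s - 1) * expR (- u).
pose G x := 2 * t `^ s * gauss_moment_fun (2 * s - 1) t x.
pose F (u : R) := t `^ (- 2^-1) * u `^ 2^-1.
have t20 : 0 < t `^ (- 2^-1) by exact: powR_gt0.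
have tt : t `^ (- 2^-1) ^+ 2 = t^-1.
  by rewrite -powR_mulrn ?powR_ge0// -powRrM mulNr mulVf// powR_inv1// ltW.
pose F' (u : R) := t `^ (- 2^-1) * (2^-1 * u `^ (2^-1 - 1)).
have dF (u : R) : 0 < u -> is_derive u (1 : R) F (F' u).
  move=> u0; have := is_derive1_powR 2^-1 u0 => du.
  by rewrite /F; apply: is_derive_eq.
have F'E (u : R) : 0 < u -> F^`()%classic u = F' u.
  by move=> u0; have := dF _ u0 => dFu; rewrite derive1E derive_val.
have cpow q (u : R) : 0 < u -> {for u, continuous (fun u : R => u `^ q)}.
  move=> u0; apply: differentiable_continuous; apply/derivable1_diffP.
  by apply: derivable_powR; rewrite in_itv/= andbT.
have cF' (u : R) : 0 < u -> {for u, continuous F'}.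
  by move=> u0; apply: cvgMr; apply: cvgMr; exact: cpow.
have cF (u : R) : 0 < u -> {for u, continuous F}.
  by move=> u0; apply: cvgMr; exact: cpow.
pose d (n : nat) : R := n.+1%:R^-1.
have d0 n : 0 < d n by rewrite invr_gt0.
have dni : {homo d : m n / (m <= n)%N >-> n <= m}.
  by move=> m n mn; rewrite lef_pV2 ?posrE// ler_nat.
have dcvg : d n @[n --> \oo] --> 0 by exact: cvg_harmonic.
pose e n := t * d n ^+ 2.
have e0 n : 0 < e n by rewrite mulr_gt0// exprn_gt0.
have eni : {homo e : m n / (m <= n)%N >-> n <= m}.
  by move=> m n mn; rewrite ler_wpM2l ?(ltW t0)// lerXn2r ?nnegrE ?(ltW (d0 _))// dni.
have ecvg : e n @[n --> \oo] --> 0.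
  rewrite -[X in _ --> X](mulr0 t); apply: cvgMr.
  rewrite -[X in _ --> X](mulr0 (0:R)); under eq_fun do rewrite expr2.
  exact: cvgM.
have Fe n : F (e n) = d n.
  rewrite /F /e powRM ?sqr_ge0 ?(ltW t0)// mulrA -powRD_gt0// addNr powRr0 mul1r.
  by rewrite -powR_mulrn ?(ltW (d0 _))// -powRrM mulfV// powRr1// ltW.
have step n : (\int[leb]_(x in `[d n, +oo[) (G x)%:E =
    \int[leb]_(u in `[e n, +oo[) (h u)%:E)%E.
  rewrite -Fe increasing_ge0_integration_by_substitutiony.
  - apply: eq_integral => u; rewrite inE/= in_itv/= andbT => eu.
    have u0 : 0 < u by exact: lt_le_trans eu.
    have -> : ((G \o F) * F^`()%classic) u = G (F u) * F' u by rewrite -F'E.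
    congr EFin; rewrite /G /gauss_moment_fun /F' /h.
    have -> : t * F u ^+ 2 = u.
      rewrite exprMn tt mulrA divff ?gt_eqF// mul1r.
      by rewrite -powR_mulrn ?powR_ge0// -powRrM mulVf// powRr1// ltW.
    rewrite /F powRM ?powR_ge0// -!powRrM.
    have -> : t `^ (- 2^-1 * (2 * s - 1)) = t `^ (- s) * t `^ 2^-1.
      by rewrite -powRD_gt0//; congr (_ `^ _); field.
    have -> : u `^ (2^-1 * (2 * s - 1)) = u `^ (s - 1) * u `^ 2^-1.
      by rewrite -powRD_gt0//; congr (_ `^ _); field.
    have -> : u `^ (2^-1 - 1) = (u `^ 2^-1)^-1.
      by rewrite -powRN; congr (_ `^ _); field.
    rewrite !powRN; field.
    by rewrite !gt_eqF ?powR_gt0.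
  - move=> x y; rewrite !in_itv/= !andbT => ex ey xy.
    rewrite /F ltr_pM2l//; apply: gt0_ltr_powR => //; rewrite nnegrE.
      exact/ltW/(lt_le_trans _ ex).
    exact/ltW/(lt_le_trans _ ey).
  - move=> u; rewrite in_itv/= andbT => eu.
    have u0 : 0 < u by exact: lt_trans eu.
    rewrite /continuous_at F'E//.
    apply: (@cvg_trans _ (F' x @[x --> u])); last exact: cF'.
    apply: near_eq_cvg; near=> z.
    by rewrite F'E//; near: z; exact: lt_nbhsr.
  - apply/cvg_ex; exists (F' (e n)).
    apply: (@cvg_trans _ (F' x @[x --> (e n)^'+])).
      apply: near_eq_cvg; near=> z.
      by rewrite F'E// (lt_trans (e0 n))//; near: z; exact: nbhs_right_gt.
    by apply: cvg_at_right_filter; exact: cF'.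
  - apply/cvg_ex; exists 0.
    apply: (@cvg_trans _ (F' x @[x --> +oo])).
      apply: near_eq_cvg; near=> z.
      by rewrite F'E//; near: z; exact: nbhs_pinfty_gt.
    rewrite -(mulr0 (t `^ (- 2^-1))); apply: cvgMr.
    rewrite -[X in _ --> X](mulr0 2^-1); apply: cvgMr.
    have -> : 2^-1 - 1 = - 2^-1 :> R by field.
    exact: cvgy_powRN_half.
  - split.
      move=> x; rewrite in_itv/= andbT => ex.
      by have := dF _ (lt_trans (e0 n) ex) => dFx; exact: ex_derive.
    by apply: cvg_at_right_filter; exact: cF.
  - by apply: gt0_cvgMry => //; exact: cvgy_powR_half.
  - have Fe0 : 0 < F (e n) by rewrite Fe.
    have cG x : 0 < x -> {for x, continuous G}.
      by move=> x0; apply: cvgMr; exact: continuous_gauss_moment_fun.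
    apply/continuous_within_itvcyP; split.
      by move=> x; rewrite in_itv/= andbT => Fx; apply: cG; exact: lt_trans Fx.
    by apply: cvg_at_right_filter; exact: cG.
  - move=> x _; apply: mulr_ge0; last exact: gauss_moment_fun_ge0.
    by rewrite mulr_ge0 ?powR_ge0.
have mG : measurable_fun setT G.
  by apply: measurable_funM => //; exact: measurable_gauss_moment_fun.
have G0 x : 0 < x -> 0 <= G x.
  by move=> x0; apply: mulr_ge0; rewrite ?gauss_moment_fun_ge0// mulr_ge0 ?powR_ge0.
have mh : measurable_fun setT h.
  apply: measurable_funM; first exact: measurable_powR.
  by apply: measurableT_comp.
have c1 := cvg_integral_oy G0 mG d0 dni dcvg.
have h0 x : 0 < x -> 0 <= h x by move=> _; rewrite mulr_ge0 ?powR_ge0 ?expR_ge0.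
have c2 := cvg_integral_oy h0 mh e0 eni ecvg.
transitivity (\int[leb]_(x in `]0%R, +oo[) (G x)%:E)%E.
  rewrite -(cvg_lim _ c1)// /Gamma_integral -(cvg_lim _ c2)//.
  by congr (limn _); apply/funext => n; rewrite step.
rewrite /G; under eq_integral do rewrite EFinM.
rewrite ge0_integralZl//=.
- by apply/measurable_EFinP; apply: measurable_funTS; exact: measurable_gauss_moment_fun.
- by move=> x _; rewrite lee_fin gauss_moment_fun_ge0.
- by rewrite lee_fin mulr_ge0 ?powR_ge0.
Unshelve. all: end_near. Qed.

Lemma Gamma_fin s t : 2^-1 < s -> 0 < t ->
  (gauss_moment (2 * s - 1) t = (Gamma s / (2 * t `^ s))%:E)%E.
Proof.
move=> s0 t0; have p0 : 0 <= 2 * s - 1 by lra.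
have c0 : 2 * t `^ s != 0 by rewrite mulf_neq0// gt_eqF// powR_gt0.
rewrite -[LHS](fineK (gauss_moment_fin_num p0 t0)); congr EFin.
apply: (@mulIf _ (2 * t `^ s)) => //; rewrite divfK//.
rewrite /Gamma /Rintegral -/(Gamma_integral s) (Gamma_gauss_moment s0 t0).
by rewrite -(fineK (gauss_moment_fin_num p0 t0)) -EFinM /= mulrC.
Qed.

Lemma Gamma_gt0 s : 2^-1 < s -> 0 < Gamma s :> R.
Proof.
move=> s0; have p0 : 0 <= 2 * s - 1 by lra.
have := gauss_moment_gt0 p0 (@ltr01 R).
by rewrite Gamma_fin// lte_fin powR1 mulr1 pmulr_lgt0// invr_gt0.
Qed.

Lemma GammaS s : 2^-1 < s -> Gamma (s + 1) = s * Gamma s :> R.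
Proof.
move=> s0; have p0 : 0 < 2 * s - 1 by lra.
have := gauss_momentS p0 (@ltr01 R).
have -> : 2 * s - 1 + 2 = 2 * (s + 1) - 1 by ring.
rewrite !Gamma_fin//; last lra.
rewrite !powR1 -!EFinM !mulr1 => -[]; rewrite [RHS]mulrC divfK// => <-.
by field.
Qed.

(** The rising factorial (Pochhammer symbol). *)
Definition poch s k : R := \prod_(i < k) (s + i%:R).

Lemma poch0 s : poch s 0 = 1.
Proof. by rewrite /poch big_ord0. Qed.

Lemma pochS s k : poch s k.+1 = poch s k * (s + k%:R).
Proof. by rewrite /poch big_ord_recr. Qed.

Lemma pochSl s k : poch s k.+1 = s * poch (s + 1) k.
Proof.
rewrite /poch big_ord_recl addr0; congr (_ * _); apply: eq_bigr => i _.
by rewrite /= /bump/= natrD addrA.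
Qed.

Lemma poch_gt0 s k : 0 < s -> 0 < poch s k.
Proof. by move=> s0; apply: prodr_gt0 => i _; rewrite ltr_wpDr. Qed.

Lemma poch_ge s k : 2^-1 <= s -> 2^-1 ^+ k <= poch s k.
Proof.
move=> s0; elim: k => [|k IH]; first by rewrite poch0 expr0.
by rewrite pochS exprSr ler_pM ?exprn_ge0// ler_wpDr.
Qed.

Lemma Gamma_poch s k : 2^-1 < s -> Gamma (s + k%:R) = poch s k * Gamma s :> R.
Proof.
move=> s0; elim: k => [|k IH]; first by rewrite addr0 poch0 mul1r.
rewrite -natr1 addrA GammaS; last by rewrite ltr_wpDr.
by rewrite IH pochS mulrCA mulrA.
Qed.

End gauss_moments.

(** * The normalized Bessel function as an entire function *)

Section bessel_series.
Context (R : realType).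
Implicit Types c x z : R.

(** [bessel0F1 c z] is the hypergeometric function 0F1 (; c; - z / 4).  With
    [c = nu + 1] its value at [x^2] is the normalized Bessel function of order [nu],
    and at [- x^2] it is the modified one; one series serves both. *)
Definition coef0F1 c k : R := (- 4^-1) ^+ k / (k`!%:R * poch c k).

Definition bessel0F1 c z : R := limn (pseries (coef0F1 c) z).

Lemma fact_neq0 k : k`!%:R != 0 :> R.
Proof. by rewrite pnatr_eq0 -lt0n fact_gt0. Qed.

Lemma norm_coef0F1_le c k z : 2^-1 <= c ->
  `|coef0F1 c k * z ^+ k| <= exp_coeff (`|z| / 2) k.
Proof.
move=> c0; have p0 : 0 < poch c k by apply: poch_gt0; lra.
have f0 : 0 < k`!%:R :> R by rewrite ltr0n fact_gt0.
rewrite /coef0F1 /exp_coeff/= normrM normf_div !normrX normrN.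
rewrite (ger0_norm (mulr_ge0 (ltW f0) (ltW p0))) (@ger0_norm _ 4^-1)//.
rewrite mulrAC -exprMn invfM mulrA ler_pdivrMr//.
rewrite [X in _ <= X * _](_ : _ = (4^-1 * `|z|) ^+ k * 2 ^+ k / k`!%:R); last first.
  by congr (_ / _); rewrite -exprMn; congr (_ ^+ _); field.
rewrite -[X in X <= _]mulr1 -!mulrA ler_wpM2l ?exprn_ge0 ?mulr_ge0//.
rewrite [X in _ <= X]mulrCA ler_wpM2l ?invr_ge0 ?(ltW f0)//.
rewrite -ler_pdivrMl ?exprn_gt0// mulr1 -exprVn; exact: poch_ge.
Qed.

Lemma is_cvg_norm_coef0F1 c z : 2^-1 <= c ->
  cvgn (series (fun k => `|coef0F1 c k * z ^+ k|)).
Proof.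
move=> c0; apply: (@series_le_cvg _ _ (exp_coeff (`|z| / 2))) => //=.
- by move=> k; rewrite divr_ge0// exprn_ge0// divr_ge0.
- by move=> k; exact: norm_coef0F1_le.
- exact: is_cvg_series_exp_coeff.
Qed.

Lemma is_cvg_coef0F1 c z : 2^-1 <= c -> cvgn (pseries (coef0F1 c) z).
Proof. by move=> c0; apply: normed_cvg; exact: is_cvg_norm_coef0F1. Qed.

Lemma bessel0F1_cvg c z : 2^-1 <= c -> pseries (coef0F1 c) z @ \oo --> bessel0F1 c z.
Proof. exact: is_cvg_coef0F1. Qed.

Lemma coef0F1_0 c : coef0F1 c 0 = 1.
Proof. by rewrite /coef0F1 expr0 fact0 poch0 mulr1 divr1. Qed.

Lemma bessel0F1_0 c : bessel0F1 c 0 = 1.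
Proof.
rewrite /bessel0F1; apply/cvg_lim => //; rewrite -(cvg_shiftS _).
rewrite (_ : [sequence _]_n = cst 1); first exact: cvg_cst.
apply/funext => n/=; rewrite /pseries /series/= big_nat_recl//= expr0 mulr1 coef0F1_0.
by rewrite big1 ?addr0// => i _; rewrite exprS mul0r mulr0.
Qed.

Lemma diffs_coef0F1 c : 0 < c ->
  pseries_diffs (coef0F1 c) = (fun k => - (4 * c)^-1 * coef0F1 (c + 1) k).
Proof.
move=> c0; apply/funext => k; rewrite /pseries_diffs /coef0F1 factS exprS pochSl natrM.
have p0 : poch (c + 1) k != 0 by rewrite gt_eqF// poch_gt0// ltr_wpDr.
have k0 : k.+1%:R != 0 :> R by rewrite pnatr_eq0.
move: (k.+1%:R : R) k0 => K K0.
by field; rewrite fact_neq0 p0 K0 gt_eqF.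
Qed.

Lemma cvg_pseriesZ (f : nat -> R) a z l : pseries f z @ \oo --> l ->
  pseries (fun k => a * f k) z @ \oo --> a * l.
Proof.
move=> fl; rewrite (_ : pseries _ z = (fun n => a * pseries f z n)); first exact: cvgMr.
apply/funext => n; rewrite /pseries /series/= mulr_sumr.
by apply: eq_bigr => i _; rewrite mulrA.
Qed.

Lemma is_derive_bessel0F1 c z : 2^-1 <= c ->
  is_derive z (1 : R) (bessel0F1 c) (- (4 * c)^-1 * bessel0F1 (c + 1) z).
Proof.
move=> c0; have cp : 0 < c by lra.
have c1 : 2^-1 <= c + 1 by lra.
have c2 : 2^-1 <= c + 1 + 1 by lra.
have cp1 : 0 < c + 1 by lra.
have E w : limn (pseries (pseries_diffs (coef0F1 c)) w) = - (4 * c)^-1 * bessel0F1 (c + 1) w.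
  rewrite diffs_coef0F1//; apply/cvg_lim => //; apply: cvg_pseriesZ; exact: bessel0F1_cvg.
rewrite -E.
apply: (@pseries_snd_diffs _ _ (`|z| + 1)).
- exact: is_cvg_coef0F1.
- by rewrite diffs_coef0F1//; apply: cvgP; apply: cvg_pseriesZ; exact: bessel0F1_cvg.
- rewrite diffs_coef0F1//.
  rewrite (_ : pseries_diffs _ = (fun k => - (4 * c)^-1 * pseries_diffs (coef0F1 (c + 1)) k)); last first.
    by apply/funext => k; rewrite /pseries_diffs mulrCA.
  rewrite diffs_coef0F1//; apply: cvgP; apply: cvg_pseriesZ; apply: cvg_pseriesZ.
  exact: bessel0F1_cvg.
- by rewrite [X in _ < X]ger0_norm ?addr_ge0// ltrDl.
Qed.

(** The contiguity relation plays the part of Bessel's differential equation. *)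
Lemma bessel0F1_contiguous c z : 2^-1 <= c ->
  z / (4 * c * (c + 1)) * bessel0F1 (c + 2) z = bessel0F1 (c + 1) z - bessel0F1 c z.
Proof.
move=> c0; have cp : 0 < c by lra.
have c1 : 2^-1 <= c + 1 by lra.
have c2 : 2^-1 <= c + 2 by lra.
have h1 : pseries (coef0F1 (c + 1)) z n.+1 - pseries (coef0F1 c) z n.+1 @[n --> \oo] -->
    bessel0F1 (c + 1) z - bessel0F1 c z.
  by apply: cvgB; rewrite (cvg_shiftS (pseries _ z)); exact: bessel0F1_cvg.
have h2 : z / (4 * c * (c + 1)) * pseries (coef0F1 (c + 2)) z n @[n --> \oo] -->
   z / (4 * c * (c + 1)) * bessel0F1 (c + 2) z.
  by apply: cvgMr; exact: bessel0F1_cvg.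
apply: cvg_unique h2 _ => //.
suff -> : (fun n => z / (4 * c * (c + 1)) * pseries (coef0F1 (c + 2)) z n) =
  (fun n => pseries (coef0F1 (c + 1)) z n.+1 - pseries (coef0F1 c) z n.+1) by [].
apply/funext => n; rewrite /pseries /series/= -sumrB big_nat_recl// !coef0F1_0 subrr add0r.
rewrite mulr_sumr; apply: eq_bigr => k _.
rewrite -mulrBl /coef0F1 factS natrM [poch c _]pochSl pochS.
have E : (c + 1) * poch (c + 2) k = poch (c + 1) k * (c + 1 + k%:R).
  rewrite -pochS pochSl; congr (_ * poch _ _); ring.
have p2 : poch (c + 2) k != 0 by rewrite gt_eqF// poch_gt0//; lra.
have p1 : poch (c + 1) k != 0 by rewrite gt_eqF// poch_gt0//; lra.
have ck : c + 1 + k%:R != 0 by rewrite gt_eqF// ltr_wpDr//; lra.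
have c1' : c + 1 != 0 by rewrite gt_eqF//; lra.
have -> : poch (c + 2) k = poch (c + 1) k * (c + 1 + k%:R) / (c + 1).
  by rewrite -E mulrAC divff// mul1r.
have k0 : k.+1%:R != 0 :> R by rewrite pnatr_eq0.
rewrite !exprS -natr1 in k0 *.
by field; rewrite fact_neq0 p1 ck c1' k0 gt_eqF.
Qed.

Lemma continuous_bessel0F1 c : 2^-1 <= c -> continuous (bessel0F1 c).
Proof.
move=> c0 z; apply: differentiable_continuous; apply/derivable1_diffP.
by have := is_derive_bessel0F1 z c0 => ?; exact: ex_derive.
Qed.

Lemma measurable_bessel0F1 c : 2^-1 <= c -> measurable_fun setT (bessel0F1 c).
Proof. by move=> c0; apply: continuous_measurable_fun; exact: continuous_bessel0F1. Qed.

(** The energy [E] below is nonincreasing: its derivative is a square times [1 - 2 c].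
    Since [E 0 = 1] and [E] dominates the square of the function, the bound follows. *)
Lemma bessel0F1_le1 c z : 2^-1 <= c -> 0 <= z -> `|bessel0F1 c z| <= 1.
Proof.
move=> c0 z0; have cp : 0 < c by lra.
have c1 : 2^-1 <= c + 1 by lra.
pose E w := bessel0F1 c w ^+ 2 + w / (4 * c ^+ 2) * bessel0F1 (c + 1) w ^+ 2.
have dE w : is_derive w (1 : R) E (bessel0F1 (c + 1) w ^+ 2 * (1 - 2 * c) / (4 * c ^+ 2)).
  have d1 := is_derive_bessel0F1 w c0; have d2 := is_derive_bessel0F1 w c1.
  rewrite /E; apply: is_derive_eq; rewrite /GRing.scale/=.
  have -> : c + 1 + 1 = c + 2 by ring.
  have := bessel0F1_contiguous w c0.
  move=> h; have -> : bessel0F1 c w = bessel0F1 (c + 1) w - w / (4 * c * (c + 1)) * bessel0F1 (c + 2) w.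
    by rewrite h; ring.
  by field; rewrite !gt_eqF//; lra.
have E1 : E z <= 1.
  have -> : 1 = E 0 by rewrite /E bessel0F1_0 mul0r mul0r addr0 expr1n.
  apply: (@ler0_derive1_le _ E 0 (z + 1) _ _ true true); rewrite ?in_itv/=.
  - by move=> x _; have := dE x => ?; exact: ex_derive.
  - move=> x _; have := dE x => ?; rewrite derive1E derive_val.
    rewrite mulr_le0_ge0//; last by rewrite invr_ge0 mulr_ge0// sqr_ge0.
    by rewrite mulr_ge0_le0 ?sqr_ge0//; lra.
  - apply: continuous_subspaceT => x; apply: differentiable_continuous; apply/derivable1_diffP.
    by have := dE x => ?; exact: ex_derive.
  - by rewrite z0/= ltrDl.
  - by rewrite lexx/= ltr_wpDl.
  - exact: z0.
have J1 : bessel0F1 c z ^+ 2 <= 1.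
  apply: le_trans E1; rewrite /E lerDl mulr_ge0 ?sqr_ge0// divr_ge0//.
  by rewrite mulr_ge0// sqr_ge0.
by rewrite -(@ler_pXn2r _ 2)// ?nnegrE// expr1n real_normK// num_real.
Qed.

Lemma bessel0F1N_ge0 c z : 2^-1 <= c -> 0 <= z -> 0 <= bessel0F1 c (- z).
Proof.
move=> c0 z0; rewrite /bessel0F1; apply: limr_ge; first exact: is_cvg_coef0F1.
near=> n; rewrite /pseries /series/=; apply: sumr_ge0 => k _.
rewrite /coef0F1 mulrAC -exprMn mulrNN divr_ge0//.
  by rewrite exprn_ge0// mulr_ge0.
by rewrite mulr_ge0// ltW// poch_gt0//; lra.
Unshelve. all: by end_near. Qed.

Lemma bessel_jE nu x : - 2^-1 < nu -> bessel_j nu x = bessel0F1 (nu + 1) (x ^+ 2).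
Proof.
move=> nu0; have c0 : 2^-1 <= nu + 1 by lra.
have c0' : 2^-1 < nu + 1 by lra.
have G0 : Gamma (nu + 1) != 0 :> R by rewrite gt_eqF// Gamma_gt0.
rewrite /bessel_j.
have -> : (fun k => (-1) ^+ k / (k`!%:R * Gamma (nu + k%:R + 1)) * (x / 2) ^+ (2 * k)) =
   (fun k => (Gamma (nu + 1))^-1 * (coef0F1 (nu + 1) k * (x ^+ 2) ^+ k)).
  apply/funext => k; rewrite addrAC Gamma_poch// /coef0F1.
  have p0 : poch (nu + 1) k != 0 by rewrite gt_eqF// poch_gt0//; lra.
  rewrite exprM expr_div_n (_ : x ^+ 2 / 2 ^+ 2 = (4^-1) * x ^+ 2); last by field.
  rewrite exprMn [(- 4^-1) ^+ k]exprNn; field.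
  by rewrite G0 p0 fact_neq0.
have h : series (fun k => (Gamma (nu + 1))^-1 * (coef0F1 (nu + 1) k * (x ^+ 2) ^+ k)) @ \oo
   --> (Gamma (nu + 1))^-1 * bessel0F1 (nu + 1) (x ^+ 2).
  rewrite (_ : series _ = (fun n => (Gamma (nu + 1))^-1 * pseries (coef0F1 (nu + 1)) (x ^+ 2) n)).
    by apply: cvgMr; exact: bessel0F1_cvg.
  by apply/funext => n; rewrite /pseries /series/= mulr_sumr.
by rewrite (cvg_lim _ h)// mulrA divff// mul1r.
Qed.

End bessel_series.

(** * Integration against a density *)

Section mdensity_integral.
Import HBNNSimple.
Context d (T : measurableType d) (R : realType).
Variables (mu : {sigma_finite_measure set T -> \bar R}) (D : set T) (w : T -> R).
Hypotheses (mD : measurable D) (mw : measurable_fun D w)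
  (w0 : forall x, D x -> 0 <= w x).
Local Notation nu := (mdensity mu mD mw w0).

Let mdensity_indic (A : set T) : measurable A ->
  (\int[nu]_x (\1_A x)%:E = \int[mu]_(x in D) ((w x)%:E * (\1_A x)%:E))%E.
Proof.
move=> mA; rewrite integral_indic// setIT /= /mdensity setIC integral_mkcondr.
apply: eq_integral => x xD; rewrite patchE indicE.
by case: ifPn => xA; rewrite ?mule1 ?mule0.
Qed.

(** Both sides agree on indicators; simple functions and monotone convergence do the
    rest. *)
Lemma ge0_integral_mdensity (f : T -> \bar R) :
  (forall x, 0 <= f x)%E -> measurable_fun setT f ->
  (\int[nu]_x f x = \int[mu]_(x in D) ((w x)%:E * f x))%E.
Proof.
move=> f0 mf; pose f_ := nnsfun_approx measurableT mf.
have mwE : measurable_fun D (EFin \o w) by exact/measurable_EFinP.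
have Hs (h : {nnsfun T >-> R}) :
    (\int[nu]_x (h x)%:E = \int[mu]_(x in D) ((w x)%:E * (h x)%:E))%E.
  have hb y x : (0 <= (y * \1_(h @^-1` [set y]) x)%:E)%E.
    by rewrite EFinM nnfun_muleindic_ge0.
  under [LHS]eq_integral do rewrite fimfunE -fsumEFin//.
  rewrite [LHS]ge0_integral_fsum//; last first.
    by move=> r; exact/measurable_EFinP/measurableT_comp.
  transitivity (\int[mu]_(x in D) (\sum_(y \in range h) ((w x)%:E * (y * \1_(h @^-1` [set y]) x)%:E)))%E; last first.
    apply: eq_integral => x _; rewrite [in RHS]fimfunE -fsumEFin//.
    by rewrite ge0_mule_fsumr// => y; rewrite EFinM nnfun_muleindic_ge0.
  rewrite [RHS]ge0_integral_fsum//; last 2 first.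
  - move=> y; apply: emeasurable_funM => //.
    by apply/measurable_EFinP; apply: measurable_funTS; exact: measurableT_comp.
  - by move=> n x Dx; apply: mule_ge0; [rewrite lee_fin w0|exact: hb].
  apply: eq_fsbigr => y /[!inE] -[x _ <-{y}].
  under [LHS]eq_integral do rewrite EFinM.
  rewrite ge0_integralZl//; last 2 first.
    by apply/measurable_EFinP; exact: measurable_indic.
    by rewrite lee_fin.
  rewrite mdensity_indic; last exact: measurable_funPTI.
  rewrite -ge0_integralZl//.
  - by apply: eq_integral => z _; rewrite EFinM muleCA.
  - apply: emeasurable_funM => //.
    by apply/measurable_EFinP; apply: measurable_funTS; exact: measurable_indic.
  - by move=> z Dz; rewrite mule_ge0 ?lee_fin ?w0.
  - by rewrite lee_fin.
transitivity (limn (fun n => \int[nu]_x (f_ n x)%:E)%E).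
  rewrite -monotone_convergence//=; last 3 first.
  - by move=> n; apply/measurable_EFinP.
  - by move=> n x _; rewrite lee_fin.
  - by move=> x _ m n mn; rewrite lee_fin; exact/lefP/nd_nnsfun_approx.
  apply: eq_integral => x _; apply/esym/cvg_lim => //.
  by apply: cvg_nnsfun_approx => //.
under eq_fun do rewrite Hs.
rewrite -monotone_convergence//=; last 3 first.
- move=> n; apply: emeasurable_funM => //.
  by apply/measurable_EFinP; exact: measurable_funTS.
- by move=> n x Dx; rewrite mule_ge0 ?lee_fin ?w0.
- move=> x Dx m n mn; rewrite lee_wpmul2l ?lee_fin ?w0//.
  exact/lefP/nd_nnsfun_approx.
apply: eq_integral => x /[!inE] Dx; apply/cvg_lim => //.
by apply: cvgeZl => //; exact: cvg_nnsfun_approx.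
Qed.

Lemma mdensity_setC : nu (~` D) = 0%E.
Proof. by rewrite /= /mdensity setICl integral_set0. Qed.

Lemma ae_mdensity : {ae nu, forall x, D x}.
Proof.
exists (~` D); split; [exact: measurableC|exact: mdensity_setC|].
by move=> x /=.
Qed.

End mdensity_integral.

(** * The one-dimensional Hankel measure and a Chu-Vandermonde identity *)

Section hankel_measure.
Context (R : realType).
Implicit Types nu x t : R.

(** The one-dimensional factor of the weight of the Bessel measure. *)
Definition hankel_weight nu x : R :=
  (2 `^ nu * Gamma (nu + 1))^-1 * x `^ (2 * nu + 1).

Lemma measurable_hankel_weight nu :
  measurable_fun (`]0%R, +oo[%classic : set R) (hankel_weight nu).
Proof.
by apply: measurable_funTS; apply: measurable_funM => //; exact: measurable_powR.
Qed.

Lemma hankel_weight_ge0 nu x : (`]0%R, +oo[%classic : set R) x ->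
  0 <= hankel_weight nu x.
Proof.
move=> _; rewrite mulr_ge0 ?powR_ge0// invr_ge0 mulr_ge0 ?powR_ge0//.
by apply: Rintegral_ge0 => t _; rewrite mulr_ge0 ?powR_ge0 ?expR_ge0.
Qed.

Definition hankel_measure nu := mdensity (@lebesgue_measure R)
  (measurable_itv `]0%R, +oo[) (measurable_hankel_weight nu)
  (@hankel_weight_ge0 nu).

HB.instance Definition _ nu := SigmaFiniteMeasure.on (hankel_measure nu).

Definition gauss_mon t k x : R := expR (- (t * x ^+ 2)) * (x ^+ 2) ^+ k.

Lemma gauss_mon_ge0 t k x : 0 <= gauss_mon t k x.
Proof. by rewrite mulr_ge0 ?expR_ge0// exprn_ge0 ?sqr_ge0. Qed.

Lemma measurable_gauss t : measurable_fun setT (fun x : R => expR (- (t * x ^+ 2))).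
Proof.
apply: measurableT_comp => //; apply: measurableT_comp => //.
by apply: measurable_funM => //; exact: measurable_funX.
Qed.

Lemma measurable_gauss_mon t k : measurable_fun setT (gauss_mon t k).
Proof.
apply: measurable_funM; first exact: measurable_gauss.
by apply: measurable_funX; exact: measurable_funX.
Qed.

Lemma integral_gauss_mon nu t k : - 2^-1 < nu -> 0 < t ->
  (\int[hankel_measure nu]_x (gauss_mon t k x)%:E =
   ((2 * t) `^ (- (nu + 1)) * (poch (nu + 1) k / t ^+ k))%:E)%E.
Proof.
move=> nu0 t0; rewrite ge0_integral_mdensity; last 2 first.
- by move=> x; rewrite lee_fin gauss_mon_ge0.
- by apply/measurable_EFinP; exact: measurable_gauss_mon.
pose c := (2 `^ nu * Gamma (nu + 1) : R)^-1.
pose s := nu + 1 + k%:R.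
have k0 : 0 <= k%:R :> R by rewrite ler0n.
have s0 : 2^-1 < s by rewrite /s; lra.
have c0 : 2^-1 < nu + 1 by lra.
transitivity (\int[lebesgue_measure]_(x in `]0%R, +oo[) (c%:E * (gauss_moment_fun (2 * s - 1) t x)%:E))%E.
  apply: eq_integral => x; rewrite inE/= in_itv/= andbT => x0.
  rewrite -!EFinM; congr EFin.
  rewrite /hankel_weight -/c /gauss_mon /gauss_moment_fun -mulrA; congr (_ * _).
  rewrite mulrCA mulrC; congr (_ * _).
  rewrite -exprM -powR_mulrn ?(ltW x0)// -powRD_gt0//; congr (_ `^ _).
  by rewrite natrM /s; ring.
rewrite ge0_integralZl//=.
- rewrite -/(gauss_moment _ _) Gamma_fin// -EFinM; congr EFin.
  rewrite /c /s Gamma_poch// powRD_gt0// powR_mulrn ?(ltW t0)// powRN powRM ?(ltW t0)//.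
  rewrite [2 `^ (nu + 1)]powRD_gt0// powRr1//.
  have G0 : Gamma (nu + 1) != 0 :> R by rewrite gt_eqF// Gamma_gt0.
  have t1 : t `^ (nu + 1) != 0 by rewrite gt_eqF// powR_gt0.
  have t2 : 2 `^ nu != 0 :> R by rewrite gt_eqF// powR_gt0.
  have t3 : t ^+ k != 0 by rewrite gt_eqF// exprn_gt0.
  by field; rewrite G0 t1 t2 t3.
- by apply/measurable_EFinP; apply: measurable_funTS; exact: measurable_gauss_moment_fun.
- by move=> x _; rewrite lee_fin gauss_moment_fun_ge0.
- by rewrite lee_fin invr_ge0 mulr_ge0 ?powR_ge0// ltW// Gamma_gt0.
Qed.

Lemma integrable_gauss_mon nu t k : - 2^-1 < nu -> 0 < t ->
  (hankel_measure nu).-integrable setT (EFin \o gauss_mon t k).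
Proof.
move=> nu0 t0; apply/integrableP; split.
  by apply/measurable_EFinP; exact: measurable_gauss_mon.
under eq_integral do rewrite /= ger0_norm ?gauss_mon_ge0//.
by rewrite integral_gauss_mon// ltry.
Qed.

End hankel_measure.

Section vandermonde.
Context (R : realType).
Implicit Types (c X : R) (k l j N : nat).

(** The value 0 for [j > k] makes both recurrences below hold for all indices. *)
Definition rfact k j : R := if (j <= k)%N then ((k - j)`!%:R)^-1 else 0.

Lemma rfactS k j : (k%:R + 1 - j%:R) * rfact k.+1 j = rfact k j.
Proof.
rewrite /rfact; case: (leqP j k) => jk.
  rewrite (leqW jk) subSn// factS natrM invfM.
  have -> : k%:R + 1 - j%:R = (k - j).+1%:R :> R.
    by rewrite -natr1 natrB//; ring.
  by rewrite mulrA divff ?mul1r// pnatr_eq0.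
case: ifPn => [jk1|_]; last by rewrite mulr0.
have -> : j = k.+1 by apply/eqP; rewrite eqn_leq jk1.
by rewrite -natr1 subrr mul0r.
Qed.

Lemma rfactSr k j : rfact k j.+1 = (k%:R - j%:R) * rfact k j.
Proof.
rewrite /rfact; case: ltnP => jk.
  rewrite (ltnW jk) -(subnSK jk) factS natrM invfM mulrA.
  have -> : k%:R - j%:R = (k - j.+1).+1%:R :> R.
    by rewrite subnSK// natrB// ltnW.
  by rewrite divff ?mul1r// pnatr_eq0.
case: ifPn => [jk1|_]; last by rewrite mulr0.
have -> : j = k by apply/eqP; rewrite eqn_leq jk1.
by rewrite subrr mul0r.
Qed.

Definition vand c N k l : R :=
  \sum_(0 <= j < N) rfact k j * rfact l j / (j`!%:R * poch c j).

(** Creative telescoping: [u j.+1 / u j] is rational in [j], and the recurrence in [k]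
    holds up to the difference [G j - G j.+1], whose sum vanishes. *)
Lemma vandS c N k l : 0 < c -> (k.+1 < N)%N ->
  (k%:R + 1) * (c + k%:R) * vand c N k.+1 l = (c + k%:R + l%:R) * vand c N k l.
Proof.
move=> c0 kN.
pose u j := rfact k.+1 j * rfact l j / (j`!%:R * poch c j).
pose G j := j%:R * (c + j%:R - 1) * u j.
have uS j : (j%:R + 1) * (c + j%:R) * u j.+1 = (k%:R + 1 - j%:R) * (l%:R - j%:R) * u j.
  rewrite /u !rfactSr factS natrM pochS -!natr1.
  have p0 : poch c j != 0 by rewrite gt_eqF// poch_gt0.
  have cj : c + j%:R != 0 by rewrite gt_eqF// ltr_wpDr.
  have j1 : j%:R + 1 != 0 :> R by rewrite natr1 pnatr_eq0.
  by field; rewrite fact_neq0 p0 cj j1.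
have step j : (k%:R + 1) * (c + k%:R) * u j -
   (c + k%:R + l%:R) * (rfact k j * rfact l j / (j`!%:R * poch c j)) = G j - G j.+1.
  rewrite -(rfactS k j) /G -natr1.
  rewrite (_ : (j%:R + 1) * (c + (j%:R + 1) - 1) * u j.+1 =
    (j%:R + 1) * (c + j%:R) * u j.+1); last by ring.
  rewrite uS /u; ring.
apply/eqP; rewrite -subr_eq0 /vand !mulr_sumr -sumrB.
under eq_bigr do rewrite step.
have -> : \sum_(0 <= i < N) (G i - G i.+1) = G 0 - G N.
  elim: N {kN} => [|N IH]; first by rewrite big_nil subrr.
  by rewrite big_nat_recr//= IH; ring.
rewrite /G mul0r mul0r sub0r oppr_eq0 /u /rfact [(N <= _)%N]leqNgt kN.
by rewrite !mul0r mulr0.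
Qed.

(** The Chu-Vandermonde identity, in the form which separates the variables [k] and [l]
    in the Gaussian moment of order [k + l]. *)
Lemma vandE c N k l : 0 < c -> (k < N)%N ->
  poch c (k + l) / (k`!%:R * poch c k * (l`!%:R * poch c l)) = vand c N k l.
Proof.
move=> c0; elim: k => [|k IH] kN.
  have pl : poch c l != 0 by rewrite gt_eqF// poch_gt0.
  rewrite add0n fact0 poch0 /vand big_ltn// big_nat big1.
    rewrite /rfact/= fact0 subn0 poch0; field.
    by rewrite fact_neq0 pl.
  by move=> [|j] //= _; rewrite /rfact/= !mul0r.
have ck : (k%:R + 1) * (c + k%:R) != 0.
  apply: mulf_neq0; first by rewrite natr1 pnatr_eq0.
  by rewrite gt_eqF// ltr_wpDr.
apply: (mulfI ck); rewrite vandS// -IH ?(ltnW kN)//.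
have pl : poch c l != 0 by rewrite gt_eqF// poch_gt0.
have pk : poch c k != 0 by rewrite gt_eqF// poch_gt0.
rewrite addSn !pochS factS natrM natrD -natr1.
move: ck; rewrite mulf_eq0 negb_or => /andP[k1 ck].
by field; rewrite !fact_neq0 pl pk k1 ck.
Qed.

Lemma sum_rfact N X j : (j <= N)%N ->
  \sum_(0 <= k < N) X ^+ k * rfact k j = X ^+ j * series (exp_coeff X) (N - j)%N.
Proof.
move=> jN; rewrite (big_cat_nat _ jN)//= big_nat big1 ?add0r; last first.
  by move=> k /andP[_ kj]; rewrite /rfact leqNgt kj mulr0.
rewrite -{1}(add0n j) big_addn /series/= mulr_sumr; apply: eq_bigr => k _.
by rewrite /rfact leq_addl addnK exprD mulrA [X ^+ k * _]mulrC.
Qed.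

End vandermonde.

Section convolution_limit.
Context (R : realType).

(** A Tannery-type statement: convolving a summable nonnegative sequence with a
    convergent one. *)
Lemma cvg_convolution (w d : nat -> R) (S D K : R) :
  (forall j, 0 <= w j) -> series w @ \oo --> S ->
  d @ \oo --> D -> (forall m, `|d m| <= K) ->
  (fun N => \sum_(0 <= j < N) w j * d (N - j)%N) @ \oo --> D * S.
Proof.
move=> w0 wS dD dK.
have K0 : 0 <= K by exact: le_trans (dK 0%N).
have wle n : series w n <= S.
  rewrite -(cvg_lim _ wS)//; apply: nondecreasing_cvgn_le; last exact: cvgP wS.
  by apply/nondecreasing_seqP => k; rewrite /series/= big_nat_recr//= lerDl.
have S0 : 0 <= S by apply: le_trans (wle 0%N); rewrite /series/= big_geq.
have DK : `|D| <= K.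
  rewrite -(cvg_lim _ dD)// -lim_norm; last exact: cvgP dD.
  by apply: limr_le; [apply: is_cvg_norm; exact: cvgP dD|exact: nearW].
suff h : (fun N => \sum_(0 <= j < N) w j * (d (N - j)%N - D)) @ \oo --> (0 : R).
  rewrite -[D * S]add0r.
  rewrite (_ : (fun N => _) = (fun N => \sum_(0 <= j < N) w j * (d (N - j)%N - D) + D * series w N)).
    by apply: cvgD => //; exact: cvgMr.
  apply/funext => N; rewrite /series/= mulr_sumr -big_split/=.
  by apply: eq_bigr => j _; ring.
apply/cvgrPdist_le => e e0.
pose C := S + 2 * K + 1.
have C0 : 0 < C by rewrite ltr_wpDl// addr_ge0// mulr_ge0.
have eC : 0 < e / C by rewrite divr_gt0.
move/cvgrPdist_le : dD => /(_ _ eC)[M _ HM].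
move/cvgrPdist_le : wS => /(_ _ eC)[n0 _ Hn].
exists (n0 + M)%N => //= N nN.
have MN : (M <= N)%N by rewrite (leq_trans _ nN)// leq_addl.
rewrite sub0r normrN (big_cat_nat _ (leq_subr M N))//= (le_trans (ler_normD _ _))//.
apply: (@le_trans _ _ (e / C * S + e / C * (2 * K))).
  apply: lerD.
    rewrite (le_trans (ler_norm_sum _ _ _))// big_nat.
    apply: (@le_trans _ _ (\sum_(0 <= j < N - M) e / C * w j)).
      rewrite [in leRHS]big_nat; apply: ler_sum => j /andP[_ jNM].
      rewrite normrM (ger0_norm (w0 _)) mulrC ler_wpM2r// distrC.
      by apply: HM => /=; rewrite leq_subRL -?ltn_subRL//; lia.
    by rewrite -mulr_sumr ler_wpM2l ?(ltW eC)//; exact: wle.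
  rewrite (le_trans (ler_norm_sum _ _ _))//.
  apply: (@le_trans _ _ (\sum_(N - M <= j < N) w j * (2 * K))).
    apply: ler_sum => j _; rewrite normrM (ger0_norm (w0 _)) ler_wpM2l//.
    by rewrite (le_trans (ler_normB _ _))// mulr_natl mulr2n lerD.
  rewrite -mulr_suml ler_wpM2r ?mulr_ge0//.
  have -> : \sum_(N - M <= j < N) w j = series w N - series w (N - M)%N.
    by rewrite sub_series_geq// leq_subr.
  have : `|S - series w (N - M)%N| <= e / C by apply: Hn => /=; rewrite leq_subRL// addnC.
  rewrite ger0_norm ?subr_ge0//; apply: le_trans; rewrite lerD2r; exact: wle.
rewrite -mulrDr -mulrA ler_piMr ?(ltW e0)// mulrC ler_pdivrMr// mul1r.
by rewrite /C lerDl.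
Qed.

End convolution_limit.

(** * Weber's second exponential integral *)

Section weber.
Context (R : realType).
Variables (nu t : R).
Hypotheses (nu0 : - 2^-1 < nu) (t0 : 0 < t).
Implicit Types X Y x y : R.
Local Notation c := (nu + 1).
Let c0 : 2^-1 <= c. Proof. by move: nu0 => ?; lra. Qed.
Let cp : 0 < c. Proof. by move: nu0 => ?; lra. Qed.
Local Notation mu := (hankel_measure nu).

Definition weber_part X Y N x : R := expR (- (t * x ^+ 2)) *
  (pseries (coef0F1 c) (X * x ^+ 2) N * pseries (coef0F1 c) (Y * x ^+ 2) N).

(** The terms of the series of the modified Bessel function in the heat kernel. *)
Definition weber_wt X Y j : R :=
  ((X / (4 * t)) * (Y / (4 * t))) ^+ j / (j`!%:R * poch c j).

Lemma weber_partE X Y N x : weber_part X Y N x =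
  \sum_(0 <= k < N) \sum_(0 <= l < N)
    coef0F1 c k * X ^+ k * (coef0F1 c l * Y ^+ l) * gauss_mon t (k + l) x.
Proof.
rewrite /weber_part /pseries /series/= mulr_suml mulr_sumr; apply: eq_bigr => k _.
rewrite mulr_sumr mulr_sumr; apply: eq_bigr => l _.
rewrite /gauss_mon !exprMn exprD; ring.
Qed.

Lemma integrable_weber_part X Y N : mu.-integrable setT (EFin \o weber_part X Y N).
Proof.
rewrite (_ : EFin \o _ = fun x => (\sum_(0 <= k < N) \sum_(0 <= l < N)
    (coef0F1 c k * X ^+ k * (coef0F1 c l * Y ^+ l))%:E * (gauss_mon t (k + l) x)%:E)%E).
  apply: integrable_sum => // k _; apply: integrable_sum => // l _.
  by apply: integrableZl => //; exact: integrable_gauss_mon.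
apply/funext => x /=; rewrite weber_partE -sumEFin; apply: eq_bigr => k _.
by rewrite -sumEFin.
Qed.

(** Integrated term by term, the product of two partial sums is a double sum whose
    coefficients couple [k] and [l] through [poch c (k + l)]; [vandE] decouples them,
    and both inner sums become partial exponential series. *)
Lemma integral_weber_part X Y N :
  (\int[mu]_x (weber_part X Y N x)%:E = ((2 * t) `^ (- c) *
    \sum_(0 <= j < N) weber_wt X Y j *
      (series (exp_coeff (- (X / (4 * t)))) (N - j)%N *
       series (exp_coeff (- (Y / (4 * t)))) (N - j)%N))%:E)%E.
Proof.
transitivity (\sum_(0 <= k < N) \sum_(0 <= l < N)
    (coef0F1 c k * X ^+ k * (coef0F1 c l * Y ^+ l))%:E * \int[mu]_x (gauss_mon t (k + l) x)%:E)%E.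
  have I k l : mu.-integrable setT (fun x => (coef0F1 c k * X ^+ k * (coef0F1 c l * Y ^+ l))%:E * (gauss_mon t (k + l) x)%:E)%E.
    by apply: integrableZl => //; exact: integrable_gauss_mon.
  under eq_integral do rewrite weber_partE -sumEFin.
  rewrite integral_sum//; last first.
    move=> k; rewrite (_ : (fun x => _) = fun x => (\sum_(0 <= l < N)
     (coef0F1 c k * X ^+ k * (coef0F1 c l * Y ^+ l))%:E * (gauss_mon t (k + l) x)%:E)%E).
      by apply: integrable_sum.
    by apply/funext => x; rewrite -sumEFin.
  apply: eq_bigr => k _.
  under eq_integral do rewrite -sumEFin.
  rewrite integral_sum//; last by move=> l; exact: I.
  apply: eq_bigr => l _.
  under eq_integral do rewrite EFinM.
  by rewrite integralZl//; exact: integrable_gauss_mon.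
pose A := X / (4 * t); pose B := Y / (4 * t).
transitivity (((2 * t) `^ (- c) * \sum_(0 <= k < N) \sum_(0 <= l < N)
    (- A) ^+ k * ((- B) ^+ l * vand c N k l))%:E).
  rewrite mulr_sumr -sumEFin !big_nat; apply: eq_bigr => k /andP[_ kN].
  rewrite mulr_sumr -sumEFin; apply: eq_bigr => l _.
  rewrite integral_gauss_mon// -EFinM; congr EFin.
  rewrite -vandE// /coef0F1 /A /B.
  have pl : poch c l != 0 by rewrite gt_eqF// poch_gt0.
  have pk : poch c k != 0 by rewrite gt_eqF// poch_gt0.
  have tN i : t ^+ i != 0 by rewrite gt_eqF// exprn_gt0.
  have pw Z i : (- (Z / (4 * t))) ^+ i = (- 4^-1) ^+ i * Z ^+ i / t ^+ i.
    rewrite -exprVn -!exprMn; congr (_ ^+ _); field; exact: lt0r_neq0.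
  rewrite !pw exprD.
  move: ((- 4^-1) ^+ k) ((- 4^-1) ^+ l) => qk ql.
  by field; rewrite pl pk !tN !fact_neq0.
congr (_ * _)%:E; rewrite -/A -/B.
rewrite /vand.
under eq_bigr do under eq_bigr do rewrite !mulr_sumr.
under eq_bigr do rewrite exchange_big/=.
rewrite exchange_big/= !big_nat; apply: eq_bigr => j /andP[_ jN].
have -> : weber_wt X Y j * (series (exp_coeff (- A)) (N - j)%N * series (exp_coeff (- B)) (N - j)%N) =
  ((j`!%:R * poch c j)^-1) * (((- A) ^+ j * series (exp_coeff (- A)) (N - j)%N) *
   ((- B) ^+ j * series (exp_coeff (- B)) (N - j)%N)).
  rewrite /weber_wt -/A -/B -[A * B]mulrNN exprMn; ring.
rewrite -!sum_rfact ?(ltnW jN)// mulr_suml mulr_sumr; apply: eq_bigr => k _.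
rewrite mulr_sumr mulr_sumr; apply: eq_bigr => l _.
ring.
Qed.

(** The heat kernel of the Bessel operator [d^2/dx^2 + ((2 nu + 1) / x) d/dx]. *)
Definition heat1 x y : R := (2 * t) `^ (- c) *
  (expR (- ((x ^+ 2 + y ^+ 2) / (4 * t))) * bessel0F1 c (- (x * y / (2 * t)) ^+ 2)).

Let weber_wt_series X Y : series (weber_wt X Y) @ \oo -->
  bessel0F1 c (- (4 * ((X / (4 * t)) * (Y / (4 * t))))).
Proof.
rewrite (_ : series _ = pseries (coef0F1 c) (- (4 * ((X / (4 * t)) * (Y / (4 * t)))))).
  exact: bessel0F1_cvg.
apply/funext => n; rewrite /pseries /series/=; apply: eq_bigr => j _.
rewrite /weber_wt /coef0F1 [RHS]mulrAC -[in RHS]exprMn; congr (_ ^+ _ / _).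
by field; rewrite gt_eqF.
Qed.

Let exp_series_norm (z : R) m : `|series (exp_coeff z) m| <= expR `|z|.
Proof.
rewrite /series/= (le_trans (ler_norm_sum _ _ _))//.
have -> : \sum_(0 <= i < m) `|exp_coeff z i| = series (exp_coeff `|z|) m.
  by apply: eq_bigr => i _; rewrite /exp_coeff/= normrM normfV normrX normr_nat.
apply: nondecreasing_cvgn_le; last exact: is_cvg_series_exp_coeff.
by apply/nondecreasing_seqP => k; rewrite /series/= big_nat_recr//= lerDl exp_coeff_ge0.
Qed.

Lemma cvg_integral_weber_part X Y : 0 <= X * Y ->
  (\int[mu]_x (weber_part X Y N x)%:E)%E @[N --> \oo] --> ((2 * t) `^ (- c) *
    (expR (- ((X + Y) / (4 * t))) * bessel0F1 c (- (X * Y / (2 * t) ^+ 2))))%:E.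
Proof.
move=> XY; under eq_fun do rewrite integral_weber_part.
apply: cvg_EFin; first by apply: nearW.
apply: cvgMr.
have -> : X * Y / (2 * t) ^+ 2 = 4 * ((X / (4 * t)) * (Y / (4 * t))).
  by field; rewrite gt_eqF.
apply: (@cvg_convolution _ (weber_wt X Y)
  (fun m => series (exp_coeff (- (X / (4 * t)))) m *
            series (exp_coeff (- (Y / (4 * t)))) m) _ _ (expR `|- (X / (4 * t))| * expR `|- (Y / (4 * t))|)).
- move=> j; rewrite /weber_wt divr_ge0//.
    rewrite exprn_ge0// mulrACA -invfM mulr_ge0// invr_ge0 mulr_ge0// mulr_ge0// ltW//.
  by rewrite mulr_ge0// ltW// poch_gt0.
- exact: weber_wt_series.
- rewrite (_ : - ((X + Y) / (4 * t)) = - (X / (4 * t)) - Y / (4 * t)); last by ring.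
  rewrite expRD; apply: cvgM; rewrite /expR; exact: is_cvg_series_exp_coeff.
- by move=> m; rewrite normrM ler_pM.
Qed.

Definition weber_fun X Y x : R :=
  expR (- (t * x ^+ 2)) * (bessel0F1 c (X * x ^+ 2) * bessel0F1 c (Y * x ^+ 2)).

Let measurable_weber_fun X Y : measurable_fun setT (weber_fun X Y).
Proof.
apply: measurable_funM; first exact: measurable_gauss.
have h Z : measurable_fun setT (fun x : R => bessel0F1 c (Z * x ^+ 2)).
  apply: measurableT_comp; first exact: measurable_bessel0F1.
  by apply: measurable_funM => //; exact: measurable_funX.
exact: measurable_funM.
Qed.

Let measurable_weber_part X Y N : measurable_fun setT (weber_part X Y N).
Proof. by have /integrableP[/measurable_EFinP] := integrable_weber_part X Y N. Qed.

Let cvg_weber_part X Y x : weber_part X Y N x @[N --> \oo] --> weber_fun X Y x.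
Proof. by apply: cvgMr; apply: cvgM; exact: bessel0F1_cvg. Qed.

Let pseries_coef0F1N_ge0 (z : R) k : z <= 0 -> 0 <= coef0F1 c k * z ^+ k.
Proof.
move=> z0; rewrite /coef0F1 mulrAC -exprMn divr_ge0 ?exprn_ge0//.
  by rewrite mulNr -mulrN mulr_ge0// oppr_ge0.
by rewrite mulr_ge0// ltW// poch_gt0.
Qed.

Let pseries_coef0F1N_nd (z : R) : z <= 0 -> nondecreasing_seq (pseries (coef0F1 c) z).
Proof.
move=> z0; apply/nondecreasing_seqP => k.
by rewrite /pseries /series/= big_nat_recr//= lerDl pseries_coef0F1N_ge0.
Qed.

Let pseries_coef0F1N_pos (z : R) N : z <= 0 -> 0 <= pseries (coef0F1 c) z N.
Proof. by move=> z0; apply: sumr_ge0 => k _; exact: pseries_coef0F1N_ge0. Qed.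

(** The modified function dominates all partial sums, as its terms are the absolute
    values of the alternating ones. *)
Let pseries_le (z : R) N : 0 <= z -> `|pseries (coef0F1 c) z N| <= bessel0F1 c (- z).
Proof.
move=> z0; apply: (@le_trans _ _ (pseries (coef0F1 c) (- z) N)); last first.
  apply: nondecreasing_cvgn_le; last exact: is_cvg_coef0F1.
  by apply: pseries_coef0F1N_nd; rewrite oppr_le0.
rewrite /pseries /series/= (le_trans (ler_norm_sum _ _ _))//; apply: ler_sum => k _.
rewrite -[leRHS]ger0_norm ?pseries_coef0F1N_ge0 ?oppr_le0//.
by rewrite normrM [in leRHS]normrM !normrX normrN lexx.
Qed.

(** The limit of [integral_weber_part].  At [- x^2] and [- y^2] the integrands are
    nonnegative and increasing, and monotone convergence applies; the resulting
    integrable function dominates the alternating case. *)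
Lemma weber x y : (hankel_measure nu).-integrable setT
    (EFin \o weber_fun (x ^+ 2) (y ^+ 2)) /\
  (\int[mu]_l (weber_fun (x ^+ 2) (y ^+ 2) l)%:E = (heat1 x y)%:E)%E.
Proof.
pose X := x ^+ 2; pose Y := y ^+ 2.
have X0 : 0 <= X by exact: sqr_ge0.
have Y0 : 0 <= Y by exact: sqr_ge0.
have neg (Z l : R) : 0 <= Z -> - Z * l ^+ 2 <= 0 by move=> Z0; rewrite mulNr oppr_le0 mulr_ge0// sqr_ge0.
have gE : (\int[mu]_l (weber_fun (- X) (- Y) l)%:E =
    ((2 * t) `^ (- c) * (expR (- ((- X + - Y) / (4 * t))) * bessel0F1 c (- (- X * - Y / (2 * t) ^+ 2))))%:E)%E.
  have h : 0 <= - X * - Y by rewrite mulrNN mulr_ge0.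
  rewrite -(cvg_lim _ (cvg_integral_weber_part h))//.
  rewrite -monotone_convergence//=.
  - apply: eq_integral => l _; apply/esym/cvg_lim => //.
    by apply: cvg_EFin; [exact: nearW|exact: cvg_weber_part].
  - by move=> n; apply/measurable_EFinP; exact: measurable_weber_part.
  - move=> n l _; rewrite lee_fin mulr_ge0 ?expR_ge0// mulr_ge0// pseries_coef0F1N_pos//; exact: neg.
  - move=> l _ m n mn; rewrite lee_fin ler_wpM2l ?expR_ge0//.
    by rewrite ler_pM ?pseries_coef0F1N_pos ?pseries_coef0F1N_nd//; exact: neg.
have g0 l : 0 <= weber_fun (- X) (- Y) l.
  by rewrite /weber_fun mulr_ge0 ?expR_ge0// mulr_ge0// mulNr bessel0F1N_ge0// mulr_ge0// sqr_ge0.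
have ig : mu.-integrable setT (EFin \o weber_fun (- X) (- Y)).
  apply/integrableP; split; first by apply/measurable_EFinP; exact: measurable_weber_fun.
  under eq_integral do rewrite /= ger0_norm//.
  by rewrite gE ltry.
have [] := @dominated_convergence _ _ _ mu setT measurableT
  (fun N => EFin \o weber_part X Y N) (EFin \o weber_fun X Y) _ _ _ _ ig.
- by move=> n; apply/measurable_EFinP; exact: measurable_weber_part.
- by apply/measurable_EFinP; exact: measurable_weber_fun.
- apply: nearW => l _; apply: cvg_EFin; [exact: nearW|exact: cvg_weber_part].
- apply: nearW => l n _ /=; rewrite lee_fin /weber_part /weber_fun normrM.
  rewrite (ger0_norm (expR_ge0 _)) ler_wpM2l ?expR_ge0// normrM !mulNr ler_pM//.
    by apply: pseries_le; rewrite mulr_ge0// sqr_ge0.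
  by apply: pseries_le; rewrite mulr_ge0// sqr_ge0.
move=> If _ cf; split => //.
have h : 0 <= X * Y by rewrite mulr_ge0.
rewrite -(cvg_lim _ cf)// (cvg_lim _ (cvg_integral_weber_part h))//.
by rewrite /heat1 [(x * y / _) ^+ 2]expr_div_n [(x * y) ^+ 2]exprMn.
Qed.

Lemma heat1_ge0 x y : 0 <= heat1 x y.
Proof.
by rewrite /heat1 mulr_ge0 ?powR_ge0// mulr_ge0 ?expR_ge0// bessel0F1N_ge0// sqr_ge0.
Qed.

End weber.

(** * The Bessel measure as a product measure *)

Section bessel_measure_cons.
Context (R : realType) (n : nat).
Implicit Types (nu x : R) (a y : n.-tuple R).

Lemma tnth_tuple_cons0 x y : tnth (tuple_cons (x, y)) ord0 = x.
Proof. by rewrite tnth0. Qed.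

Lemma tnth_tuple_consS x y i : tnth (tuple_cons (x, y)) (lift ord0 i) = tnth y i.
Proof. by rewrite tnthS. Qed.

Lemma orthant_cons x y : orthant (tuple_cons (x, y)) <-> 0 < x /\ orthant y.
Proof.
split=> [h|[x0 y0] i].
  by split=> [|i]; [rewrite -(tnth_tuple_cons0 x y)|rewrite -(tnth_tuple_consS x y)].
by case: (unliftP ord0 i) => [j|] ->; rewrite ?tnth_tuple_cons0 ?tnth_tuple_consS.
Qed.

Lemma bessel_weight_cons nu a x y :
  bessel_weight (tuple_cons (nu, a)) (tuple_cons (x, y)) =
  hankel_weight nu x * bessel_weight a y.
Proof.
rewrite /bessel_weight /hankel_weight /tsum !big_ord_recl.
rewrite !tnth_tuple_cons0.
under eq_bigr do rewrite tnth_tuple_consS.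
have -> : \prod_(i < n) Gamma (tnth (tuple_cons (nu, a)) (lift ord0 i) + 1) =
    \prod_(i < n) Gamma (tnth a i + 1).
  by apply: eq_bigr => i _; rewrite tnth_tuple_consS.
have -> : \prod_(i < n) tnth (tuple_cons (x, y)) (lift ord0 i)
      `^ (2 * tnth (tuple_cons (nu, a)) (lift ord0 i) + 1) =
    \prod_(i < n) tnth y i `^ (2 * tnth a i + 1).
  by apply: eq_bigr => i _; rewrite !tnth_tuple_consS.
rewrite powRD_gt0// !invfM; ring.
Qed.

Lemma measurable_hankel_weight_pos nu :
  measurable_fun setT (fun x => (hankel_weight nu x)%:E).
Proof.
apply/measurable_EFinP; apply: measurable_funM => //; exact: measurable_powR.
Qed.

(** The weight factorizes, and Lebesgue measure on tuples is a product by
    construction. *)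
Lemma ge0_integral_bessel_measure_cons nu a (f : n.+1.-tuple R -> \bar R) :
  (forall z, 0 <= f z)%E -> measurable_fun setT f ->
  (\int[bessel_measure (tuple_cons (nu, a))]_z f z =
   \int[hankel_measure nu]_x \int[bessel_measure a]_y f (tuple_cons (x, y)))%E.
Proof.
move=> f0 mf.
have mc := @measurable_tuple_cons R n.
have mfc : measurable_fun setT (f \o @tuple_cons R n) by exact: measurableT_comp.
rewrite ge0_integral_mdensity//= /lebesgue_cons.
pose h (z : measurableTypeR R * n.-tuple R) : \bar R :=
  ((hankel_weight nu z.1)%:E * ((bessel_weight a z.2)%:E * f (tuple_cons z)))%E.
pose D : set (measurableTypeR R * n.-tuple R) :=
  (`]0%R, +oo[%classic : set R) `*` orthant (n := n).
have mD : measurable D.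
  by apply: measurableX; [exact: measurable_itv|exact: measurable_orthant].
rewrite ge0_integral_pushforward//; last 3 first.
- exact: measurable_orthant.
- apply: emeasurable_funM; last exact: measurable_funTS.
  by apply/measurable_EFinP; exact: measurable_bessel_weight.
- move=> x; rewrite inE => x0; rewrite mule_ge0// lee_fin.
  exact: bessel_weight_ge0.
have DE : @tuple_cons R n @^-1` orthant (n := n.+1) = D.
  apply/seteqP; split=> -[x y]; rewrite /D/= in_itv/= andbT => h1.
    exact/orthant_cons.
  by apply/orthant_cons.
rewrite DE.
have h0 z : D z -> (0 <= h z)%E.
  case: z => x y [/= xD yD]; rewrite /h/= mule_ge0 ?lee_fin ?hankel_weight_ge0//.
  by rewrite mule_ge0// lee_fin bessel_weight_ge0.
have mh : measurable_fun D h.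
  apply: emeasurable_funM.
    apply: measurable_funTS.
    apply: (@measurableT_comp _ _ _ _ _ _ (fun x => (hankel_weight nu x)%:E)) => //.
    exact: measurable_hankel_weight_pos.
  apply: emeasurable_funM; last exact: measurable_funTS.
  apply/measurable_EFinP.
  apply: measurable_funTS; apply: (@measurableT_comp _ _ _ _ _ _ (bessel_weight a)) => //.
  apply: measurable_funM => //; apply: measurable_prod => i _.
  exact: (measurableT_comp (measurable_powR _) (@measurable_tnth _ R n i)).
transitivity (\int[lebesgue_measure \x lebesgue_tuple R n]_z (h \_ D) z)%E.
  rewrite -integral_mkcond; apply: eq_integral => -[x y] _ /=.
  by rewrite bessel_weight_cons /h/= EFinM muleA.
rewrite fubini_tonelli1; last 2 first.
- exact/(measurable_restrictT _ mD).
- by move=> z; apply: erestrict_ge0.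
rewrite ge0_integral_mdensity; last 2 first.
- by move=> x; exact: integral_ge0.
- apply: (measurable_fun_fubini_tonelli_F (m2 := bessel_measure a) (f \o @tuple_cons R n)) => //.
  by move=> z /=.
rewrite [RHS]integral_mkcond; apply: eq_integral => x _; rewrite /fubini_F patchE.
case: ifPn => [|/negP]; rewrite inE => xD; last first.
  rewrite integral0_eq// => y _; rewrite patchE ifF//; apply/negbTE/negP.
  by rewrite inE => -[].
have mfx : measurable_fun setT (fun y => f (tuple_cons (x, y))).
  exact: (measurableT_comp mfc (measurable_pair1 x)).
rewrite ge0_integral_mdensity//.
rewrite -ge0_integralZl//; last 4 first.
- exact: measurable_orthant.
- apply: emeasurable_funM; last exact: measurable_funTS.
  by apply/measurable_EFinP; exact: measurable_bessel_weight.
- by move=> y yD; rewrite mule_ge0// lee_fin bessel_weight_ge0.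
- by rewrite lee_fin hankel_weight_ge0.
rewrite [RHS]integral_mkcond; apply: eq_integral => y _; rewrite !patchE.
have -> : ((x, y) \in D) = (y \in orthant (n := n)).
  by apply/idP/idP; rewrite !inE; [case|split].
by case: ifPn.
Qed.

Lemma bessel_measure_consE nu a (A : set (n.+1.-tuple R)) : measurable A ->
  bessel_measure (tuple_cons (nu, a)) A =
  pushforward (hankel_measure nu \x bessel_measure a)%E (@tuple_cons R n) A.
Proof.
move=> mA.
have mcA : measurable (@tuple_cons R n @^-1` A).
  by rewrite -[X in measurable X]setTI; exact: measurable_tuple_cons.
transitivity (\int[bessel_measure (tuple_cons (nu, a))]_z (\1_A z)%:E)%E.
  by rewrite integral_indic// setIT.
rewrite ge0_integral_bessel_measure_cons//; last first.
  by apply/measurable_EFinP; exact: measurable_indic.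
transitivity (\int[hankel_measure nu \x bessel_measure a]_z
    (\1_(@tuple_cons R n @^-1` A) z)%:E)%E.
  rewrite fubini_tonelli1//.
  by apply/measurable_EFinP; exact: measurable_indic.
rewrite [LHS](integral_indic (hankel_measure nu \x bessel_measure a)%E measurableT mcA).
by rewrite /pushforward setIT.
Qed.

Lemma integral_bessel_measure_cons nu a (f : n.+1.-tuple R -> \bar R) :
  measurable_fun setT f ->
  (hankel_measure nu \x bessel_measure a)%E.-integrable setT (f \o @tuple_cons R n) ->
  (bessel_measure (tuple_cons (nu, a))).-integrable setT f /\
  (\int[bessel_measure (tuple_cons (nu, a))]_z f z =
   \int[hankel_measure nu]_x \int[bessel_measure a]_y f (tuple_cons (x, y)))%E.
Proof.
move=> mf fi.
have mc := @measurable_tuple_cons R n.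
have E (g : n.+1.-tuple R -> \bar R) :
    (\int[bessel_measure (tuple_cons (nu, a))]_z g z =
     \int[pushforward (hankel_measure nu \x bessel_measure a)%E (@tuple_cons R n)]_z g z)%E.
  by apply: eq_measure_integral => A mA _; exact: bessel_measure_consE.
split.
  apply/integrableP; split => //; rewrite E.
  by have /integrableP[_] := integrable_pushforward mc mf fi measurableT.
rewrite E integral_pushforward//.
exact: (esym (integral12_prod_meas1 fi)).
Qed.

End bessel_measure_cons.

Section product_integral.
Context (R : realType).

Definition tprod n (F : 'I_n -> R -> R) (x : n.-tuple R) : R :=
  \prod_(i < n) F i (tnth x i).

Lemma measurable_tprod n (F : 'I_n -> R -> R) :
  (forall i, measurable_fun setT (F i)) -> measurable_fun setT (tprod F).
Proof.
move=> mF; apply: measurable_prod => i _.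
exact: (measurableT_comp (mF i) (@measurable_tnth _ R n i)).
Qed.

Lemma bessel_measure_tuple0 (a : 0.-tuple R) : bessel_measure a setT = 1%E.
Proof.
rewrite /bessel_measure /mdensity/= setTI.
have -> : @orthant R 0 = setT by apply/seteqP; split => // x _ [].
rewrite integral_dirac//; last first.
  have := measurable_bessel_weight a => /measurable_EFinP.
  have -> : @orthant R 0 = setT by apply/seteqP; split => // x _ [].
  by [].
rewrite diracT mul1e /bessel_weight /tsum !big_ord0 powRr0 !mul1r mulr1.
by rewrite invr1.
Qed.

(** By induction on the number of variables, peeling off the first one. *)
Lemma integral_tprod n (a : n.-tuple R) (F : 'I_n -> R -> R) :
  (forall i, (hankel_measure (tnth a i)).-integrable setT (EFin \o F i)) ->
  (bessel_measure a).-integrable setT (EFin \o tprod F) /\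
  (\int[bessel_measure a]_x (tprod F x)%:E =
   (\prod_(i < n) \int[hankel_measure (tnth a i)]_x F i x)%:E)%E.
Proof.
elim: n a F => [|n IH] a F iF.
  have T1 (x : 0.-tuple R) : tprod F x = 1 by rewrite /tprod big_ord0.
  have E : EFin \o tprod F = cst 1%E by apply/funext => x /=; rewrite T1.
  rewrite -/(EFin \o tprod F) E big_ord0.
  have I1 : (\int[bessel_measure a]_x cst 1 x = 1)%E.
    by rewrite integral_cst// mul1e; exact: bessel_measure_tuple0.
  split; last exact: I1.
  apply/integrableP; split => //.
  under eq_integral do rewrite /= normr1.
  by rewrite I1 ltry.
case/tupleP: a iF => nu a iF.
have iF0 : (hankel_measure nu).-integrable setT (EFin \o F ord0).
  by have := iF ord0; rewrite tnth0.
have iFS i : (hankel_measure (tnth a i)).-integrable setT (EFin \o F (lift ord0 i)).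
  by have := iF (lift ord0 i); rewrite tnthS.
have [iG IG] := IH a (fun i => F (lift ord0 i)) iFS.
set G := tprod _ in iG IG.
have FG x y : tprod F (tuple_cons (x, y)) = F ord0 x * G y.
  rewrite /tprod big_ord_recl tnth_tuple_cons0; congr (_ * _).
  by apply: eq_bigr => i _; rewrite tnth_tuple_consS.
have mF i : measurable_fun setT (F i).
  by have /integrableP[/measurable_EFinP] := iF i.
have mT : measurable_fun setT (EFin \o tprod F).
  by apply/measurable_EFinP; exact: measurable_tprod.
have mTc : measurable_fun setT ((EFin \o tprod F) \o @tuple_cons R n).
  exact: measurableT_comp mT (@measurable_tuple_cons R n).
have iFG : (hankel_measure nu \x bessel_measure a)%E.-integrable setT
    ((EFin \o tprod F) \o @tuple_cons R n).
  apply/(integrable12ltyP _ _ mTc) => /=.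
  under eq_integral => x _ do under eq_integral => y _ do rewrite FG normrM EFinM.
  have mG : measurable_fun setT G by have /integrableP[/measurable_EFinP] := iG.
  under eq_integral => x _.
    rewrite ge0_integralZl//; last first.
      by apply/measurable_EFinP; exact: measurableT_comp.
    over.
  rewrite ge0_integralZr//.
  - apply: lte_mul_pinfty.
    + exact: integral_ge0.
    + have /integrableP[_] := iF0; rewrite ge0_fin_numE//.
      exact: integral_ge0.
    + by have /integrableP[_] := iG.
  - by apply/measurable_EFinP; apply: measurableT_comp => //; exact: mF.
  - exact: integral_ge0.
have [i1 i2] := integral_bessel_measure_cons mT iFG.
split => //; rewrite [LHS]i2 big_ord_recl.
under eq_integral => x _ do under eq_integral => y _ do rewrite /= FG EFinM.
under eq_integral => x _.
  rewrite integralZl//; rewrite IG.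
  over.
rewrite /= integralZr//.
rewrite tnth0; under [in RHS]eq_bigr do rewrite tnthS.
rewrite -[X in (X * _)%E]fineK; last exact: integrable_fin_num.
by rewrite -EFinM.
Qed.

End product_integral.

(** * The heat kernel in several variables *)

Section fubini_bounded.
Context d (T : measurableType d) (R : realType).
Variable mu : {sigma_finite_measure set T -> \bar R}.
Variables (u v : T -> R) (M : T * T -> R).
Hypotheses (iu : mu.-integrable setT (EFin \o u))
  (iv : mu.-integrable setT (EFin \o v))
  (mM : measurable_fun setT M) (M1 : forall z, `|M z| <= 1).

Let mu_ : measurable_fun setT u.
Proof. by have /integrableP[/measurable_EFinP] := iu. Qed.

Let mv_ : measurable_fun setT v.
Proof. by have /integrableP[/measurable_EFinP] := iv. Qed.

Lemma integrable_mul_bounded (w N : T -> R) :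
  mu.-integrable setT (EFin \o w) -> measurable_fun setT N ->
  (forall z, `|N z| <= 1) -> mu.-integrable setT (fun x => (w x * N x)%:E).
Proof.
move=> iw mN N1; have /integrableP[/measurable_EFinP mw _] := iw.
apply: (le_integrable _ _ _ iw) => //.
  by apply/measurable_EFinP; exact: measurable_funM.
by move=> x _ /=; rewrite lee_fin normrM ler_piMr.
Qed.

Let mM1 y : measurable_fun setT (fun l => M (l, y)).
Proof. exact: measurableT_comp. Qed.

Let mM2 l : measurable_fun setT (fun y => M (l, y)).
Proof. exact: measurableT_comp. Qed.

Let Phi (z : T * T) : \bar R := (u z.1 * (v z.2 * M (z.2, z.1)))%:E.

Let mPhi : measurable_fun setT Phi.
Proof.
apply/measurable_EFinP; apply: measurable_funM; first exact: measurableT_comp.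
apply: measurable_funM; first exact: measurableT_comp.
by apply: (measurableT_comp mM); apply: measurable_fun_pair.
Qed.

Let iPhi : (mu \x mu)%E.-integrable setT Phi.
Proof.
apply/(integrable12ltyP _ _ mPhi).
have [_ fu] := integrableP _ _ _ iu; have [_ fv] := integrableP _ _ _ iv.
apply: (@le_lt_trans _ _ (\int[mu]_y (`|(u y)%:E| * \int[mu]_l `|(v l)%:E|))%E).
  apply: ge0_le_integral => //=.
  - by move=> y _; exact: integral_ge0.
  - apply: (measurable_fun_fubini_tonelli_F (m2 := mu) (abse \o Phi)).
      exact: measurableT_comp.
    by move=> z /=.
  - apply: emeasurable_funM => //; apply/measurable_EFinP; exact: measurableT_comp.
  - move=> y _; rewrite -ge0_integralZl//=; last first.
      by apply/measurable_EFinP; exact: measurableT_comp.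
    apply: ge0_le_integral => //=.
    + apply/measurable_EFinP; apply: measurableT_comp => //.
      by apply: measurable_funM => //; exact: measurable_funM.
    + by apply/measurable_EFinP; apply: measurable_funM => //; exact: measurableT_comp.
    + by move=> l _; rewrite lee_fin !normrM ler_wpM2l// ler_piMr.
rewrite ge0_integralZr//=; last 2 first.
- by apply/measurable_EFinP; exact: measurableT_comp.
- exact: integral_ge0.
by rewrite lte_mul_pinfty ?integral_ge0// ge0_fin_numE// integral_ge0.
Qed.

Let F1 y : (\int[mu]_l Phi (y, l) = (u y * \int[mu]_l (v l * M (l, y)))%:E)%E.
Proof.
rewrite /Phi/=; under eq_integral do rewrite EFinM.
have iw := integrable_mul_bounded iv (mM1 y) (fun z => M1 _).
rewrite integralZl//= EFinM /Rintegral fineK//; exact: integrable_fin_num iw.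
Qed.

Let F2 l : (\int[mu]_y Phi (y, l) = (v l * \int[mu]_y (u y * M (l, y)))%:E)%E.
Proof.
rewrite /Phi/=; under eq_integral do rewrite mulrCA EFinM.
have iw := integrable_mul_bounded iu (mM2 l) (fun z => M1 _).
rewrite integralZl//= EFinM /Rintegral fineK//; exact: integrable_fin_num iw.
Qed.

Lemma integrable_fubini_bounded :
  mu.-integrable setT (fun y => (u y * \int[mu]_l (v l * M (l, y)))%:E).
Proof.
have := integrable_fubini_F iPhi; apply: eq_integrable => // y _.
by rewrite /fubini_F F1.
Qed.

(** Fubini for a bounded kernel between two integrable functions, with the inner
    integrals real-valued. *)
Lemma fubini_bounded :
  (\int[mu]_y (u y * \int[mu]_l (v l * M (l, y)))%:E =
   \int[mu]_l (v l * \int[mu]_y (u y * M (l, y)))%:E)%E.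
Proof.
under eq_integral do rewrite -F1.
under [RHS]eq_integral do rewrite -F2.
exact: (Fubini iPhi).
Qed.

End fubini_bounded.

Section kernels.
Context (R : realType) (n : nat) (a : n.-tuple R).
Hypothesis a0 : forall i, - 2^-1 < tnth a i.
Implicit Types (s b t : 'I_n -> R) (x y l : n.-tuple R).
Local Notation mu := (bessel_measure a).
Local Notation K := (bessel_kernel a).

(** One exponent per variable: the exponents have to vary independently for the
    Gaussians to separate the coordinates. *)
Definition gaussN s x : R := tprod (fun i u => expR (- (s i * u ^+ 2))) x.

Definition heatN s x y : R :=
  \prod_(i < n) heat1 (tnth a i) (s i) (tnth x i) (tnth y i).

Let c0 i : 2^-1 <= tnth a i + 1.
Proof. by have := a0 i => ?; lra. Qed.

Lemma bessel_kernelE l x :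
  K l x = \prod_(i < n) bessel0F1 (tnth a i + 1) ((tnth l i * tnth x i) ^+ 2).
Proof. by apply: eq_bigr => i _; rewrite bessel_jE. Qed.

Lemma bessel_kernelC l x : K l x = K x l.
Proof. by apply: eq_bigr => i _; rewrite mulrC. Qed.

Lemma bessel_kernel_le1 l x : `|K l x| <= 1.
Proof.
rewrite bessel_kernelE normr_prod; apply: prodr_ile1 => i _.
by rewrite normr_ge0/= bessel0F1_le1// sqr_ge0.
Qed.

Lemma measurable_bessel_kernel : measurable_fun setT (fun z => K z.1 z.2).
Proof.
rewrite (_ : (fun z => _) = (fun z : n.-tuple R * n.-tuple R =>
   \prod_(i < n) bessel0F1 (tnth a i + 1) ((tnth z.1 i * tnth z.2 i) ^+ 2))); last first.
  by apply/funext => z; exact: bessel_kernelE.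
apply: measurable_prod => i _; apply: measurableT_comp; first exact: measurable_bessel0F1.
apply: measurable_funX; apply: measurable_funM.
  exact: (measurableT_comp (@measurable_tnth _ R n i)).
exact: (measurableT_comp (@measurable_tnth _ R n i)).
Qed.

Lemma gaussN_gt0 s x : 0 < gaussN s x.
Proof. by apply: prodr_gt0 => i _; exact: expR_gt0. Qed.

Lemma measurable_gaussN s : measurable_fun setT (gaussN s).
Proof. by apply: measurable_tprod => i; exact: measurable_gauss. Qed.

Lemma gaussND s t x : gaussN (fun i => s i + t i) x = gaussN s x * gaussN t x.
Proof.
rewrite /gaussN /tprod -big_split; apply: eq_bigr => i _ /=.
by rewrite -expRD; congr expR; ring.
Qed.

Lemma heatN_ge0 s x y : (forall i, 0 < s i) -> 0 <= heatN s x y.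
Proof. by move=> s0; apply: prodr_ge0 => i _; exact: heat1_ge0. Qed.

Lemma heatNC s x y : heatN s x y = heatN s y x.
Proof.
by apply: eq_bigr => i _; rewrite /heat1 [_ ^+ 2 + _]addrC [tnth x i * _]mulrC.
Qed.

Lemma measurable_heatN s : measurable_fun setT (fun z => heatN s z.1 z.2).
Proof.
have m1 i : measurable_fun setT (fun z : n.-tuple R * n.-tuple R => tnth z.1 i).
  exact: (measurableT_comp (@measurable_tnth _ R n i)).
have m2 i : measurable_fun setT (fun z : n.-tuple R * n.-tuple R => tnth z.2 i).
  exact: (measurableT_comp (@measurable_tnth _ R n i)).
apply: measurable_prod => i _; apply: measurable_funM => //; apply: measurable_funM.
  apply: measurableT_comp => //; apply: measurableT_comp => //.
  by apply: measurable_funM => //; apply: measurable_funD; exact: measurable_funX.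
apply: measurableT_comp; first exact: measurable_bessel0F1.
apply: measurableT_comp => //; apply: measurable_funX; apply: measurable_funM => //.
exact: measurable_funM.
Qed.

(** A product of one-dimensional integrals [weber]. *)
Lemma weberN s x y : (forall i, 0 < s i) ->
  mu.-integrable setT (fun l => (gaussN s l * (K l x * K l y))%:E) /\
  (\int[mu]_l (gaussN s l * (K l x * K l y))%:E = (heatN s x y)%:E)%E.
Proof.
move=> s0.
pose F i := weber_fun (tnth a i) (s i) (tnth x i ^+ 2) (tnth y i ^+ 2).
have W i := weber (a0 i) (s0 i) (tnth x i) (tnth y i).
have FE l : gaussN s l * (K l x * K l y) = tprod F l.
  rewrite /gaussN /tprod !bessel_kernelE -!big_split; apply: eq_bigr => i _ /=.
  by rewrite /F /weber_fun !exprMn ![tnth l i ^+ 2 * _]mulrC.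
have [i1 i2] := integral_tprod (fun i => (W i).1).
split; first by apply: eq_integrable i1 => // l _; rewrite /= FE.
under eq_integral do rewrite FE.
rewrite i2; congr EFin; apply: eq_bigr => i _.
by rewrite /Rintegral (W i).2.
Qed.

Definition tuple00 : n.-tuple R := [tuple 0 | i < n].

Lemma bessel_kernel0 l : K l tuple00 = 1.
Proof.
rewrite bessel_kernelE big1// => i _.
by rewrite tnth_mktuple mulr0 expr0n/= bessel0F1_0.
Qed.

Definition gauss_cst s : R := \prod_(i < n) (2 * s i) `^ (- (tnth a i + 1)).

Lemma gauss_cst_gt0 s : (forall i, 0 < s i) -> 0 < gauss_cst s.
Proof. by move=> s0; apply: prodr_gt0 => i _; rewrite powR_gt0// mulr_gt0. Qed.

(** The kernel at the origin is 1, so the heat kernel there is the transform of a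
    Gaussian. *)
Lemma heatN_0 s x : heatN s x tuple00 = gauss_cst s * gaussN (fun i => (4 * s i)^-1) x.
Proof.
rewrite /heatN /gauss_cst /gaussN /tprod -big_split; apply: eq_bigr => i _ /=.
rewrite /heat1 tnth_mktuple mulr0 mul0r expr0n/= oppr0 bessel0F1_0 mulr1 addr0.
by rewrite [in RHS]mulrC [(4 * s i)^-1 * _]mulrC [LHS]mulrC.
Qed.

Lemma integral_gaussN s : (forall i, 0 < s i) ->
  mu.-integrable setT (EFin \o gaussN s) /\
  (\int[mu]_l (gaussN s l)%:E = (gauss_cst s)%:E)%E.
Proof.
move=> s0; have [i1 i2] := weberN tuple00 tuple00 s0.
have E l : gaussN s l * (K l tuple00 * K l tuple00) = gaussN s l.
  by rewrite bessel_kernel0 !mulr1.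
split; first by apply: eq_integrable i1 => // l _; rewrite E.
under eq_integral do rewrite -E.
rewrite i2 heatN_0; congr EFin; rewrite /gaussN /tprod big1 ?mulr1// => i _.
by rewrite tnth_mktuple expr0n/= mulr0 oppr0 expR0.
Qed.

Lemma integral_gaussN_kernel s x : (forall i, 0 < s i) ->
  \int[mu]_l (gaussN s l * K l x) = gauss_cst s * gaussN (fun i => (4 * s i)^-1) x.
Proof.
move=> s0; have [i1 i2] := weberN x tuple00 s0.
have E l : gaussN s l * (K l x * K l tuple00) = gaussN s l * K l x.
  by rewrite bessel_kernel0 !mulr1.
rewrite -heatN_0 /Rintegral; under eq_integral do rewrite -E.
by rewrite i2.
Qed.

(** The semigroup maps Gaussians to Gaussians: multiply the transforms, which are
    Gaussians, and transform back. *)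
Lemma integral_heatN_gaussN t b x : (forall i, 0 < t i) -> (forall i, 0 < b i) ->
  (\int[mu]_y (heatN t x y * gaussN b y)%:E =
   (\prod_(i < n) (1 + 4 * b i * t i) `^ (- (tnth a i + 1)) *
    gaussN (fun i => b i / (1 + 4 * b i * t i)) x)%:E)%E.
Proof.
move=> t0 b0.
pose s i := t i + (4 * b i)^-1.
have s0 i : 0 < s i by rewrite /s addr_gt0// invr_gt0 mulr_gt0.
have [it _] := integral_gaussN t0; have [ib _] := integral_gaussN b0.
pose v l := gaussN t l * K l x.
have mKx : measurable_fun setT (fun l => K l x).
  exact: (measurableT_comp measurable_bessel_kernel (measurable_pair2 x)).
have iv : mu.-integrable setT (EFin \o v).
  exact: (integrable_mul_bounded it mKx (fun z => bessel_kernel_le1 _ _)).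
have F := fubini_bounded ib iv measurable_bessel_kernel (fun z => bessel_kernel_le1 _ _).
have E1 y : \int[mu]_l (v l * K l y) = heatN t x y.
  rewrite /Rintegral; under eq_integral do rewrite /v -mulrA.
  by rewrite (weberN x y t0).2.
have E2 l : \int[mu]_y (gaussN b y * K l y) = gauss_cst b * gaussN (fun i => (4 * b i)^-1) l.
  by under eq_Rintegral do rewrite bessel_kernelC; exact: integral_gaussN_kernel.
transitivity (\int[mu]_y (gaussN b y * \int[mu]_l (v l * K l y))%:E)%E.
  by apply: eq_integral => y _; rewrite E1 mulrC.
rewrite F.
transitivity (\int[mu]_l ((gauss_cst b)%:E * (gaussN s l * K l x)%:E))%E.
  by apply: eq_integral => l _; rewrite E2 -EFinM gaussND /v; congr EFin; ring.
have iw : mu.-integrable setT (fun l => (gaussN s l * K l x)%:E).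
  have [is_ _] := integral_gaussN s0.
  exact: (integrable_mul_bounded is_ mKx (fun z => bessel_kernel_le1 _ _)).
clear F E1 E2 iv.
rewrite (integralZl measurableT iw).
rewrite -[X in (_ * X)%E](fineK (integrable_fin_num measurableT iw)).
have := integral_gaussN_kernel x s0; rewrite /Rintegral => ->.
rewrite -EFinM mulrA; congr EFin; congr (_ * _).
  rewrite /gauss_cst -big_split; apply: eq_bigr => i _ /=.
  rewrite -powRM; last 2 first.
  - by rewrite mulr_ge0// ltW.
  - by rewrite mulr_ge0// ltW.
  by congr (_ `^ _); rewrite /s; field; rewrite gt_eqF.
congr (gaussN _ x); apply/funext => i; rewrite /s.
have := b0 i; have := t0 i => t0i b0i.
have h : 0 < t i * b i by rewrite mulr_gt0.
field; rewrite !gt_eqF//; lra.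
Qed.

End kernels.

(** * Vanishing of Markovian quadratic forms *)

Section vanishing.
Context (R : realType).

(** Convergence to 0 of nonnegative extended reals, in the form that survives
    domination and sums without any finiteness side condition. *)
Definition vanish (s : nat -> \bar R) :=
  forall e : R, 0 < e -> exists N0, forall N, (N0 <= N)%N -> (s N <= e%:E)%E.

Lemma vanish_le (s s' : nat -> \bar R) :
  (forall N, (s' N <= s N)%E) -> vanish s -> vanish s'.
Proof.
move=> ss' vs e /vs[N0 H]; exists N0 => N /H; exact: le_trans.
Qed.

Lemma vanishD (s s' : nat -> \bar R) : vanish s -> vanish s' ->
  vanish (fun N => s N + s' N)%E.
Proof.
move=> vs vs' e e0; have e20 : 0 < e / 2 by rewrite divr_gt0.
have [N0 H0] := vs _ e20; have [N1 H1] := vs' _ e20.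
exists (maxn N0 N1) => N; rewrite geq_max => /andP[/H0 h0 /H1 h1].
by rewrite [e]splitr EFinD leeD.
Qed.

Lemma vanishZ (c : R) (s : nat -> \bar R) : 0 <= c ->
  vanish s -> vanish (fun N => c%:E * s N)%E.
Proof.
move=> c0 vs e e0; have h : 0 < e / (c + 1) by rewrite divr_gt0// ltr_wpDl.
have [N0 H0] := vs _ h; exists N0 => N /H0 h0.
apply: (@le_trans _ _ (c%:E * (e / (c + 1))%:E)%E); first by rewrite lee_wpmul2l.
rewrite -EFinM lee_fin mulrCA ler_piMr ?(ltW e0)//.
by rewrite ler_pdivrMr ?mul1r ?lerDl// ltr_wpDl.
Qed.

Lemma vanish_approx (s : nat -> \bar R) :
  (forall e : R, 0 < e -> exists s', vanish s' /\ forall N, (s N <= s' N + e%:E)%E) ->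
  vanish s.
Proof.
move=> H e e0; have e20 : 0 < e / 2 by rewrite divr_gt0.
have [s' [vs' ss']] := H _ e20.
have [N0 H0] := vs' _ e20; exists N0 => N /H0 h0.
by rewrite (le_trans (ss' N))// [e in leRHS]splitr EFinD leeD2r.
Qed.

Lemma cvg_vanish (s : nat -> \bar R) : s @ \oo --> 0%E -> vanish s.
Proof.
move=> s0 e e0.
have /fine_cvgP[fs /cvgrPdist_le /(_ _ e0) sd] := s0.
have : \forall N \near \oo, (s N <= e%:E)%E.
  near=> N.
  have sN : s N \is a fin_num by near: N.
  rewrite -(fineK sN) lee_fin (le_trans (ler_norm _))//.
  rewrite -normrN -[- _]sub0r; near: N; exact: sd.
by move=> [N0 _ H]; exists N0 => N NN0; exact: H.
Unshelve. all: end_near. Qed.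

Lemma vanish_cst0 : vanish (fun=> 0%E : \bar R).
Proof. by move=> e e0; exists 0%N => N _; rewrite lee_fin ltW. Qed.

End vanishing.

Section quadratic_form.
Context d (T : measurableType d) (R : realType).
Variable mu : {sigma_finite_measure set T -> \bar R}.
Implicit Types (w : T * T -> R) (u v g : T -> R).
Local Open Scope ereal_scope.

Definition sqint u : \bar R := \int[mu]_x (u x ^+ 2)%:E.

Definition quad w u : \bar R :=
  \int[mu \x mu]_z (w z * (u z.1 - u z.2) ^+ 2)%:E.

Lemma sqint_ge0 u : 0 <= sqint u.
Proof. by apply: integral_ge0 => x _; rewrite lee_fin sqr_ge0. Qed.

Lemma measurable_sqr u : measurable_fun setT u ->
  measurable_fun setT (fun x => (u x ^+ 2)%:E).
Proof. by move=> mu_; apply/measurable_EFinP; exact: measurable_funX. Qed.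

Lemma measurable_pull1 (u : T -> R) : measurable_fun setT u ->
  measurable_fun setT (fun z : T * T => u z.1).
Proof. by move=> mu_; exact: measurableT_comp. Qed.

Lemma measurable_pull2 (u : T -> R) : measurable_fun setT u ->
  measurable_fun setT (fun z : T * T => u z.2).
Proof. by move=> mu_; exact: measurableT_comp. Qed.

Lemma measurable_quad w u : measurable_fun setT w -> measurable_fun setT u ->
  measurable_fun setT (fun z : T * T => (w z * (u z.1 - u z.2) ^+ 2)%:E).
Proof.
move=> mw mu_; apply/measurable_EFinP; apply: measurable_funM => //.
by apply: measurable_funX; apply: measurable_funB;
  [exact: measurable_pull1|exact: measurable_pull2].
Qed.

Lemma quad_le2 w w1 w2 u u1 u2 (c1 c2 : R) :
  (forall z, (0 <= w z)%R) -> (forall z, (0 <= w1 z)%R) -> (forall z, (0 <= w2 z)%R) ->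
  measurable_fun setT w -> measurable_fun setT w1 -> measurable_fun setT w2 ->
  measurable_fun setT u -> measurable_fun setT u1 -> measurable_fun setT u2 ->
  (0 <= c1)%R -> (0 <= c2)%R ->
  (forall x y, (w (x, y) * (u x - u y) ^+ 2 <=
    c1 * (w1 (x, y) * (u1 x - u1 y) ^+ 2) + c2 * (w2 (x, y) * (u2 x - u2 y) ^+ 2))%R) ->
  quad w u <= c1%:E * quad w1 u1 + c2%:E * quad w2 u2.
Proof.
move=> w0 w10 w20 mw mw1 mw2 mu_ mu1 mu2 c10 c20 H.
have m1 := measurable_quad mw1 mu1; have m2 := measurable_quad mw2 mu2.
have p1 z : 0 <= (w1 z * (u1 z.1 - u1 z.2) ^+ 2)%:E by rewrite lee_fin mulr_ge0// sqr_ge0.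
have p2 z : 0 <= (w2 z * (u2 z.1 - u2 z.2) ^+ 2)%:E by rewrite lee_fin mulr_ge0// sqr_ge0.
rewrite /quad -(ge0_integralZl (mu \x mu) measurableT m1)//.
rewrite -(ge0_integralZl (mu \x mu) measurableT m2)//.
rewrite -ge0_integralD//; last 4 first.
- by move=> z _; rewrite mule_ge0.
- by apply: emeasurable_funM.
- by move=> z _; rewrite mule_ge0.
- by apply: emeasurable_funM.
apply: ge0_le_integral => //.
- by move=> z _; rewrite lee_fin mulr_ge0// sqr_ge0.
- exact: measurable_quad.
- by apply: emeasurable_funD; apply: emeasurable_funM.
- by move=> [x y] _ /=; rewrite -!EFinM -EFinD lee_fin H.
Qed.

End quadratic_form.

Section dominated_sqint.
Context d (T : measurableType d) (R : realType).
Variable mu : {sigma_finite_measure set T -> \bar R}.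

Lemma cvg_sqint0 (v : nat -> T -> R) (h : T -> R) :
  (forall k, measurable_fun setT (v k)) -> measurable_fun setT h ->
  {ae mu, forall x, v k x @[k --> \oo] --> 0} ->
  (forall k x, `|v k x| <= h x) -> (sqint mu h < +oo)%E ->
  sqint mu (v k) @[k --> \oo] --> 0%E.
Proof.
move=> mv mh v0 vh hoo.
have ih : mu.-integrable setT (fun x => (h x ^+ 2)%:E).
  apply/integrableP; split; first exact: measurable_sqr.
  by under eq_integral do rewrite /= ger0_norm ?sqr_ge0//.
have [] := @dominated_convergence _ _ _ mu setT measurableT
  (fun k x => (v k x ^+ 2)%:E) (cst 0%E) _ _ _ _ ih.
- by move=> k; exact: measurable_sqr.
- exact: measurable_cst.
- apply: filterS v0 => x vx _; apply: cvg_EFin; first exact: nearW.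
  by rewrite -[X in _ --> X](mulr0 (0 : R)); under eq_fun do rewrite expr2; exact: cvgM.
- apply: nearW => x k _ /=; rewrite lee_fin ger0_norm ?sqr_ge0//.
  have := vh k x; rewrite -(real_normK (num_real (v k x))) => vhx.
  by rewrite lerXn2r ?nnegrE//; exact: le_trans vhx.
by move=> _ _; rewrite integral0.
Qed.

End dominated_sqint.

Section markov.
Context d (T : measurableType d) (R : realType).
Variable mu : {sigma_finite_measure set T -> \bar R}.
Variable p : nat -> T * T -> R.
Hypotheses (p0 : forall N z, 0 <= p N z)
  (psym : forall N x y, p N (x, y) = p N (y, x))
  (mp : forall N, measurable_fun setT (p N))
  (p1 : forall N x, (\int[mu]_y (p N (x, y))%:E = 1)%E).

Lemma integral_markov1 N (f : T -> R) : (forall x, 0 <= f x) ->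
  measurable_fun setT f ->
  (\int[mu \x mu]_z (p N z * f z.1)%:E = \int[mu]_x (f x)%:E)%E.
Proof.
move=> f0 mf; rewrite fubini_tonelli1; last 2 first.
- apply/measurable_EFinP; apply: measurable_funM => //; exact: measurable_pull1.
- by move=> z; rewrite lee_fin mulr_ge0.
apply: eq_integral => x _; rewrite /fubini_F/=.
under eq_integral do rewrite mulrC EFinM.
rewrite ge0_integralZl//.
- by rewrite p1 mule1.
- by apply/measurable_EFinP; exact: measurableT_comp.
- by move=> y _; rewrite lee_fin.
- by rewrite lee_fin.
Qed.

Lemma integral_markov2 N (f : T -> R) : (forall x, 0 <= f x) ->
  measurable_fun setT f ->
  (\int[mu \x mu]_z (p N z * f z.2)%:E = \int[mu]_x (f x)%:E)%E.
Proof.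
move=> f0 mf; rewrite fubini_tonelli2; last 2 first.
- apply/measurable_EFinP; apply: measurable_funM => //; exact: measurable_pull2.
- by move=> z; rewrite lee_fin mulr_ge0.
apply: eq_integral => y _; rewrite /fubini_G/=.
under eq_integral do rewrite mulrC EFinM psym.
rewrite ge0_integralZl//.
- by rewrite p1 mule1.
- by apply/measurable_EFinP; exact: measurableT_comp.
- by move=> x _; rewrite lee_fin.
- by rewrite lee_fin.
Qed.

Lemma quad_le_sqint N (w : T * T -> R) (v f : T -> R) :
  (forall z, 0 <= w z) -> measurable_fun setT w ->
  measurable_fun setT v -> measurable_fun setT f ->
  (forall x y, w (x, y) * (v x - v y) ^+ 2 <=
     p N (x, y) * (2 * f x ^+ 2) + p N (x, y) * (2 * f y ^+ 2)) ->
  (quad mu w v <= 4%:E * sqint mu f)%E.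
Proof.
move=> w0 mw mv mf H.
have m2 : measurable_fun setT (fun x => 2 * f x ^+ 2).
  by apply: measurable_funM => //; exact: measurable_funX.
have f20 x : 0 <= 2 * f x ^+ 2 by rewrite mulr_ge0// sqr_ge0.
apply: (@le_trans _ _ (\int[mu \x mu]_z ((p N z * (2 * f z.1 ^+ 2))%:E + (p N z * (2 * f z.2 ^+ 2))%:E))%E).
  apply: ge0_le_integral => //.
  - by move=> z _; rewrite lee_fin mulr_ge0// sqr_ge0.
  - exact: measurable_quad.
  - apply/measurable_EFinP; apply: measurable_funD; apply: measurable_funM => //.
      exact: (measurable_pull1 m2).
    exact: (measurable_pull2 m2).
  - by move=> [x y] _; rewrite -EFinD lee_fin; exact: H.
rewrite ge0_integralD//; last 4 first.
- by move=> z _; rewrite lee_fin mulr_ge0.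
- apply/measurable_EFinP; apply: measurable_funM => //; exact: (measurable_pull1 m2).
- by move=> z _; rewrite lee_fin mulr_ge0.
- apply/measurable_EFinP; apply: measurable_funM => //; exact: (measurable_pull2 m2).
rewrite (integral_markov1 _ f20 m2) (integral_markov2 _ f20 m2).
under eq_integral do rewrite EFinM.
rewrite ge0_integralZl//; last 2 first.
- exact: measurable_sqr.
- by move=> x _; rewrite lee_fin sqr_ge0.
rewrite -ge0_muleDl// ?lee_fin// -EFinD.
by rewrite (_ : 2 + 2 = 4 :> R)//; ring.
Qed.

Lemma sqr_sub_le (r s : R) : (r - s) ^+ 2 <= 2 * r ^+ 2 + 2 * s ^+ 2.
Proof. by have := sqr_ge0 (r + s); rewrite -subr_ge0 => h; lra. Qed.

Lemma sqr_add_le (r s : R) : (r + s) ^+ 2 <= 2 * r ^+ 2 + 2 * s ^+ 2.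
Proof. by have := sqr_sub_le r (- s); rewrite opprK sqrrN. Qed.

Let max0_lipschitz (r s : R) : `|Num.max r 0 - Num.max s 0| <= `|r - s|.
Proof.
have h1 := ler_norm (r - s); have := ler_norm (s - r); rewrite distrC => h2.
move: (leP r 0) (leP s 0) => [r0|r0] [s0|s0]; rewrite ler_norml; lra.
Qed.

Let wle (W c1 c2 r s t : R) : 0 <= W -> t <= c1 * r + c2 * s ->
  W * t <= c1 * (W * r) + c2 * (W * s).
Proof.
move=> W0 h; rewrite (_ : _ + _ = W * (c1 * r + c2 * s)); last by ring.
by rewrite ler_wpM2l.
Qed.

Lemma quad_p_le N v : measurable_fun setT v ->
  (quad mu (p N) v <= 4%:E * sqint mu v)%E.
Proof.
move=> mv; apply: (@quad_le_sqint N) => // x y.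
by rewrite -mulrDr ler_wpM2l// sqr_sub_le.
Qed.

Variable g : T -> R.
Hypotheses (g0 : forall x, 0 < g x) (mg : measurable_fun setT g)
  (goo : (sqint mu g < +oo)%E) (vg : vanish (fun N => quad mu (p N) g)).

(** The minimum is bounded by [g] at either end point, so that the weighted form of a
    bounded function is controlled by [sqint mu g] through either variable. *)
Let wg N (z : T * T) : R := p N z * Num.min (g z.1) (g z.2) ^+ 2.

Let wg0 N z : 0 <= wg N z.
Proof. by rewrite mulr_ge0// sqr_ge0. Qed.

Let mwg N : measurable_fun setT (wg N).
Proof.
apply: measurable_funM => //; apply: measurable_funX.
by apply: measurable_minr; [exact: measurable_pull1|exact: measurable_pull2].
Qed.

Let min2_le1 x y : Num.min (g x) (g y) ^+ 2 <= g x ^+ 2.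
Proof. by rewrite lerXn2r ?nnegrE ?le_min ?ge_min ?lexx// ?ltW. Qed.

Let min2_le2 x y : Num.min (g x) (g y) ^+ 2 <= g y ^+ 2.
Proof. by rewrite lerXn2r ?nnegrE ?le_min ?ge_min ?lexx ?orbT// ?ltW. Qed.

Let quad_wg_le N v : measurable_fun setT v ->
  (quad mu (wg N) v <= 4%:E * sqint mu (fun x => (g x * v x)%R))%E.
Proof.
move=> mv; apply: (@quad_le_sqint N) => //; first exact: measurable_funM.
move=> x y; rewrite -mulrDr /wg/= -mulrA ler_wpM2l//.
apply: (@le_trans _ _ (Num.min (g x) (g y) ^+ 2 * (2 * v x ^+ 2 + 2 * v y ^+ 2))).
  by rewrite ler_wpM2l ?sqr_ge0// sqr_sub_le.
by rewrite mulrDr lerD// mulrCA ler_wpM2l// exprMn ler_wpM2r// sqr_ge0.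
Qed.

(** Bounded functions that vary slowly at the scale of the kernel.  Thanks to the weight
    [wg], all bounded functions have a finite form, constants included. *)
Let C (psi : T -> R) := [/\ measurable_fun setT psi,
  exists M : R, forall x, `|psi x| <= M & vanish (fun N => quad mu (wg N) psi)].

Let C_comb a b psi chi : C psi -> C chi -> C (fun x => a * psi x + b * chi x).
Proof.
move=> [mpsi [M1 M1P] v1] [mchi [M2 M2P] v2]; split.
- by apply: measurable_funD; apply: measurable_funM.
- exists (`|a| * M1 + `|b| * M2) => x; rewrite (le_trans (ler_normD _ _))// !normrM.
  by rewrite lerD// ler_wpM2l.
- have a20 : 0 <= 2 * a ^+ 2 by rewrite mulr_ge0// sqr_ge0.
  have b20 : 0 <= 2 * b ^+ 2 by rewrite mulr_ge0// sqr_ge0.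
  apply: vanish_le (vanishD (vanishZ a20 v1) (vanishZ b20 v2)) => N.
  apply: quad_le2 => //.
    by apply: measurable_funD; apply: measurable_funM.
  move=> x y; apply: wle => //.
  have -> : a * psi x + b * chi x - (a * psi y + b * chi y) =
    a * (psi x - psi y) + b * (chi x - chi y) by ring.
  by rewrite (le_trans (sqr_add_le _ _))// !exprMn !mulrA.
Qed.

Let C_cst c : C (cst c).
Proof.
split; [exact: measurable_cst|by exists (`|c|)|].
apply: (@vanish_le _ (fun=> 0%E)); last exact: vanish_cst0.
move=> N; rewrite /quad integral0_eq// => z _.
by rewrite /= subrr expr0n mulr0.
Qed.

Let C_le (L : R) (psi theta : T -> R) : 0 <= L -> C psi -> measurable_fun setT theta ->
  (exists M : R, forall x, `|theta x| <= M) ->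
  (forall x y, `|theta x - theta y| <= L * `|psi x - psi y|) -> C theta.
Proof.
move=> L0 [mpsi _ v1] mt bt H; split => //.
have c0 : vanish (fun N => quad mu (wg N) (cst 0)) by have [] := C_cst 0.
apply: vanish_le (vanishD (vanishZ (sqr_ge0 L) v1) (vanishZ (@ler01 R) c0)) => N.
apply: quad_le2 => //; first exact: sqr_ge0.
move=> x y /=; apply: wle => //; rewrite subrr expr0n mulr0 addr0 -exprMn.
rewrite -[leLHS]real_normK ?num_real// -[leRHS]real_normK ?num_real//.
by rewrite lerXn2r ?nnegrE// normrM (ger0_norm L0).
Qed.

(** Closure under bounded almost everywhere convergence: the form of the difference is
    at most 4 times the square integral of [g] times the difference, uniformly in [N]. *)
Let C_lim (M : R) (chi : nat -> T -> R) (psi : T -> R) : (forall k, C (chi k)) ->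
  (forall k x, `|chi k x| <= M) -> measurable_fun setT psi ->
  (forall x, `|psi x| <= M) ->
  {ae mu, forall x, chi k x @[k --> \oo] --> psi x} -> C psi.
Proof.
move=> Cchi Mchi mpsi Mpsi cv; split => //; first by exists M.
apply: vanish_approx => e e0.
have mchi k : measurable_fun setT (chi k) by have [] := Cchi k.
have cv0 : sqint mu (fun x => g x * (psi x - chi k x)) @[k --> \oo] --> 0%E.
  apply: (@cvg_sqint0 _ _ _ mu _ (fun x => g x * (2 * M))).
  - by move=> k; apply: measurable_funM => //; exact: measurable_funB.
  - exact: measurable_funM.
  - apply: filterS cv => x cx; rewrite -[X in _ --> X](mulr0 (g x)); apply: cvgMr.
    by rewrite -(subrr (psi x)); apply: cvgB => //; exact: cvg_cst.
  - move=> k x; rewrite normrM (ger0_norm (ltW (g0 x))) ler_wpM2l ?(ltW (g0 x))//.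
    by rewrite (le_trans (ler_normB _ _))// mulr_natl mulr2n lerD.
  - rewrite /sqint; under eq_integral do rewrite exprMn mulrC EFinM.
    rewrite ge0_integralZl//; last 3 first.
    + exact: measurable_sqr.
    + by move=> x _; rewrite lee_fin sqr_ge0.
    + by rewrite lee_fin sqr_ge0.
    rewrite lte_mul_pinfty// ?lee_fin ?sqr_ge0//.
have e8 : 0 < e / 8 by rewrite divr_gt0.
have [k0 /(_ _ (leqnn _)) hk] := cvg_vanish cv0 e8.
have [_ _ vk] := Cchi k0.
exists (fun N => 2%:E * quad mu (wg N) (chi k0))%E; split; first exact: vanishZ.
move=> N.
have mB : measurable_fun setT (fun x => psi x - chi k0 x) by exact: measurable_funB.
apply: (@le_trans _ _ (2%:E * quad mu (wg N) (chi k0) + 2%:E * quad mu (wg N) (fun x => (psi x - chi k0 x)%R))%E).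
  apply: quad_le2 => // x y; apply: wle => //.
  have -> : psi x - psi y = (chi k0 x - chi k0 y) + (psi x - chi k0 x - (psi y - chi k0 y)) by ring.
  exact: sqr_add_le.
rewrite leeD2l//; apply: (@le_trans _ _ (2%:E * (4%:E * (e / 8)%:E))%E).
  rewrite lee_wpmul2l ?lee_fin//; apply: le_trans (quad_wg_le _ mB) _.
  by rewrite lee_wpmul2l ?lee_fin.
by rewrite -!EFinM lee_fin; lra.
Qed.

Let C_sum (I : Type) (r : seq I) (h : I -> T -> R) : (forall i, C (h i)) ->
  C (fun x => \sum_(i <- r) h i x).
Proof.
move=> Ch; elim: r => [|i r IH].
  by have := C_cst 0; congr C; apply/funext => x; rewrite big_nil.
have := C_comb 1 1 (Ch i) IH; congr C; apply/funext => x.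
by rewrite big_cons !mul1r.
Qed.

Let Cset (A : set T) := measurable A /\ C \1_A.

Let indic_le1 (A : set T) (x : T) : `|\1_A x : R| <= 1.
Proof. by rewrite indicE ger0_norm// lern1 leq_b1. Qed.

Let Cset_C A : Cset A -> Cset (~` A).
Proof.
move=> [mA CA]; split; first exact: measurableC.
have := C_comb 1 (-1) (C_cst 1) CA; congr C; apply/funext => x /=.
by rewrite !indicE in_setC; case: (x \in A) => /=; ring.
Qed.

Let Cset_U A B : Cset A -> Cset B -> Cset (A `|` B).
Proof.
move=> [mA CA] [mB CB]; split; first exact: measurableU.
have [_ _ vA] := CA; have [_ _ vB] := CB.
split; [exact: measurable_indic (measurableU _ _ mA mB)|by exists 1|].
apply: vanish_le (vanishD (vanishZ (@ler01 R) vA) (vanishZ (@ler01 R) vB)) => N.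
apply: quad_le2 => //; try exact: measurable_indic.
  exact: measurable_indic (measurableU _ _ mA mB).
move=> x y; apply: wle => //; rewrite !indicE !in_setU !mul1r.
by case: (x \in A); case: (x \in B); case: (y \in A); case: (y \in B) => /=; nra.
Qed.

Let Cset_bigcup (F : nat -> set T) : (forall k, Cset (F k)) ->
  nondecreasing_seq F -> Cset (\bigcup_k F k).
Proof.
move=> CF ndF; have mF k : measurable (F k) by have [] := CF k.
have mU : measurable (\bigcup_k F k) by exact: bigcup_measurable.
split => //; apply: (@C_lim 1 (fun k => \1_(F k))) => //.
- by move=> k; have [] := CF k.
apply: nearW => x; have [[k _ Fkx]|nFx] := pselect ((\bigcup_k F k) x); last first.
  rewrite (_ : (fun k => _) = cst (\1_(\bigcup_k F k) x)); first exact: cvg_cst.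
  apply/funext => k; rewrite !indicE !memNset// => Fkx; apply: nFx; by exists k.
apply: cvg_near_cst; exists k => // j /= kj.
rewrite !indicE !mem_set//; first by exists k.
by have := ndF _ _ kj; rewrite subsetEset; apply.
Qed.

Let Cset_ae A B : Cset A -> measurable B -> {ae mu, forall x, A x <-> B x} -> Cset B.
Proof.
move=> [mA CA] mB AB; split => //; apply: (@C_lim 1 (fun=> \1_A)) => //.
apply: filterS AB => x ABx.
have -> : \1_B x = \1_A x :> R.
  rewrite !indicE; congr (_%:R); congr nat_of_bool.
  by apply/idP/idP; rewrite !inE; case: ABx => ? ?.
exact: cvg_cst.
Qed.

(** The Lipschitz functions [th k] of [psi] decrease to the indicator. *)
Let Cset_le psi c : C psi -> Cset [set x | psi x <= c].
Proof.
move=> Cpsi; have [mpsi _ _] := Cpsi.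
have mle : measurable [set x | psi x <= c].
  rewrite -[X in measurable X]setTI.
  exact: (measurable_fun_le measurableT mpsi (measurable_cst c)).
split => //.
pose h x : R := Num.max (psi x - c) 0.
have h0 x : 0 <= h x by rewrite le_max lexx orbT.
have mh : measurable_fun setT h.
  by apply: measurable_maxr => //; exact: measurable_funB.
pose th (k : nat) x : R := (1 + k%:R * h x)^-1.
have pos k x : 0 < 1 + k%:R * h x by rewrite ltr_wpDr// mulr_ge0.
have th1 k x : `|th k x| <= 1.
  by rewrite /th ger0_norm ?invr_ge0 ?(ltW (pos k x))// invf_le1 ?pos// lerDl mulr_ge0.
have mth k : measurable_fun setT (th k).
  rewrite (_ : th k = fun x => (1 + k%:R * h x) `^ (- 1)); last first.
    by apply/funext => x; rewrite powR_inv1// ltW.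
  apply: (measurableT_comp (measurable_powR _)).
  by apply: measurable_funD => //; exact: measurable_funM.
apply: (@C_lim 1 th) => //.
- move=> k; apply: (C_le (ler0n _ k) Cpsi) => //; first by exists 1.
  move=> x y; rewrite /th.
  have -> : (1 + k%:R * h x)^-1 - (1 + k%:R * h y)^-1 =
      k%:R * (h y - h x) / ((1 + k%:R * h x) * (1 + k%:R * h y)).
    by field; rewrite !gt_eqF.
  rewrite normrM normfV (ger0_norm (mulr_ge0 (ltW (pos k x)) (ltW (pos k y)))).
  rewrite ler_pdivrMr ?mulr_gt0//.
  apply: (@le_trans _ _ (k%:R * `|psi x - psi y|)).
    rewrite normrM ger0_norm// ler_wpM2l// distrC /h.
    have -> : psi x - psi y = (psi x - c) - (psi y - c) by ring.
    exact: max0_lipschitz.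
  rewrite ler_peMr ?mulr_ge0//.
  rewrite -[leLHS]mulr1 ler_pM// lerDl mulr_ge0//.
apply: nearW => x; rewrite indicE.
have [xc|xc] := leP (psi x) c.
  rewrite mem_set//=; rewrite (_ : th ^~ x = cst 1); first exact: cvg_cst.
  apply/funext => k; rewrite /th /h (_ : Num.max _ _ = 0) ?mulr0 ?addr0 ?invr1//.
  by apply/max_idPr; rewrite subr_le0.
rewrite memNset/=; last by apply/negP; rewrite -ltNge.
have hx : 0 < h x by rewrite lt_max subr_gt0 xc.
apply: (@squeeze_cvgr _ _ _ _ (fun=> 0) (fun k => (h x)^-1 * k%:R^-1)).
- near=> k; rewrite /th invr_ge0 ltW ?pos//=.
  have k0 : 0 < k%:R :> R by near: k; exact: nbhs_infty_gtr.
  by rewrite -invfM lef_pV2 ?posrE ?mulr_gt0// mulrC lerDr.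
- exact: cvg_cst.
- rewrite -[X in _ --> X](mulr0 (h x)^-1); apply: cvgMr.
  apply/gtr0_cvgV0; last exact: cvgr_idn.
  by near=> k; near: k; exact: nbhs_infty_gtr.
Unshelve. all: end_near. Qed.

Variable Psi : set (T -> R).
Hypothesis PsiP : forall psi, Psi psi -> [/\ measurable_fun setT psi,
  forall x, `|psi x| <= 1 & vanish (fun N => quad mu (p N) (fun x => g x * psi x))].
Hypothesis Psi_generates : forall S : set (set T),
  (forall A, S A -> S (~` A)) -> (forall A B, S A -> S B -> S (A `|` B)) ->
  (forall F : nat -> set T, (forall k, S (F k)) -> nondecreasing_seq F ->
    S (\bigcup_k F k)) ->
  (forall A B, S A -> measurable B -> {ae mu, forall x, A x <-> B x} -> S B) ->
  (forall psi c, Psi psi -> S [set x | psi x <= c]) ->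
  forall A, measurable A -> S A.

Let C_Psi psi : Psi psi -> C psi.
Proof.
move=> /PsiP[mpsi psi1 vpsi]; split => //; first by exists 1.
have m2 : measurable_fun setT (fun x => g x * psi x) by exact: measurable_funM.
have c20 : 0 <= 2 :> R by [].
apply: vanish_le (vanishD (vanishZ c20 vpsi) (vanishZ c20 vg)) => N.
apply: quad_le2 => // x y; rewrite /wg/= -mulrA; apply: wle => //.
apply: (@le_trans _ _ (g x ^+ 2 * (psi x - psi y) ^+ 2)).
  by rewrite ler_wpM2r ?sqr_ge0.
have -> : g x ^+ 2 * (psi x - psi y) ^+ 2 =
  ((g x * psi x - g y * psi y) + - (psi y * (g x - g y))) ^+ 2 by ring.
rewrite (le_trans (sqr_add_le _ _))// lerD2l ler_wpM2l// sqrrN exprMn.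
rewrite -[leRHS]mul1r ler_wpM2r ?sqr_ge0//.
by rewrite -[leLHS]real_normK ?num_real// expr_le1.
Qed.

Let Cset_measurable A : measurable A -> Cset A.
Proof.
apply: (Psi_generates Cset_C Cset_U Cset_bigcup Cset_ae).
by move=> psi c /C_Psi; exact: Cset_le.
Qed.

Import HBNNSimple.

Let C_bounded_ge0 (M : R) (psi : T -> R) : measurable_fun setT psi -> (forall x, 0 <= psi x <= M) ->
  C psi.
Proof.
move=> mpsi psiM.
have mE : measurable_fun setT (EFin \o psi) by exact/measurable_EFinP.
pose f := nnsfun_approx measurableT mE.
have fle k x : f k x <= psi x.
  have nd : nondecreasing_seq (f ^~ x) by move=> i j ij; exact/lefP/nd_nnsfun_approx.
  have cv : f k x @[k --> \oo] --> psi x.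
    have h : (EFin \o f ^~ x) @ \oo --> (EFin \o psi) x.
      by apply: cvg_nnsfun_approx => // y _; rewrite lee_fin; have /andP[] := psiM y.
    by have /fine_cvgP[] := h.
  by rewrite -(cvg_lim _ cv)//; apply: nondecreasing_cvgn_le => //; exact: cvgP cv.
apply: (@C_lim M f) => //.
- move=> k.
  have -> : f k = (fun x => \sum_(y <- finmap.enum_fset (fset_set (range (f k)))) y * \1_(f k @^-1` [set y]) x) :> (T -> R).
    by apply/funext => x; rewrite fimfunE fsbig_finite.
  apply: C_sum => y.
  have [_ Cy] := Cset_measurable (measurable_sfunP (f k) (measurable_set1 y)).
  have := C_comb y 0 Cy (C_cst 0); congr C; apply/funext => x.
  by rewrite mul0r addr0.
- move=> k x; rewrite ger0_norm// (le_trans (fle k x))//.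
  by have /andP[] := psiM x.
- by move=> x; rewrite ger0_norm; have /andP[] := psiM x.
- apply: nearW => x.
  have h : (EFin \o f ^~ x) @ \oo --> (EFin \o psi) x.
    by apply: cvg_nnsfun_approx => // y _; rewrite lee_fin; have /andP[] := psiM y.
  by have /fine_cvgP[] := h.
Qed.

Let C_bounded (M : R) (psi : T -> R) : measurable_fun setT psi -> (forall x, `|psi x| <= M) ->
  C psi.
Proof.
move=> mpsi psiM.
have CM : C (fun x => psi x + M).
  apply: (@C_bounded_ge0 (M + M)); first exact: measurable_funD.
  by move=> x; have := psiM x; rewrite ler_norml => /andP[h1 h2]; apply/andP; split; lra.
have := C_comb 1 (- M) CM (C_cst 1); congr C; apply/funext => x /=; ring.
Qed.

(** The symmetric Markov kernels [p N] approach the identity on all square integrable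
    functions as soon as they do on [g] and on the products of [g] with a family
    whose sublevel sets generate the measurable sets.  Write [u] as a limit of
    [g psi] with [psi] bounded. *)
Lemma vanish_quad (u : T -> R) : measurable_fun setT u -> (sqint mu u < +oo)%E ->
  vanish (fun N => quad mu (p N) u).
Proof.
move=> mu_ uoo.
pose A k := [set x | `|u x| <= k%:R * g x].
have mA k : measurable (A k).
  rewrite -[X in measurable X]setTI; apply: measurable_fun_le => //.
    exact: measurableT_comp.
  exact: measurable_funM.
pose psi k x := u x / g x * \1_(A k) x.
pose uk k x := g x * psi k x.
have mV : measurable_fun setT (fun x => (g x)^-1).
  rewrite (_ : (fun _ => _) = (fun x => g x `^ (- 1))); last first.
    by apply/funext => x; rewrite powR_inv1// ltW.
  exact: (measurableT_comp (measurable_powR _)).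
have mpsi k : measurable_fun setT (psi k).
  by apply: measurable_funM => //; exact: measurable_funM.
have muk k : measurable_fun setT (uk k) by exact: measurable_funM.
have ukE k x : uk k x = u x * \1_(A k) x.
  by rewrite /uk /psi mulrA [g x * _]mulrC divfK// gt_eqF.
have psik k x : `|psi k x| <= k%:R.
  rewrite /psi indicE; have [xA|xA] := boolP (x \in A k); last by rewrite mulr0 normr0.
  rewrite mulr1 normrM normfV (ger0_norm (ltW (g0 x))) ler_pdivrMr//.
  by move: xA; rewrite inE.
have vuk k : vanish (fun N => quad mu (p N) (uk k)).
  have [_ _ vpsi] := C_bounded (mpsi k) (psik k).
  have k20 : 0 <= 2 * k%:R ^+ 2 :> R by rewrite mulr_ge0// sqr_ge0.
  have c20 : 0 <= 2 :> R by [].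
  apply: vanish_le (vanishD (vanishZ k20 vg) (vanishZ c20 vpsi)) => N.
  apply: quad_le2 => // x y; rewrite /wg/= -[X in _ <= _ + _ * X]mulrA; apply: wle => //.
  have step z w : (uk k z - uk k w) ^+ 2 <=
     2 * k%:R ^+ 2 * (g z - g w) ^+ 2 + 2 * (g w ^+ 2 * (psi k z - psi k w) ^+ 2).
    have -> : uk k z - uk k w = psi k z * (g z - g w) + g w * (psi k z - psi k w).
      by rewrite /uk; ring.
    rewrite (le_trans (sqr_add_le _ _))//.
    rewrite [(psi k z * _) ^+ 2]exprMn [(g w * _) ^+ 2]exprMn.
    rewrite lerD2r -[leRHS]mulrA ler_wpM2l//.
    rewrite ler_wpM2r ?sqr_ge0// -[leLHS]real_normK ?num_real//.
    by rewrite lerXn2r ?nnegrE.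
  (* the bound [step] carries the value of [g] at its second point: choose the
     point where [g] is smaller *)
  have [gxy|gyx] := leP (g x) (g y).
    have sw (r s : R) : (r - s) ^+ 2 = (s - r) ^+ 2 by rewrite -sqrrN opprB.
    rewrite (sw (uk k x)) (sw (g x)) (sw (psi k x)); exact: step.
  exact: step.
apply: vanish_approx => e e0.
have e8 : 0 < e / 8 by rewrite divr_gt0.
have cv0 : sqint mu (fun x => u x - uk k x) @[k --> \oo] --> 0%E.
  apply: (@cvg_sqint0 _ _ _ mu _ (fun x => `|u x|)).
  - by move=> k; exact: measurable_funB.
  - exact: measurableT_comp.
  - apply: nearW => x; apply: cvg_near_cst; exists (Num.truncn (`|u x| / g x)).+1 => // k /= kx.
    rewrite ukE indicE mem_set/= ?mulr1 ?subrr// /A/=.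
    rewrite -ler_pdivrMr//; apply: ltW; apply: lt_le_trans (Num.Theory.truncnS_gt _) _.
    by rewrite ler_nat.
  - move=> k x; rewrite ukE indicE; case: (x \in A k) => /=.
      by rewrite mulr1 subrr normr0.
    by rewrite mulr0 subr0.
  - by rewrite /sqint; under eq_integral do rewrite real_normK ?num_real//.
have [k0 /(_ _ (leqnn _)) hk] := cvg_vanish cv0 e8.
exists (fun N => 2%:E * quad mu (p N) (uk k0))%E; split; first exact: vanishZ.
move=> N.
have mB : measurable_fun setT (fun x => u x - uk k0 x) by exact: measurable_funB.
apply: (@le_trans _ _ (2%:E * quad mu (p N) (uk k0) + 2%:E * quad mu (p N) (fun x => (u x - uk k0 x)%R))%E).
  apply: quad_le2 => // x y; apply: wle => //.
  have -> : u x - u y = (uk k0 x - uk k0 y) + (u x - uk k0 x - (u y - uk k0 y)) by ring.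
  exact: sqr_add_le.
rewrite leeD2l//; apply: (@le_trans _ _ (2%:E * (4%:E * (e / 8)%:E))%E).
  rewrite lee_wpmul2l ?lee_fin//; apply: le_trans (quad_p_le _ mB) _.
  by rewrite lee_wpmul2l ?lee_fin.
by rewrite -!EFinM lee_fin; lra.
Qed.

End markov.

(** * Approximation in mean square *)

Section ae_limit.
Context d (T : measurableType d) (R : realType).
Variable mu : {sigma_finite_measure set T -> \bar R}.

(** Young's inequality in the form which lets [v] replace [u] at the cost of a
    factor as close to 1 as desired. *)
Lemma wsqint_approx (w u v : T -> R) (eta B : R) : 0 < eta -> 0 <= B ->
  measurable_fun setT w -> (forall x, 0 <= w x <= B) ->
  measurable_fun setT u -> measurable_fun setT v ->
  (\int[mu]_x (w x * u x ^+ 2)%:E <= (1 + eta)%:E * \int[mu]_x (w x * v x ^+ 2)%:E +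
    ((1 + eta^-1) * B)%:E * sqint mu (fun x => (v x - u x)%R))%E.
Proof.
move=> eta0 B0 mw wB mu_ mv.
have w0 x : 0 <= w x by have /andP[] := wB x.
have ei : 0 < eta^-1 by rewrite invr_gt0.
have m1 (f : T -> R) : measurable_fun setT f -> measurable_fun setT (fun x => (w x * f x ^+ 2)%:E).
  move=> mf; apply/measurable_EFinP; apply: measurable_funM => //; exact: measurable_funX.
have f0 (f : T -> R) x : (0 <= (w x * f x ^+ 2)%:E)%E by rewrite lee_fin mulr_ge0 ?sqr_ge0.
have mB : measurable_fun setT (fun x => v x - u x) by exact: measurable_funB.
have e1 : 0 <= 1 + eta by rewrite addr_ge0// ltW.
have e2 : 0 <= (1 + eta^-1) * B by rewrite mulr_ge0// addr_ge0// ltW.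
rewrite /sqint -!ge0_integralZl//.
all: try exact: m1.
all: try exact: measurable_sqr.
all: try (by move=> x _; rewrite lee_fin sqr_ge0).
rewrite -ge0_integralD//.
all: try (by apply: measurable_funeM; apply: m1).
all: try (by apply: measurable_funeM; apply: measurable_sqr).
all: try (by move=> x _; rewrite mule_ge0// lee_fin ?sqr_ge0).
apply: ge0_le_integral => //.
- exact: m1.
- by apply: emeasurable_funD; apply: measurable_funeM; [exact: m1|exact: measurable_sqr].
move=> x _; rewrite -!EFinM -EFinD lee_fin.
have /andP[wx0 wxB] := wB x.
have key : u x ^+ 2 <= (1 + eta) * v x ^+ 2 + (1 + eta^-1) * (v x - u x) ^+ 2.
  have := mulr_ge0 (ltW ei) (sqr_ge0 (eta * v x + (v x - u x))).
  move=> H; rewrite -[leLHS]add0r -lerBrDr; apply: le_trans H _.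
  by rewrite le_eqVlt; apply/orP; left; apply/eqP; field; rewrite gt_eqF.
apply: le_trans (ler_wpM2l wx0 key) _.
rewrite mulrDr mulrCA lerD2l mulrA [w x * _]mulrC ler_wpM2r ?sqr_ge0//.
by rewrite ler_wpM2l// addr_ge0// ltW.
Qed.

Lemma sqint_le2 (u v : T -> R) : measurable_fun setT u -> measurable_fun setT v ->
  (sqint mu u <= 2%:E * sqint mu v + 2%:E * sqint mu (fun x => (v x - u x)%R))%E.
Proof.
move=> mu_ mv; have := @wsqint_approx (cst 1) u v 1 1 ltr01 ler01.
have m1 : measurable_fun setT (cst (1 : R) : T -> R) by exact: measurable_cst.
move=> /(_ m1 _ mu_ mv); rewrite invr1 mulr1 (_ : 1 + 1 = 2 :> R); last by lra.
have cE (f : T -> R) : (\int[mu]_x (cst 1 x * f x ^+ 2)%:E = sqint mu f)%E.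
  by apply: eq_integral => x _; rewrite mul1r.
by rewrite !cE; apply => x; rewrite ler01 lexx.
Qed.

Lemma sqint_subC (u v : T -> R) :
  sqint mu (fun x => u x - v x) = sqint mu (fun x => v x - u x).
Proof. by apply: eq_integral => x _; rewrite -sqrrN opprB. Qed.

(** An inequality between weighted square integrals on a dense class extends to
    limits in mean square: apply [wsqint_approx] on both sides, with [eta] and [e]
    small enough for a loss of [d0]. *)
Lemma wsqint_le_approx (w1 w2 f g : T -> R) (B : R) : 0 <= B ->
  measurable_fun setT w1 -> (forall x, 0 <= w1 x <= B) ->
  measurable_fun setT w2 -> (forall x, 0 <= w2 x <= B) ->
  measurable_fun setT f -> measurable_fun setT g -> (sqint mu g < +oo)%E ->
  (forall e : R, 0 < e -> exists a b : T -> R, [/\ measurable_fun setT a, measurable_fun setT b,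
    (\int[mu]_x (w1 x * a x ^+ 2)%:E <= \int[mu]_x (w2 x * b x ^+ 2)%:E)%E,
    (sqint mu (fun x => (a x - f x)%R) <= e%:E)%E &
    (sqint mu (fun x => (b x - g x)%R) <= e%:E)%E]) ->
  (\int[mu]_x (w1 x * f x ^+ 2)%:E <= \int[mu]_x (w2 x * g x ^+ 2)%:E)%E.
Proof.
move=> B0 mw1 w1B mw2 w2B mf mg goo H.
have W0 : (0 <= \int[mu]_x (w2 x * g x ^+ 2)%:E)%E.
  by apply: integral_ge0 => x _; rewrite lee_fin mulr_ge0 ?sqr_ge0//; have /andP[] := w2B x.
have Wfin : (\int[mu]_x (w2 x * g x ^+ 2)%:E)%E \is a fin_num.
  rewrite ge0_fin_numE//; apply: (@le_lt_trans _ _ (B%:E * sqint mu g)%E).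
    rewrite -ge0_integralZl//; last 2 first.
    - exact: measurable_sqr.
    - by move=> x _; rewrite lee_fin sqr_ge0.
    apply: ge0_le_integral => //.
    - by move=> x _; rewrite lee_fin mulr_ge0 ?sqr_ge0//; have /andP[] := w2B x.
    - by apply/measurable_EFinP; apply: measurable_funM => //; exact: measurable_funX.
    - by apply: measurable_funeM; exact: measurable_sqr.
    by move=> x _; rewrite -EFinM lee_fin ler_wpM2r ?sqr_ge0//; have /andP[] := w2B x.
  by rewrite lte_mul_pinfty.
set W := (\int[mu]_x (w2 x * g x ^+ 2)%:E)%E in W0 Wfin *.
apply/lee_addgt0Pr => d0 d00; rewrite -(fineK Wfin).
have r0 : 0 <= fine W by rewrite fine_ge0.
set r := fine W in r0 *.
pose eta := d0 / (d0 + 6 * r + 6).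
have den : 0 < d0 + 6 * r + 6 by lra.
have eta0 : 0 < eta by rewrite divr_gt0.
have eta1 : eta <= 1 by rewrite ler_pdivrMr// mul1r; lra.
have etar : 3 * eta * r <= d0 / 2.
  rewrite /eta -subr_ge0.
  rewrite (_ : _ - _ = d0 * (d0 + 6) / (2 * (d0 + 6 * r + 6))); last by field; rewrite gt_eqF.
  by apply: divr_ge0; nra.
pose C := (1 + eta^-1) * B.
have C0 : 0 <= C by rewrite mulr_ge0// addr_ge0// invr_ge0 ltW.
have e0 : 0 < d0 / (6 * C + 6) by rewrite divr_gt0//; lra.
have [a [b [ma mb ab af bg]]] := H _ e0.
set e := d0 / (6 * C + 6) in e0 af bg.
have Ce : 3 * (C * e) <= d0 / 2.
  have den2 : 0 < 6 * C + 6 by lra.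
  rewrite /e -subr_ge0 (_ : _ - _ = 3 * d0 / (6 * C + 6)); last by field; rewrite gt_eqF.
  by apply: divr_ge0; lra.
have s1 := wsqint_approx eta0 B0 mw1 w1B mf ma.
have s2 := wsqint_approx eta0 B0 mw2 w2B mb mg.
have s1' := le_trans s1 (leeD (lee_wpmul2l _ ab) (lee_wpmul2l _ af)).
have s2' : (\int[mu]_x (w2 x * b x ^+ 2)%:E <= ((1 + eta) * r + C * e)%:E)%E.
  apply: le_trans s2 _; rewrite -/W -(fineK Wfin) -/r sqint_subC -/C.
  rewrite (_ : ((1 + eta) * r + C * e)%:E = (1 + eta)%:E * r%:E + C%:E * e%:E)%E//.
  by rewrite leeD2l// lee_wpmul2l// lee_fin.
apply: le_trans (s1' _ _) _; rewrite ?lee_fin//; first lra.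
apply: (@le_trans _ _ ((1 + eta)%:E * ((1 + eta) * r + C * e)%:E + C%:E * e%:E)%E).
  by rewrite leeD2r// lee_wpmul2l// lee_fin; lra.
rewrite -!EFinM -!EFinD lee_fin.
have Ce0 : 0 <= C * e by rewrite mulr_ge0// ltW.
have h1 : eta * (C * e) <= C * e by rewrite ler_piMl.
have h2 : eta * (eta * r) <= eta * r by rewrite ler_piMl// mulr_ge0// ltW.
rewrite (_ : _ + _ = r + 2 * (eta * r) + eta * (eta * r) + 2 * (C * e) + eta * (C * e)); last by ring.
have : 3 * eta * r = 3 * (eta * r) by ring.
lra.
Qed.

Let sum_half n : \sum_(0 <= j < n) (2^-1 : R) ^+ j <= 2.
Proof.
have -> : \sum_(0 <= j < n) (2^-1 : R) ^+ j = 2 - 2 * 2^-1 ^+ n.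
  elim: n => [|n IH]; first by rewrite big_nil expr0 mulr1 subrr.
  by rewrite big_nat_recr//= IH exprS; field.
by rewrite gerBl mulr_ge0// exprn_ge0// invr_ge0.
Qed.

(** A sequence which is Cauchy in mean square at a geometric rate converges
    almost everywhere, since [`|d| <= 2^-j + 2^j d^2]. *)
Lemma ae_cvg_geometric (v : nat -> T -> R) (C : R) : 0 <= C ->
  (forall j, measurable_fun setT (v j)) ->
  (forall j, (sqint mu (fun x => (v j.+1 x - v j x)%R) <= (C * 4^-1 ^+ j)%:E)%E) ->
  exists g : T -> R, measurable_fun setT g /\
    {ae mu, forall x, v j x @[j --> \oo] --> g x}.
Proof.
move=> C0 mv vC.
pose d_ j x : R := v j.+1 x - v j x.
have md j : measurable_fun setT (d_ j) by exact: measurable_funB.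
pose F x := (\sum_(0 <= j <oo) (2 ^+ j * d_ j x ^+ 2)%:E)%E.
have mF j : measurable_fun setT (fun x => (2 ^+ j * d_ j x ^+ 2)%:E).
  by apply/measurable_EFinP; apply: measurable_funM => //; exact: measurable_funX.
have F0 j x : (0 <= (2 ^+ j * d_ j x ^+ 2)%:E :> \bar R)%E.
  by rewrite lee_fin mulr_ge0 ?sqr_ge0// exprn_ge0.
have intF : (\int[mu]_x F x <= (C * 2)%:E)%E.
  rewrite /F integral_nneseries//; apply: lime_le.
    by apply: is_cvg_ereal_nneg_natsum => j _; apply: integral_ge0.
  apply: nearW => n.
  apply: (@le_trans _ _ (\sum_(0 <= j < n) (C * 2^-1 ^+ j)%:E)%E).
    apply: lee_sum => j _.
    under eq_integral do rewrite EFinM.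
    rewrite ge0_integralZl//; last 2 first.
    - exact: measurable_sqr.
    - by move=> x _; rewrite lee_fin sqr_ge0.
    apply: le_trans (lee_wpmul2l _ (vC j)) _; first by rewrite lee_fin exprn_ge0.
    rewrite -EFinM lee_fin mulrCA ler_wpM2l// -exprMn.
    by rewrite (_ : 2 * 4^-1 = 2^-1 :> R)//; lra.
  by rewrite sumEFin lee_fin -mulr_sumr ler_wpM2l.
have mFF : measurable_fun setT F by exact: ge0_emeasurable_sum.
have iF : mu.-integrable setT F.
  apply/integrableP; split => //; under eq_integral do rewrite gee0_abs ?nneseries_ge0//.
  by apply: le_lt_trans intF _; rewrite ltry.
exists (fun x => fine (limn_esup (fun j => (v j x)%:E))); split.
  apply: measurableT_comp => //.
  by apply: (measurable_fun_limn_esup (f := fun j x => (v j x)%:E)) => // j; exact/measurable_EFinP.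
apply: filterS (integrable_ae measurableT iF) => x /(_ I) Ffin.
suff cv : cvgn (fun j => v j x).
  have cvE : (v j x)%:E @[j --> \oo] --> (limn (fun j => v j x))%:E.
    by apply: cvg_EFin; [exact: nearW|exact: cv].
  by have [_ ->] := cvg_limn_einf_sup cvE.
have vE : (fun j => v j x) = (fun j => v 0%N x + series (fun j => d_ j x) j).
  apply/funext => j; rewrite /series /= telescope_sumr//.
  by rewrite addrC subrK.
rewrite vE; apply: is_cvgD; first exact: is_cvg_cst.
apply: normed_cvg; apply: nondecreasing_is_cvgn.
  by apply: nondecreasing_series => j _ _; exact: normr_ge0.
exists (2 + fine (F x)) => _ [n _ <-]; rewrite /series/=.
apply: (@le_trans _ _ (\sum_(0 <= j < n) ((2^-1 : R) ^+ j + 2 ^+ j * d_ j x ^+ 2))).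
  apply: ler_sum => j _.
  have e0 : 0 < (2 : R) ^+ j by rewrite exprn_gt0.
  rewrite exprVn; set e := 2 ^+ j in e0 *.
  have := mulr_ge0 (ltW e0) (sqr_ge0 (e^-1 - `|d_ j x|)).
  have := normr_ge0 (d_ j x); rewrite -(real_normK (num_real (d_ j x))).
  set D := `|d_ j x| => D0.
  rewrite (_ : e * (e^-1 - D) ^+ 2 = e^-1 + e * D ^+ 2 - 2 * D); last by field; rewrite gt_eqF.
  by move=> ?; lra.
rewrite big_split/= lerD// -lee_fin fineK// -sumEFin.
exact: (@nneseries_lim_ge _ (fun j => (2 ^+ j * d_ j x ^+ 2)%:E) xpredT).
Qed.

End ae_limit.

(** * Kernel transforms: Plancherel and the uncertainty inequality *)

Section fatou_bound.
Context d (T : measurableType d) (R : realType).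
Variable mu : {measure set T -> \bar R}.

(** Fatou's lemma for an almost everywhere limit and uniformly bounded integrals. *)
Lemma ge0_integral_le_lim (f : nat -> T -> \bar R) (g : T -> \bar R) (C : \bar R) :
  (forall k, measurable_fun setT (f k)) -> measurable_fun setT g ->
  (forall k x, (0 <= f k x)%E) -> (forall x, (0 <= g x)%E) ->
  {ae mu, forall x, f k x @[k --> \oo] --> g x} ->
  (forall k, (\int[mu]_x f k x <= C)%E) -> (\int[mu]_x g x <= C)%E.
Proof.
move=> mf mg f0 g0 fg fC.
have mL : measurable_fun setT (fun x => limn_einf (f ^~ x)).
  rewrite (_ : (fun x => _) = fun x => (- limn_esup (-%E \o f ^~ x))%E); last first.
    by apply/funext => x; rewrite limn_esupN oppeK.
  apply: measurableT_comp => //; apply: (measurable_fun_limn_esup (f := fun k x => (- f k x)%E)) => // k.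
  exact: measurableT_comp.
rewrite (@ge0_ae_eq_integral _ _ _ mu setT g (fun x => limn_einf (f ^~ x)))//; last 2 first.
- move=> x _; rewrite limn_einf_lim; apply: lime_ge; first exact: is_cvg_einfs.
  by apply: nearW => k; apply: le_ereal_inf_tmp => _ [j _ <-].
- by apply: filterS fg => x /cvg_limn_einf_sup[-> _].
apply: le_trans (fatou mu measurableT mf (fun k x _ => f0 k x)) _.
rewrite limn_einf_lim; apply: lime_le; first exact: is_cvg_einfs.
apply: nearW => k; apply: le_trans (fC k).
by apply: ereal_inf_lbound; exists k => /=.
Qed.

End fatou_bound.

Section semigroup_derivative.
Context {R : realType}.

Lemma cvg_difference_quotient (F : R -> R) (l : R) : is_derive (0 : R) 1 F l ->
  (N.+1%:R * (F N.+1%:R^-1 - F 0)) @[N --> \oo] --> l.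
Proof.
move=> dF; have [/cvg_ex[l' cv] lE] := dF.
have ll' : l' = l by rewrite -lE; apply/esym; exact: cvg_lim cv.
rewrite {}ll' in cv; have /cvgr_dnbhsP := cv.
move=> /(_ (fun N => N.+1%:R^-1)) H.
rewrite (_ : (fun N => _) = fun N : nat =>
    (N.+1%:R^-1)^-1 *: ((F \o shift 0) (N.+1%:R^-1 *: (1 : R)) - F 0)).
  by apply: H; split; [move=> N; rewrite gt_eqF|exact: cvg_harmonic].
by apply/funext => N; rewrite /= /GRing.scale/= invrK addr0 mulr1.
Qed.

(** The derivative at 0 of the semigroup acting on the Gaussian of exponent [c], at a
    point with squared norm [r]. *)
Lemma is_derive_semigroup (c h r : R) :
  is_derive (0 : R) 1
    (fun t => expR (- (h * ln (1 + 4 * c * t)) - c / (1 + 4 * c * t) * r))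
    (4 * c * (c * r - h) * expR (- (c * r))).
Proof.
have D0 : 0 < 1 + 4 * c * 0 :> R by rewrite mulr0 addr0.
have D1 : 1 + 4 * c * 0 != 0 :> R by rewrite gt_eqF.
have dD : is_derive (0 : R) 1 (fun s : R => 1 + 4 * c * s) (4 * c).
  by rewrite (_ : (fun s => _) = cst 1 \+ (4 * c) *: (id : R -> R))//; apply: is_derive_eq;
    rewrite add0r scaler1.
have dln : is_derive (0 : R) 1 (fun s : R => ln (1 + 4 * c * s)) (4 * c).
  have := @is_derive1_comp _ (@ln R) (fun s : R => 1 + 4 * c * s) 0 _ _ (is_derive1_ln D0) dD.
  by rewrite mulr0 addr0 invr1 mul1r.
have dV : is_derive (0 : R) 1 (fun s : R => (1 + 4 * c * s)^-1) (- (4 * c)).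
  have := @is_deriveV _ (fun s : R => 1 + 4 * c * s) 0 _ _ D1 dD.
  by rewrite mulr0 addr0 expr1n invr1 scaleN1r.
have dE : is_derive (0 : R) 1
    (fun t => - (h * ln (1 + 4 * c * t)) - c / (1 + 4 * c * t) * r)
    (4 * c * (c * r - h)).
  rewrite (_ : (fun t => _) = ((- h) *: (fun s : R => ln (1 + 4 * c * s))) \+
     ((- (c * r)) *: (fun s : R => (1 + 4 * c * s)^-1))); last first.
    apply/funext => s.
    transitivity (- h * ln (1 + 4 * c * s) + - (c * r) * (1 + 4 * c * s)^-1) => //.
    by ring.
  have -> : 4 * c * (c * r - h) = - h *: (4 * c) + - (c * r) *: - (4 * c).
    by transitivity (- h * (4 * c) + - (c * r) * - (4 * c)) => //; ring.
  exact: is_deriveD (is_deriveZ (- h) dln) (is_deriveZ (- (c * r)) dV).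
have -> : 4 * c * (c * r - h) * expR (- (c * r)) =
    expR (- (h * ln (1 + 4 * c * 0)) - c / (1 + 4 * c * 0) * r) * (4 * c * (c * r - h)).
  by rewrite mulr0 addr0 ln1 mulr0 oppr0 add0r divr1 [RHS]mulrC.
exact: @is_derive1_comp _ (@expR R) _ 0 _ _ (is_derive_expR _) dE.
Qed.

End semigroup_derivative.

Section transform.
Context d (T : measurableType d) (R : realType).
Variable mu : {sigma_finite_measure set T -> \bar R}.
Variables (K : T -> T -> R) (q : T -> R) (p : R -> T * T -> R) (h : R).
Hypotheses (mK : measurable_fun setT (fun z => K z.1 z.2))
  (K1 : forall l x, `|K l x| <= 1).
Hypotheses (mq : measurable_fun setT q) (q0 : forall x, 0 <= q x).

Definition gauss_q (t : R) x : R := expR (- (t * q x)).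
Local Notation G := gauss_q.

Hypotheses (iG : forall t : R, 0 < t -> mu.-integrable setT (EFin \o G t))
  (p0 : forall (t : R) z, 0 < t -> 0 <= p t z)
  (psym : forall (t : R) x y, p t (x, y) = p t (y, x))
  (mp : forall t : R, measurable_fun setT (p t))
  (p1 : forall (t : R) x, 0 < t -> (\int[mu]_y (p t (x, y))%:E = 1)%E)
  (pK : forall (t : R) x y, 0 < t -> \int[mu]_l (G t l * (K l x * K l y)) = p t (x, y))
  (vq : forall u : T -> R, measurable_fun setT u -> (sqint mu u < +oo)%E ->
    vanish (fun N => quad mu (p (N.+1%:R^-1)) u)).

Hypotheses (h0 : 0 < h) (pG : forall (c t : R) x, 0 < c -> 0 < t ->
  (\int[mu]_y (p t (x, y) * G c y)%:E =
   (expR (- (h * ln (1 + 4 * c * t))) * G (c / (1 + 4 * c * t)) x)%:E)%E).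

Let G_gt0 (t : R) x : 0 < G t x. Proof. exact: expR_gt0. Qed.

Let mG (t : R) : measurable_fun setT (G t).
Proof.
by apply: measurableT_comp => //; apply: measurableT_comp => //; exact: measurable_funM.
Qed.

Let G_le1 (t : R) x : 0 <= t -> G t x <= 1.
Proof. by move=> t0; rewrite -expR0 ler_expR oppr_le0 mulr_ge0. Qed.

Definition ktransform (u : T -> R) l : R := \int[mu]_x (u x * K l x).

Let K_1 (z : T * T) : `|K z.1 z.2| <= 1. Proof. exact: K1. Qed.

Let mKl l : measurable_fun setT (K l).
Proof. exact: (measurableT_comp mK (measurable_pair1 l)). Qed.

Let mKr x : measurable_fun setT (K ^~ x).
Proof. exact: (measurableT_comp mK (measurable_pair2 x)). Qed.

Let int_u_K (u : T -> R) l : mu.-integrable setT (EFin \o u) ->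
  mu.-integrable setT (fun x => (u x * K l x)%:E).
Proof. by move=> iu; exact: (integrable_mul_bounded iu (mKl l) (K1 l)). Qed.

(** The Gaussian factor makes the transform integrable, and is divided out afterwards. *)
Lemma measurable_ktransform (u : T -> R) : mu.-integrable setT (EFin \o u) -> measurable_fun setT (ktransform u).
Proof.
move=> iu.
have mK' : measurable_fun setT (fun z : T * T => K z.2 z.1).
  by apply: (measurableT_comp mK (g := fun z : T * T => (z.2, z.1))); apply: measurable_fun_pair.
have := integrable_fubini_bounded (iG ltr01) iu mK' (fun z => K1 _ _).
move=> /integrableP[/measurable_EFinP mGt _].
rewrite (_ : ktransform u = fun l => expR (q l) * (G 1 l * ktransform u l)).
  by apply: measurable_funM => //; exact: measurableT_comp.
apply/funext => l; rewrite mulrA /G mul1r -expRD subrr expR0 mul1r//.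
Qed.

Lemma ktransform_comb (a b : R) (u v : T -> R) l : mu.-integrable setT (EFin \o u) ->
  mu.-integrable setT (EFin \o v) ->
  ktransform (fun x => a * u x + b * v x) l = a * ktransform u l + b * ktransform v l.
Proof.
move=> iu iv; rewrite /ktransform.
under eq_Rintegral do rewrite mulrDl -!mulrA.
have i1 := int_u_K l iu; have i2 := int_u_K l iv.
rewrite RintegralD//; last 2 first.
- by have := integrableZl measurableT a i1; apply: eq_integrable.
- by have := integrableZl measurableT b i2; apply: eq_integrable.
by rewrite !RintegralZl.
Qed.

Let ktransform_bound (u : T -> R) l : mu.-integrable setT (EFin \o u) ->
  `|ktransform u l| <= \int[mu]_x `|u x|.
Proof.
move=> iu; have iuK := int_u_K l iu.
apply: le_trans (le_normr_Rintegral measurableT iuK) _.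
apply: le_Rintegral => //.
- exact: integrable_norm iuK.
- exact: integrable_norm iu.
- by move=> x _; rewrite normrM ler_piMr.
Qed.

(** Fubini twice: once to exchange [x] and the frequency, once inside. *)
Lemma ktransform_form (u : T -> R) (t : R) : 0 < t -> mu.-integrable setT (EFin \o u) ->
  mu.-integrable setT (fun x => (u x * \int[mu]_y (u y * p t (x, y)))%:E) /\
  (\int[mu]_l (G t l * ktransform u l ^+ 2)%:E =
   \int[mu]_x (u x * \int[mu]_y (u y * p t (x, y)))%:E)%E.
Proof.
move=> t0 iu; have mtr := measurable_ktransform iu.
pose C := (\int[mu]_x `|u x|)%R.
have iv : mu.-integrable setT (EFin \o (fun l => G t l * ktransform u l)).
  have iCG : mu.-integrable setT (fun l => (C%:E * (G t l)%:E)%E).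
    exact: integrableZl (iG t0).
  apply: (le_integrable measurableT _ _ iCG).
    by apply/measurable_EFinP; exact: measurable_funM.
  move=> l _; rewrite -EFinM lee_fin !normrM mulrC ler_wpM2r//.
  by rewrite (le_trans (ktransform_bound l iu))// ler_norm.
have E0 : (fun x => (u x * \int[mu]_l (G t l * ktransform u l * K l x))%:E) =
    (fun x => (u x * \int[mu]_y (u y * p t (x, y)))%:E).
  apply/funext => x; congr (_ * _)%:E.
  have iw : mu.-integrable setT (EFin \o (fun l => G t l * K l x)).
    exact: (integrable_mul_bounded (iG t0) (mKr x) (fun l => K1 l x)).
  have E2 := fubini_bounded iu iw mK K_1.
  rewrite /Rintegral; congr fine.
  transitivity (\int[mu]_l (G t l * K l x * ktransform u l)%:E)%E.
    by apply: eq_integral => l _ /=; rewrite mulrAC.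
  rewrite -E2; apply: eq_integral => y _; congr (_ * _)%:E.
  rewrite -(pK x y t0); apply: eq_Rintegral => l _ /=; by rewrite mulrA.
have I1 := integrable_fubini_bounded iu iv mK K_1.
have E1 := fubini_bounded iu iv mK K_1.
rewrite -E0; split; first exact: I1.
rewrite E1; apply: eq_integral => l _; by rewrite expr2 mulrA.
Qed.

Let mpx (t : R) x : measurable_fun setT (fun y => p t (x, y)).
Proof. exact: (measurableT_comp (mp t) (measurable_pair1 x)). Qed.

(** Schur test: Young's inequality with the weight [phi y / phi x]. *)
Lemma ktransform_schur (u : T -> R) (t : R) (phi Pphi : T -> R) : 0 < t ->
  mu.-integrable setT (EFin \o u) ->
  measurable_fun setT phi -> measurable_fun setT Pphi -> (forall x, 0 < phi x) ->
  (forall x, (\int[mu]_y (p t (x, y) * phi y)%:E = (Pphi x)%:E)%E) ->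
  (\int[mu]_l (G t l * ktransform u l ^+ 2)%:E <=
   \int[mu]_x (u x ^+ 2 * (Pphi x / phi x))%:E)%E.
Proof.
move=> t0 iu mphi mPphi phi0 PphiE.
have /integrableP[/measurable_EFinP mu_ _] := iu.
have mV : measurable_fun setT (fun x => (phi x)^-1).
  rewrite (_ : (fun _ => _) = (fun x => phi x `^ (- 1))); last first.
    by apply/funext => x; rewrite powR_inv1// ltW.
  exact: (measurableT_comp (measurable_powR _)).
pose A z := p t z * (u z.1 ^+ 2 * (phi z.2 / phi z.1)).
pose B z := p t z * (u z.2 ^+ 2 * (phi z.1 / phi z.2)).
have mA : measurable_fun setT A.
  apply: measurable_funM => //; apply: measurable_funM.
    by apply: measurable_funX; exact: measurable_pull1.
  by apply: measurable_funM; [exact: measurable_pull2|exact: (measurable_pull1 mV)].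
have mB : measurable_fun setT B.
  apply: measurable_funM => //; apply: measurable_funM.
    by apply: measurable_funX; exact: measurable_pull2.
  by apply: measurable_funM; [exact: measurable_pull1|exact: (measurable_pull2 mV)].
have A0 z : 0 <= A z by rewrite mulr_ge0 ?p0// mulr_ge0 ?sqr_ge0// divr_ge0// ltW.
have B0 z : 0 <= B z by rewrite mulr_ge0 ?p0// mulr_ge0 ?sqr_ge0// divr_ge0// ltW.
pose Z := (\int[mu]_x (u x ^+ 2 * (Pphi x / phi x))%:E)%E.
have IA : (\int[mu \x mu]_z (A z)%:E = Z)%E.
  rewrite fubini_tonelli1; last 2 first.
  - exact/measurable_EFinP.
  - by move=> z; rewrite lee_fin.
  apply: eq_integral => x _; rewrite /fubini_F /A/=.
  have c0 : 0 <= u x ^+ 2 / phi x by rewrite divr_ge0 ?sqr_ge0// ltW.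
  transitivity (\int[mu]_y ((u x ^+ 2 / phi x)%:E * (p t (x, y) * phi y)%:E))%E.
    by apply: eq_integral => y _; rewrite -EFinM; congr EFin; ring.
  rewrite ge0_integralZl//; last 2 first.
  - by apply/measurable_EFinP; exact: measurable_funM.
  - by move=> y _; rewrite lee_fin mulr_ge0 ?p0// ltW.
  by rewrite PphiE -EFinM; congr EFin; ring.
have IB : (\int[mu \x mu]_z (B z)%:E = Z)%E.
  rewrite fubini_tonelli2; last 2 first.
  - exact/measurable_EFinP.
  - by move=> z; rewrite lee_fin.
  apply: eq_integral => y _; rewrite /fubini_G /B/=.
  have c0 : 0 <= u y ^+ 2 / phi y by rewrite divr_ge0 ?sqr_ge0// ltW.
  transitivity (\int[mu]_x ((u y ^+ 2 / phi y)%:E * (p t (y, x) * phi x)%:E))%E.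
    by apply: eq_integral => x _; rewrite -EFinM psym; congr EFin; ring.
  rewrite ge0_integralZl//; last 2 first.
  - by apply/measurable_EFinP; exact: measurable_funM.
  - by move=> x _; rewrite lee_fin mulr_ge0 ?p0// ltW.
  by rewrite PphiE -EFinM; congr EFin; ring.
have mxy : measurable_fun setT (fun z : T * T => (`|u z.1| * (`|u z.2| * p t z))%:E).
  apply/measurable_EFinP; apply: measurable_funM.
    by apply: measurableT_comp => //; exact: measurable_pull1.
  apply: measurable_funM => //.
  by apply: measurableT_comp => //; exact: measurable_pull2.
have xy0 (z : T * T) : (0 <= (`|u z.1| * (`|u z.2| * p t z))%:E)%E.
  by rewrite lee_fin mulr_ge0// mulr_ge0// p0.
have [iform ->] := ktransform_form t0 iu.
apply: (@le_trans _ _ (\int[mu \x mu]_z (`|u z.1| * (`|u z.2| * p t z))%:E)%E).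
  rewrite fubini_tonelli1//.
  have /integrableP[mform _] := iform.
  apply: le_trans (lee_abs _) _; apply: le_trans (le_abse_integral _ measurableT mform) _.
  apply: ge0_le_integral => //.
  - exact: measurableT_comp.
  - exact: measurable_fun_fubini_tonelli_F.
  move=> x _; rewrite /fubini_F/=.
  rewrite (_ : (\int[mu]_y _)%E = `|u x|%:E * \int[mu]_y `|(u y * p t (x, y))%:E|)%E; last first.
    rewrite -ge0_integralZl//.
      by apply: eq_integral => y _ /=; rewrite -EFinM normrM (ger0_norm (p0 _ t0)).
    by do 2 apply: measurableT_comp => //; apply: measurable_funM.
  rewrite normrM EFinM lee_wpmul2l//.
  apply: le_trans (le_abse_integral _ measurableT _); last first.
    by apply/measurable_EFinP; apply: measurable_funM.
  by rewrite /Rintegral; case: (\int[mu]_y _)%E => [r| |]//=; rewrite ?normr0 ?lee_fin// leey.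
have two : ((2^-1)%:E * Z + (2^-1)%:E * Z = Z)%E.
  rewrite -ge0_muleDl ?lee_fin ?invr_ge0//.
  by rewrite -EFinD (_ : 2^-1 + 2^-1 = 1 :> R) ?mul1e//; lra.
rewrite -/Z -two -{1}IA -IB -!ge0_integralZl//; last first.
all: try exact/measurable_EFinP.
all: try (by move=> z _; rewrite lee_fin).
rewrite -ge0_integralD//.
all: try (by move=> z _; rewrite -EFinM lee_fin mulr_ge0// invr_ge0).
all: try (by apply: measurable_funeM; exact/measurable_EFinP).
apply: ge0_le_integral => //.
- by apply: emeasurable_funD; apply: measurable_funeM; exact/measurable_EFinP.
move=> z _; rewrite -!EFinM -EFinD lee_fin /A /B.
have f1 := phi0 z.1; have f2 := phi0 z.2; have pz := p0 z t0.
have key : 2 * (`|u z.1| * `|u z.2|) <=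
    u z.1 ^+ 2 * (phi z.2 / phi z.1) + u z.2 ^+ 2 * (phi z.1 / phi z.2).
  rewrite -(real_normK (num_real (u z.1))) -(real_normK (num_real (u z.2))).
  have := sqr_ge0 (`|u z.1| * phi z.2 - `|u z.2| * phi z.1).
  rewrite -(@pmulr_rge0 _ (phi z.1 * phi z.2)^-1) ?invr_gt0 ?mulr_gt0//.
  move=> H; rewrite -[leLHS]add0r -lerBrDr; apply: le_trans H _.
  by rewrite le_eqVlt; apply/orP; left; apply/eqP; field; rewrite !gt_eqF.
have := ler_wpM2l pz key; nra.
Qed.

(** The Schur test with weight 1. *)
Lemma ktransform_gauss_le (u : T -> R) (t : R) : 0 < t -> mu.-integrable setT (EFin \o u) ->
  (\int[mu]_l (G t l * ktransform u l ^+ 2)%:E <= sqint mu u)%E.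
Proof.
move=> t0 iu; have P1E x : (\int[mu]_y (p t (x, y) * cst 1 y)%:E = (cst 1 x)%:E :> \bar R)%E.
  by rewrite -[RHS](p1 x t0); apply: eq_integral => y _ /=; rewrite mulr1.
have m1 : measurable_fun setT (cst (1 : R) : T -> R) by exact: measurable_cst.
apply: le_trans (ktransform_schur t0 iu m1 m1 (fun=> ltr01) P1E) _.
by rewrite le_eqVlt; apply/orP; left; apply/eqP; apply: eq_integral => x _ /=;
  rewrite divr1 mulr1.
Qed.

Let invS_gt0 N : 0 < N.+1%:R^-1 :> R. Proof. by rewrite invr_gt0. Qed.

Let G_cvg1 x : G N.+1%:R^-1 x @[N --> \oo] --> (1 : R).
Proof.
rewrite -[X in _ --> X]expR0 /G; apply: continuous_cvg; first exact: continuous_expR.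
rewrite -oppr0; apply: cvgN; rewrite -(mul0r (q x)); apply: cvgMl.
exact: cvg_harmonic.
Qed.

Lemma le_sqint_gauss (v : T -> R) (C : \bar R) : measurable_fun setT v ->
  (forall t : R, 0 < t -> (\int[mu]_l (G t l * v l ^+ 2)%:E <= C)%E) ->
  (sqint mu v <= C)%E.
Proof.
move=> mv vC.
apply: (@ge0_integral_le_lim _ _ _ mu (fun N l => (G N.+1%:R^-1 l * v l ^+ 2)%:E)).
- move=> N; apply/measurable_EFinP; apply: measurable_funM => //.
  exact: measurable_funX.
- exact: measurable_sqr.
- by move=> N l; rewrite lee_fin mulr_ge0 ?sqr_ge0// ltW.
- by move=> l; rewrite lee_fin sqr_ge0.
- apply: nearW => l; apply: cvg_EFin; first exact: nearW.
  by rewrite -[X in _ --> X]mul1r; apply: cvgMl; exact: G_cvg1.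
- by move=> N; exact: vC.
Qed.

Lemma sqint_ktransform_le (u : T -> R) : mu.-integrable setT (EFin \o u) ->
  (sqint mu (ktransform u) <= sqint mu u)%E.
Proof.
move=> iu; apply: le_sqint_gauss; first exact: measurable_ktransform.
by move=> t t0; exact: ktransform_gauss_le.
Qed.

(** [p t] is a transform of an integrable function against a bounded kernel. *)
Let p_bounded (t : R) : 0 < t -> exists C : R, forall z, p t z <= C.
Proof.
move=> t0; exists (\int[mu]_l G t l) => -[x y]; rewrite -(pK x y t0).
apply: le_Rintegral => //; [|exact: iG|].
- have iK := integrable_mul_bounded (iG t0) (mKr x) (fun l => K1 l x).
  have := integrable_mul_bounded iK (mKr y) (fun l => K1 l y).
  by apply: eq_integrable => // l _ /=; rewrite mulrA.
move=> l _; rewrite ler_piMr ?(ltW (G_gt0 _ _))//.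
by rewrite (le_trans (ler_norm _))// normrM mulr_ile1.
Qed.

(** Expanding the square in the quadratic form [quad mu (p t) u] and using that [p t] has
    mass 1 gives [2 \int u^2 <= 2 \int (ktransform u)^2 + quad mu (p t) u]. *)
Lemma sqint_le_ktransform (u : T -> R) : (forall x, 0 <= u x) ->
  mu.-integrable setT (EFin \o u) -> (sqint mu u < +oo)%E ->
  (sqint mu u <= sqint mu (ktransform u))%E.
Proof.
move=> u0 iu uoo; have /integrableP[/measurable_EFinP mu_ _] := iu.
have mtr := measurable_ktransform iu.
have step (t : R) : 0 < t ->
    (sqint mu u + sqint mu u <= 2%:E * sqint mu (ktransform u) + quad mu (p t) u)%E.
  move=> t0; have pt0 (N : nat) z : 0 <= p t z by exact: p0.
  have m2 : measurable_fun setT (fun x => u x ^+ 2) by exact: measurable_funX.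
  have s0 x : 0 <= u x ^+ 2 by exact: sqr_ge0.
  have ps (N : nat) : forall x y, p t (x, y) = p t (y, x) by move=> x y; exact: psym.
  have p1' (N : nat) x : (\int[mu]_y (p t (x, y))%:E = 1)%E by exact: p1.
  have I1 := integral_markov1 pt0 (fun=> mp t) p1' 0%N s0 m2.
  have I2 := integral_markov2 pt0 ps (fun=> mp t) p1' 0%N s0 m2.
  rewrite /sqint -{1}I1 -I2.
  have mu1 := measurable_pull1 mu_; have mu2 := measurable_pull2 mu_.
  have mpu : measurable_fun setT (fun z : T * T => (p t z * (u z.1 * u z.2))%:E).
    by apply/measurable_EFinP; do 2 apply: measurable_funM => //.
  have pu0 (z : T * T) : (0 <= (p t z * (u z.1 * u z.2))%:E)%E.
    by rewrite lee_fin mulr_ge0 ?p0// mulr_ge0.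
  have form : (\int[mu \x mu]_z (p t z * (u z.1 * u z.2))%:E =
      \int[mu]_l (G t l * ktransform u l ^+ 2)%:E)%E.
    have [_ ->] := ktransform_form t0 iu.
    rewrite fubini_tonelli1//; apply: eq_integral => x _; rewrite /fubini_F/=.
    have [C CP] := p_bounded t0.
    have iup : mu.-integrable setT (EFin \o (fun y => u y * p t (x, y))).
      have := integrableZl measurableT C iu; apply: le_integrable => //.
        by apply/measurable_EFinP; exact: measurable_funM.
      move=> y _; rewrite /= lee_fin !normrM mulrC ler_wpM2r//.
      by rewrite ger0_norm ?p0// (le_trans (CP _))// ler_norm.
    rewrite EFinM /Rintegral fineK; last exact: (integrable_fin_num measurableT iup).
    rewrite -ge0_integralZl//.
    - by apply: eq_integral => y _; rewrite -EFinM; congr EFin; ring.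
    - by apply/measurable_EFinP; exact: measurable_funM.
    - by move=> y _; rewrite lee_fin mulr_ge0// p0.
    - by rewrite lee_fin.
  have ps0 (f : T * T -> R) z : (0 <= (p t z * f z ^+ 2)%:E)%E.
    by rewrite lee_fin mulr_ge0 ?sqr_ge0// p0.
  have mps (f : T * T -> R) : measurable_fun setT f ->
      measurable_fun setT (fun z => (p t z * f z ^+ 2)%:E).
    by move=> mf; apply/measurable_EFinP; apply: measurable_funM => //; exact: measurable_funX.
  rewrite -ge0_integralD//; last 4 first.
  - by move=> z _; exact: (ps0 (fun z => u z.1)).
  - exact: (mps (fun z => u z.1)).
  - by move=> z _; exact: (ps0 (fun z => u z.2)).
  - exact: (mps (fun z => u z.2)).
  apply: (@le_trans _ _ (2%:E * \int[mu \x mu]_z (p t z * (u z.1 * u z.2))%:E +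
      quad mu (p t) u)%E).
    rewrite -ge0_integralZl// -ge0_integralD//; last 4 first.
    - by move=> z _; rewrite mule_ge0.
    - exact: measurable_funeM.
    - by move=> z _; rewrite lee_fin mulr_ge0 ?sqr_ge0// p0.
    - exact: measurable_quad.
    rewrite le_eqVlt; apply/orP; left; apply/eqP; apply: eq_integral => z _; rewrite -!EFinM -!EFinD; congr EFin.
    by ring.
  rewrite leeD2r// lee_wpmul2l// form; apply: ge0_le_integral => //.
  - by move=> l _; rewrite lee_fin mulr_ge0 ?sqr_ge0// ltW.
  - by apply/measurable_EFinP; apply: measurable_funM => //; exact: measurable_funX.
  - exact: measurable_sqr.
  by move=> l _; rewrite lee_fin ler_piMl ?sqr_ge0// G_le1// ltW.
have two : (2%:E * sqint mu u = sqint mu u + sqint mu u)%E.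
  rewrite (_ : 2 = 1 + 1)%R; last by lra.
  by rewrite EFinD ge0_muleDl// mul1e.
rewrite -(@lee_pmul2l _ 2%:E)// two; apply/lee_addgt0Pr => e e0.
have [N0 /(_ _ (leqnn N0)) vN] := vq mu_ uoo e0.
by apply: le_trans (step _ (invS_gt0 N0)) _; rewrite leeD2l.
Qed.

Let sqint_parallelogram (a b : T -> R) : measurable_fun setT a -> measurable_fun setT b ->
  (sqint mu (fun x => a x + b x)%R + sqint mu (fun x => a x - b x)%R =
   2%:E * sqint mu a + 2%:E * sqint mu b)%E.
Proof.
move=> ma mb; rewrite /sqint -!ge0_integralZl//; last 4 first.
- exact: measurable_sqr.
- by move=> x _; rewrite lee_fin sqr_ge0.
- exact: measurable_sqr.
- by move=> x _; rewrite lee_fin sqr_ge0.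
have m2 (f : T -> R) : measurable_fun setT f ->
    measurable_fun setT (fun x => 2%:E * (f x ^+ 2)%:E)%E.
  by move=> mf; apply: measurable_funeM; exact: measurable_sqr.
have p2 (f : T -> R) x : (0 <= 2%:E * (f x ^+ 2)%:E)%E by rewrite -EFinM lee_fin mulr_ge0 ?sqr_ge0.
rewrite -!ge0_integralD//.
all: try (by move=> x _; rewrite lee_fin sqr_ge0).
all: try exact: m2.
- by apply: eq_integral => x _; rewrite -!EFinM -!EFinD; congr EFin; ring.
- by apply: measurable_sqr; exact: measurable_funD.
- by apply: measurable_sqr; exact: measurable_funB.
Qed.

(** Plancherel.  The parallelogram law for the positive and negative parts turns
    the inequality for signed functions into an equality, because their sum and
    difference have the same square integral. *)
Lemma sqint_ktransform (u : T -> R) : mu.-integrable setT (EFin \o u) ->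
  (sqint mu u < +oo)%E -> sqint mu (ktransform u) = sqint mu u.
Proof.
move=> iu uoo; apply/eqP; rewrite eq_le sqint_ktransform_le//=.
have /integrableP[/measurable_EFinP mu_ _] := iu.
pose v x := Num.max (u x) 0; pose w x := Num.max (- u x) 0.
have mv : measurable_fun setT v by exact: measurable_maxr.
have mw : measurable_fun setT w by apply: measurable_maxr => //; exact: measurableT_comp.
have vw x : [/\ 0 <= v x, 0 <= w x, `|v x| <= `|u x|, `|w x| <= `|u x| &
    v x - w x = u x /\ v x + w x = `|u x|].
  rewrite /v /w; case: (ger0P (u x)) => ux.
    rewrite max_r ?oppr_le0// normr0 ger0_norm//.
    by split=> //; rewrite subr0 addr0.
  rewrite max_l ?oppr_ge0 ?(ltW ux)// normr0 gtr0_norm ?oppr_gt0//.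
  by split; rewrite ?oppr_ge0 ?(ltW ux)// opprK !add0r.
have iv : mu.-integrable setT (EFin \o v).
  apply: le_integrable iu => //; first exact/measurable_EFinP.
  by move=> x _; have [] := vw x.
have iw : mu.-integrable setT (EFin \o w).
  apply: le_integrable iu => //; first exact/measurable_EFinP.
  by move=> x _; have [] := vw x.
have soo (f : T -> R) : measurable_fun setT f -> (forall x, `|f x| <= `|u x|) ->
    (sqint mu f < +oo)%E.
  move=> mf fu; apply: le_lt_trans uoo; apply: ge0_le_integral => //.
  - by move=> x _; rewrite lee_fin sqr_ge0.
  - exact: measurable_sqr.
  - exact: measurable_sqr.
  by move=> x _; rewrite lee_fin -(real_normK (num_real (f x)))
    -(real_normK (num_real (u x))) lerXn2r ?nnegrE.
have vE : sqint mu (ktransform v) = sqint mu v.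
  apply/eqP; rewrite eq_le sqint_ktransform_le//= sqint_le_ktransform//.
    by move=> x; have [] := vw x.
  by apply: soo => // x; have [] := vw x.
have wE : sqint mu (ktransform w) = sqint mu w.
  apply/eqP; rewrite eq_le sqint_ktransform_le//= sqint_le_ktransform//.
    by move=> x; have [] := vw x.
  by apply: soo => // x; have [] := vw x.
have P1 := sqint_parallelogram mv mw.
have P2 := sqint_parallelogram (measurable_ktransform iv) (measurable_ktransform iw).
have uE : (fun x => v x - w x) = u.
  by apply/funext => x; have [_ _ _ _ [<- _]] := vw x.
have nE : sqint mu (fun x => v x + w x) = sqint mu u.
  apply: eq_integral => x _; have [_ _ _ _ [_ ->]] := vw x.
  by rewrite real_normK ?num_real.
have tE : (fun l => ktransform v l - ktransform w l) = ktransform u.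
  apply/funext => l; rewrite -uE.
  have := ktransform_comb 1 (-1) l iv iw; rewrite mul1r mulN1r => <-.
  by congr ktransform; apply/funext => x; rewrite mul1r mulN1r.
have sE : (fun l => ktransform v l + ktransform w l) = ktransform (fun x => v x + w x).
  apply/funext => l; have := ktransform_comb 1 1 l iv iw; rewrite !mul1r => <-.
  by congr ktransform; apply/funext => x; rewrite !mul1r.
have ivw : mu.-integrable setT (EFin \o (fun x => v x + w x)).
  by have := integrableD measurableT iv iw; apply: eq_integrable.
have le1 := sqint_ktransform_le ivw.
move: P2; rewrite tE sE vE wE -P1 uE nE => P2.
have fin : (sqint mu u \is a fin_num) by rewrite ge0_fin_numE ?sqint_ge0.
rewrite -(leeD2rE _ _ fin) -P2 addeC leeD2l// -nE; exact: le1.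
Qed.

(** The closure of the graph of [ktransform] in mean square: the transform of a square
    integrable function need not be given by an integral. *)
Definition is_ktransform (f g : T -> R) := [/\ measurable_fun setT f, measurable_fun setT g,
  (sqint mu f < +oo)%E, (sqint mu g < +oo)%E &
  forall e : R, 0 < e -> exists u : T -> R, [/\ mu.-integrable setT (EFin \o u),
    (sqint mu u < +oo)%E, (sqint mu (fun x => (u x - f x)%R) <= e%:E)%E &
    (sqint mu (fun x => (ktransform u x - g x)%R) <= e%:E)%E]].

Let sqint1 (f : T -> R) : (\int[mu]_x (cst 1 x * f x ^+ 2)%:E = sqint mu f)%E.
Proof. by apply: eq_integral => x _; rewrite mul1r. Qed.

Let mu_int (u : T -> R) : mu.-integrable setT (EFin \o u) -> measurable_fun setT u.
Proof. by move=> /integrableP[/measurable_EFinP]. Qed.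

Lemma sqint_is_ktransform f g : is_ktransform f g -> sqint mu g = sqint mu f.
Proof.
move=> [mf mg foo goo fg].
have m1 : measurable_fun setT (cst (1 : R) : T -> R) by exact: measurable_cst.
have b1 (x : T) : 0 <= cst (1 : R) x <= 1 by rewrite ler01 lexx.
apply/eqP; rewrite eq_le -(sqint1 f) -(sqint1 g); apply/andP; split.
  apply: (wsqint_le_approx ler01 m1 b1 m1 b1 mg mf foo) => e e0.
  have [u [iu uoo uf ug]] := fg _ e0; exists (ktransform u), u.
  by split => //; [exact: measurable_ktransform|exact: mu_int|rewrite !sqint1 sqint_ktransform].
apply: (wsqint_le_approx ler01 m1 b1 m1 b1 mf mg goo) => e e0.
have [u [iu uoo uf ug]] := fg _ e0; exists u, (ktransform u).
by split => //; [exact: mu_int|exact: measurable_ktransform|rewrite !sqint1 sqint_ktransform].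
Qed.

Let mwsq (w u : T -> R) : measurable_fun setT w -> measurable_fun setT u ->
  measurable_fun setT (fun x => (w x * u x ^+ 2)%:E).
Proof.
by move=> mw mu_; apply/measurable_EFinP; apply: measurable_funM => //; exact: measurable_funX.
Qed.

Let sq0 (u : T -> R) x : setT x -> (0 <= (u x ^+ 2)%:E)%E.
Proof. by rewrite lee_fin sqr_ge0. Qed.

Let wsq0 (w u : T -> R) : (forall x, 0 <= w x) ->
  forall x, setT x -> (0 <= (w x * u x ^+ 2)%:E)%E.
Proof. by move=> w0 x _; rewrite lee_fin; apply: mulr_ge0 => //; exact: sqr_ge0. Qed.

Let cmul0 (c : R) (e : T -> \bar R) : 0 <= c -> (forall x, setT x -> (0 <= e x)%E) ->
  forall x, setT x -> (0 <= c%:E * e x)%E.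
Proof. by move=> c0 e0 x Tx; apply: mule_ge0; rewrite ?lee_fin// e0. Qed.

Let G_ge0 (t : R) x : 0 <= G t x. Proof. exact: expR_ge0. Qed.

Let q_ge0 (c : R) x : 0 <= c -> 0 <= c * q x.
Proof. by move=> c0; exact: mulr_ge0. Qed.

Section heisenberg.
Variables (c delta : R) (f g : T -> R).
Hypotheses (c0 : 0 < c) (d0 : 0 < delta) (fg : is_ktransform f g).

(** [F t] is [P_t] applied to the Gaussian of exponent [c].  The constant [delta] keeps
    [phi] away from 0, which bounds [rho t] and its difference quotients. *)
Let F (t : R) x := expR (- (h * ln (1 + 4 * c * t))) * G (c / (1 + 4 * c * t)) x.
Let phi x := G c x + delta.
Let rho (t : R) x := (F t x + delta) / phi x.

Let phi0 x : 0 < phi x. Proof. by rewrite addr_gt0. Qed.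
Let mphi : measurable_fun setT phi. Proof. exact: measurable_funD. Qed.
Let mF t : measurable_fun setT (F t). Proof. exact: measurable_funM. Qed.

Let mVphi : measurable_fun setT (fun x => (phi x)^-1).
Proof.
rewrite (_ : (fun _ => _) = (fun x => phi x `^ (- 1))); last first.
  by apply/funext => x; rewrite powR_inv1// ltW.
exact: (measurableT_comp (measurable_powR _)).
Qed.

Let mrho t : measurable_fun setT (rho t).
Proof. by apply: measurable_funM => //; exact: measurable_funD. Qed.

Let den1 (t : R) : 0 < t -> 1 < 1 + 4 * c * t.
Proof. by move=> t0; rewrite ltrDl mulr_gt0// mulr_gt0. Qed.

Let F0 t x : 0 <= F t x. Proof. by rewrite mulr_ge0// ?expR_ge0. Qed.

Let exp_h_le1 (t : R) : 0 < t -> expR (- (h * ln (1 + 4 * c * t))) <= 1.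
Proof.
move=> t0; rewrite -[leRHS]expR0 ler_expR oppr_le0 mulr_ge0 ?(ltW h0)// ln_ge0//.
exact: ltW (den1 t0).
Qed.

(** With [y = c q / (1 + 4 c t)], the increment is at most [y exp (- y) (4 c t)], and
    [y exp (- y) <= 1]. *)
Let F_le (t : R) x : 0 < t -> F t x <= G c x + 4 * c * t.
Proof.
move=> t0; have D1 := den1 t0; set D := 1 + 4 * c * t in D1 *.
have D0 : 0 < D by lra.
apply: (@le_trans _ _ (G (c / D) x)).
  by rewrite ler_piMl ?expR_ge0// exp_h_le1.
pose y := c / D * q x.
have y0 : 0 <= y by rewrite mulr_ge0// divr_ge0// ltW.
have -> : G c x = expR (- y) * expR (- (y * (4 * c * t))).
  rewrite -expRD /G /y /D; congr expR; field.
  by rewrite gt_eqF.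
rewrite -/y /G -/y.
have e1 := expR_ge1Dx (- (y * (4 * c * t))).
have e2 := expR_ge1Dx y.
have e3 : expR (- y) * expR y = 1 by rewrite -expRD addNr expR0.
have e4 := expR_ge0 (- y).
have e5 : expR (- y) * y <= 1.
  by rewrite -e3 ler_wpM2l//; lra.
have s0 : 0 <= 4 * c * t by rewrite mulr_ge0 ?mulr_ge0 ?ltW.
have := ler_wpM2l e4 e1; have := ler_wpM2r s0 e5; nra.
Qed.

Let rho_ge0 t x : 0 <= rho t x.
Proof. by apply: divr_ge0; [rewrite addr_ge0// ltW|exact: ltW]. Qed.

Let B := 4 * c / delta.
Let B0 : 0 <= B. Proof. by apply: divr_ge0; [rewrite mulr_ge0// ltW|exact: ltW]. Qed.

Let rho_le (t : R) x : 0 < t -> rho t x <= 1 + t * B.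
Proof.
move=> t0; rewrite ler_pdivrMr// mulrDl mul1r.
have := F_le x t0; rewrite /phi /B => Fx.
have := G_gt0 c x => G0.
rewrite (_ : t * (4 * c / delta) * (G c x + delta) = 4 * c * t / delta * G c x + 4 * c * t);
  last by field; rewrite gt_eqF.
have d1 : 0 < delta^-1 by rewrite invr_gt0.
have := mulr_gt0 (mulr_gt0 (mulr_gt0 c0 t0) d1) G0; lra.
Qed.

(** The Schur test for [phi], extended to square integrable functions. *)
Let heat_le (t : R) : 0 < t ->
  (\int[mu]_l (G t l * g l ^+ 2)%:E <= \int[mu]_x (rho t x * f x ^+ 2)%:E)%E.
Proof.
move=> t0; have [mf mg foo goo app] := fg.
have tB : 0 <= t * B by rewrite mulr_ge0// ltW.
apply: (@wsqint_le_approx _ _ _ _ (G t) (rho t) g f (1 + t * B)) => //.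
- by rewrite addr_ge0.
- move=> l; rewrite (ltW (G_gt0 _ _)) (le_trans (G_le1 l (ltW t0)))//.
  by rewrite lerDl.
- by move=> x; rewrite rho_ge0 rho_le.
move=> e e0; have [u [iu uoo uf ug]] := app _ e0; exists (ktransform u), u.
split => //; [exact: measurable_ktransform|exact: mu_int|].
have PE x : (\int[mu]_y (p t (x, y) * phi y)%:E = (F t x + delta)%:E)%E.
  transitivity (\int[mu]_y ((p t (x, y) * G c y)%:E + delta%:E * (p t (x, y))%:E))%E.
    by apply: eq_integral => y _; rewrite -EFinM -EFinD; congr EFin; rewrite /phi; ring.
  rewrite ge0_integralD//; last 4 first.
  - by move=> y _; rewrite lee_fin mulr_ge0 ?p0// ltW.
  - by apply/measurable_EFinP; exact: measurable_funM.
  - by move=> y _; rewrite -EFinM lee_fin mulr_ge0 ?p0// ltW.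
  - by apply: measurable_funeM; exact/measurable_EFinP.
  rewrite ge0_integralZl//; last 3 first.
  - exact/measurable_EFinP.
  - by move=> y _; rewrite lee_fin p0.
  - by rewrite lee_fin ltW.
  by rewrite pG// p1// mule1.
have mFd : measurable_fun setT (fun x => F t x + delta) by exact: measurable_funD.
apply: le_trans (ktransform_schur t0 iu mphi mFd phi0 PE) _.
by rewrite le_eqVlt; apply/orP; left; apply/eqP; apply: eq_integral => x _; rewrite mulrC.
Qed.

Let theta x := G c x / phi x.

Let F_deriv x : (N.+1%:R * (F N.+1%:R^-1 x - G c x)) @[N --> \oo] -->
  (4 * c * (c * q x - h) * G c x : R).
Proof.
have FE (t : R) : F t x = expR (- (h * ln (1 + 4 * c * t)) - c / (1 + 4 * c * t) * q x).
  by rewrite /F /G -expRD.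
have F00 : F 0 x = G c x.
  by rewrite FE mulr0 addr0 ln1 mulr0 oppr0 add0r divr1.
have := cvg_difference_quotient (is_derive_semigroup c h (q x)).
by under eq_fun do rewrite -!FE F00.
Qed.

Let rho_cvg x : ((1 - rho N.+1%:R^-1 x) / N.+1%:R^-1 + B) @[N --> \oo] -->
  4 * c * (h - c * q x) * theta x + B.
Proof.
apply: cvgD; last exact: cvg_cst.
have -> : 4 * c * (h - c * q x) * theta x = - (phi x)^-1 * (4 * c * (c * q x - h) * G c x).
  by rewrite /theta; ring.
rewrite (_ : (fun N => _) = fun N => - (phi x)^-1 * (N.+1%:R * (F N.+1%:R^-1 x - G c x))).
  by apply: cvgM; [exact: cvg_cst|exact: F_deriv].
apply/funext => N; rewrite invrK /rho.
have -> : F N.+1%:R^-1 x = F N.+1%:R^-1 x + delta - delta by rewrite addrK.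
have -> : G c x = phi x - delta by rewrite /phi addrK.
by field; rewrite gt_eqF.
Qed.

(** As [\int f^2 = \int g^2] and [1 - exp (- t q) <= t q], the inequality [heat_le] bounds
    the difference quotient of [rho] at 0; adding [B] makes the integrand nonnegative,
    as Fatou's lemma requires. *)
Let rho_small (t : R) : 0 < t ->
  (\int[mu]_x (((1 - rho t x) / t + B) * f x ^+ 2)%:E <=
   \int[mu]_x (q x * g x ^+ 2)%:E + B%:E * sqint mu f)%E.
Proof.
move=> t0; have [mf mg foo goo _] := fg.
have tB : 0 <= t * B by rewrite mulr_ge0// ltW.
have f20 x : 0 <= f x ^+ 2 by exact: sqr_ge0.
have rfin : (\int[mu]_x (rho t x * f x ^+ 2)%:E)%E \is a fin_num.
  rewrite ge0_fin_numE; last by apply: integral_ge0 => x _; rewrite lee_fin mulr_ge0.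
  apply: (@le_lt_trans _ _ ((1 + t * B)%:E * sqint mu f)%E).
    rewrite -ge0_integralZl//; [|exact: measurable_sqr|by move=> x _; rewrite lee_fin|
      by rewrite lee_fin addr_ge0].
    apply: ge0_le_integral => //.
    - by move=> x _; rewrite lee_fin mulr_ge0.
    - exact: mwsq.
    - by apply: measurable_funeM; exact: measurable_sqr.
    by move=> x _; rewrite -EFinM lee_fin ler_wpM2r// rho_le.
  by rewrite lte_mul_pinfty// lee_fin addr_ge0.
pose k x := (1 - rho t x) / t + B.
have k0 x : 0 <= k x.
  rewrite -(pmulr_rge0 _ t0) mulrDr mulrCA divff ?gt_eqF// mulr1.
  by have := rho_le x t0; lra.
have mk : measurable_fun setT k.
  by apply: measurable_funD => //; apply: measurable_funM => //; exact: measurable_funB.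
rewrite -(@lee_pmul2l _ t%:E) ?lte_fin// -(leeD2rE _ _ rfin).
apply: (@le_trans _ _ (sqint mu f + (t * B)%:E * sqint mu f)%E).
  rewrite le_eqVlt; apply/orP; left; apply/eqP.
  rewrite /sqint -!ge0_integralZl//.
  all: try exact: measurable_sqr.
  all: try exact: mwsq.
  all: try exact: sq0.
  all: try exact: wsq0.
  all: try (by rewrite lee_fin ltW).
  rewrite -!ge0_integralD//.
  all: try exact: measurable_sqr.
  all: try (by apply: measurable_funeM; (exact: mwsq || exact: measurable_sqr)).
  all: try exact: mwsq.
  all: try exact: sq0.
  all: try (apply: cmul0; [(exact: tB || exact: ltW)|(exact: sq0 || exact: wsq0)]).
  all: try exact: wsq0.
  apply: eq_integral => x _; rewrite -!EFinM -!EFinD; congr EFin.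
  by rewrite /k; field; rewrite gt_eqF.
have qg0 : (0 <= \int[mu]_x (q x * g x ^+ 2)%:E)%E by apply: integral_ge0; exact: wsq0.
have Bf0 : (0 <= B%:E * sqint mu f)%E by apply: mule_ge0; rewrite ?lee_fin// sqint_ge0.
rewrite (ge0_muleDr t%:E qg0 Bf0) (muleA t%:E B%:E) -EFinM [leRHS]addeAC.
apply: leeD => //; rewrite -(sqint_is_ktransform fg).
apply: (@le_trans _ _ (\int[mu]_l (G t l * g l ^+ 2)%:E +
    t%:E * \int[mu]_x (q x * g x ^+ 2)%:E)%E); last first.
  by rewrite addeC leeD2l// heat_le.
have g20 x : 0 <= g x ^+ 2 by exact: sqr_ge0.
rewrite /sqint -!ge0_integralZl//.
all: try exact: mwsq.
all: try exact: wsq0.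
all: try (by rewrite lee_fin ltW).
rewrite -ge0_integralD//.
all: try exact: mwsq.
all: try (by apply: measurable_funeM; exact: mwsq).
all: try (apply: cmul0; [exact: ltW|exact: wsq0]).
all: try exact: wsq0.
apply: ge0_le_integral => //.
- exact: sq0.
- exact: measurable_sqr.
- by apply: emeasurable_funD; [|apply: measurable_funeM]; exact: mwsq.
move=> x _; rewrite -!EFinM -EFinD lee_fin (mulrA t (q x)) -mulrDl ler_peMl//.
by have := expR_ge1Dx (- (t * q x)); rewrite /G; lra.
Qed.

Let rho_quot_ge0 (t : R) x : 0 < t -> 0 <= (1 - rho t x) / t + B.
Proof.
move=> t0; rewrite -(pmulr_rge0 _ t0) mulrDr mulrCA divff ?gt_eqF// mulr1.
by have := rho_le x t0; lra.
Qed.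

Let theta0 x : 0 <= theta x. Proof. by apply: divr_ge0; exact: ltW. Qed.

Let theta1 x : theta x <= 1.
Proof. by rewrite ler_pdivrMr// mul1r lerDl ltW. Qed.

Let mtheta : measurable_fun setT theta. Proof. exact: measurable_funM. Qed.

(** The limit of [rho_small] as [t] tends to 0. *)
Lemma heisenberg_cutoff :
  (\int[mu]_x (4 * c * h * (G c x / (G c x + delta)) * f x ^+ 2)%:E <=
   \int[mu]_x (q x * g x ^+ 2)%:E + \int[mu]_x (4 * c ^+ 2 * q x * f x ^+ 2)%:E)%E.
Proof.
have [mf mg foo goo _] := fg.
have ch0 : 0 <= 4 * c * h by apply: mulr_ge0; [rewrite mulr_ge0// ltW|exact: ltW].
have c20 : 0 <= 4 * c ^+ 2 by rewrite mulr_ge0// sqr_ge0.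
pose L x := 4 * c * (h - c * q x) * theta x + B.
have mL : measurable_fun setT L.
  apply: measurable_funD => //; apply: measurable_funM => //; apply: measurable_funM => //.
  by apply: measurable_funB => //; exact: measurable_funM.
have L0 x : 0 <= L x.
  have cv := @rho_cvg x; rewrite /L -(cvg_lim _ cv)//.
  apply: limr_ge; first exact: cvgP cv.
  by apply: nearW => N; exact: rho_quot_ge0.
have f20 x : 0 <= f x ^+ 2 by exact: sqr_ge0.
have IL : (\int[mu]_x (L x * f x ^+ 2)%:E <=
    \int[mu]_x (q x * g x ^+ 2)%:E + B%:E * sqint mu f)%E.
  apply: (@ge0_integral_le_lim _ _ _ mu
    (fun N x => (((1 - rho N.+1%:R^-1 x) / N.+1%:R^-1 + B) * f x ^+ 2)%:E)).
  - move=> N; apply: mwsq => //; apply: measurable_funD => //; apply: measurable_funM => //.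
    exact: measurable_funB.
  - exact: mwsq.
  - by move=> N x; rewrite lee_fin mulr_ge0// rho_quot_ge0.
  - by move=> x; rewrite lee_fin mulr_ge0.
  - apply: nearW => x; apply: cvg_EFin; first exact: nearW.
    by apply: cvgM; [exact: rho_cvg|exact: cvg_cst].
  - by move=> N; exact: rho_small.
have Bfin : (B%:E * sqint mu f)%E \is a fin_num.
  by rewrite fin_numM// ge0_fin_numE// sqint_ge0.
rewrite -(leeD2rE _ _ Bfin).
apply: (@le_trans _ _ (\int[mu]_x (L x * f x ^+ 2)%:E +
    \int[mu]_x (4 * c ^+ 2 * q x * f x ^+ 2)%:E)%E); last first.
  by rewrite [leRHS]addeAC; apply: leeD.
have mq4 : measurable_fun setT (fun x => 4 * c ^+ 2 * q x) by exact: measurable_funM.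
have mt4 : measurable_fun setT (fun x => 4 * c * h * theta x) by exact: measurable_funM.
have W0 : forall x, setT x -> (0 <= (4 * c * h * (G c x / (G c x + delta)) * f x ^+ 2)%:E)%E.
  by apply: (wsq0 (w := fun x => 4 * c * h * theta x)) => x; exact: mulr_ge0.
rewrite /sqint -ge0_integralZl//; last 2 first.
- exact: measurable_sqr.
- by move=> x _; rewrite lee_fin.
rewrite -!ge0_integralD//.
all: try exact: W0.
all: try exact: mwsq.
all: try (by apply: measurable_funeM; exact: measurable_sqr).
all: try (apply: cmul0 => //; exact: sq0).
all: try (apply: wsq0 => x; exact: q_ge0).
all: try (apply: wsq0 => x; exact: mulr_ge0).
all: try exact: wsq0.
apply: ge0_le_integral => //.
- move=> x Tx; apply: adde_ge0; first exact: W0.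
  by apply: (cmul0 (e := fun y => (f y ^+ 2)%:E)) => //; exact: sq0.
- by apply: emeasurable_funD; [exact: mwsq|apply: measurable_funeM; exact: measurable_sqr].
- by apply: emeasurable_funD; exact: mwsq.
move=> x _; rewrite -EFinM -!EFinD lee_fin -!mulrDl ler_wpM2r// /L -/(theta x).
have : 4 * c ^+ 2 * q x * theta x <= 4 * c ^+ 2 * q x.
  by apply: ler_piMr => //; exact: q_ge0.
lra.
Qed.

End heisenberg.

(** The additive uncertainty inequality, as [G c / (G c + delta)] tends to 1 when
    [delta] tends to 0. *)
Lemma heisenberg (c : R) (f g : T -> R) : 0 < c -> is_ktransform f g ->
  ((4 * c * h)%:E * sqint mu f <=
   \int[mu]_x (q x * g x ^+ 2)%:E + (4 * c ^+ 2)%:E * \int[mu]_x (q x * f x ^+ 2)%:E)%E.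
Proof.
move=> c0 fg; have [mf mg foo goo _] := fg.
have f20 x : 0 <= f x ^+ 2 by exact: sqr_ge0.
have ch0 : 0 <= 4 * c * h by apply: mulr_ge0; [rewrite mulr_ge0// ltW|exact: ltW].
have c20 : 0 <= 4 * c ^+ 2 by rewrite mulr_ge0// sqr_ge0.
have mqf : measurable_fun setT (fun x => (q x * f x ^+ 2)%:E).
  by apply/measurable_EFinP; apply: measurable_funM => //; exact: measurable_funX.
rewrite /sqint -!ge0_integralZl//.
- apply: (@ge0_integral_le_lim _ _ _ mu
    (fun N x => (4 * c * h * (G c x / (G c x + N.+1%:R^-1)) * f x ^+ 2)%:E)).
  + move=> N; apply/measurable_EFinP; apply: measurable_funM; last exact: measurable_funX.
    apply: measurable_funM => //; apply: measurable_funM => //.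
    rewrite (_ : (fun _ => _) = (fun x => (G c x + N.+1%:R^-1) `^ (- 1))).
      by apply: (measurableT_comp (measurable_powR _)); exact: measurable_funD.
    by apply/funext => x; rewrite powR_inv1// addr_ge0// ltW.
  + by apply: measurable_funeM; exact: measurable_sqr.
  + move=> N x; rewrite lee_fin mulr_ge0// mulr_ge0// divr_ge0 ?(ltW (G_gt0 _ _))//.
    by rewrite addr_ge0// ltW.
  + by move=> x; rewrite mule_ge0// lee_fin.
  + apply: nearW => x; rewrite -EFinM; apply: cvg_EFin; first exact: nearW.
    apply: cvgMl; rewrite -[X in _ --> X]mulr1; apply: cvgMr.
    rewrite -[X in _ --> X](@divff _ (G c x)) ?gt_eqF//; apply: cvgMr.
    apply: cvgV; first by rewrite gt_eqF.
    rewrite -[X in _ --> X]addr0; apply: cvgD; [exact: cvg_cst|exact: cvg_harmonic].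
  + move=> N; apply: le_trans (heisenberg_cutoff c0 (invS_gt0 N) fg) _.
    rewrite leeD2l//; rewrite le_eqVlt; apply/orP; left; apply/eqP.
    by apply: eq_integral => x _; rewrite -EFinM (mulrA _ (q x)).
- exact: wsq0.
- exact: measurable_sqr.
- exact: sq0.
Qed.

(** Cutting [f] off where it exceeds a multiple of a Gaussian makes it integrable. *)
Let truncation (f : T -> R) (e : R) : 0 < e -> measurable_fun setT f ->
  (sqint mu f < +oo)%E -> exists u : T -> R,
    [/\ mu.-integrable setT (EFin \o u), (sqint mu u < +oo)%E &
        (sqint mu (fun x => (u x - f x)%R) <= e%:E)%E].
Proof.
move=> e0 mf foo.
pose A k := [set x | `|f x| <= k%:R * G 1 x].
have mA k : measurable (A k).
  rewrite -[X in measurable X]setTI; apply: measurable_fun_le => //.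
    exact: measurableT_comp.
  exact: measurable_funM.
pose u k x := f x * \1_(A k) x.
have mu_ k : measurable_fun setT (u k) by apply: measurable_funM => //; exact: measurable_indic.
have ind01 k x : (0 : R) <= \1_(A k) x <= (1 : R) by rewrite indicE lern1 leq_b1 ler0n.
have uf k x : `|u k x| <= `|f x|.
  rewrite normrM ler_piMr//; have /andP[i0 i1] := ind01 k x.
  by rewrite ger0_norm.
have ufd k x : `|u k x - f x| <= `|f x|.
  rewrite (_ : _ - _ = - (f x * (1 - \1_(A k) x))); last by rewrite /u; ring.
  have /andP[i0 i1] := ind01 k x.
  by rewrite normrN normrM ler_piMr// ger0_norm ?subr_ge0// gerBl.
have cv : sqint mu (fun x => (u k x - f x)%R) @[k --> \oo] --> 0%E.
  apply: (@cvg_sqint0 _ _ _ mu (fun k x => u k x - f x) (fun x => `|f x|)).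
  - by move=> k; exact: measurable_funB.
  - exact: measurableT_comp.
  - apply: nearW => x; apply/cvgrPdist_le => e1 e10; near=> k.
    rewrite (_ : u k x = f x) ?subrr ?subr0 ?normr0 ?ltW//.
    rewrite /u indicE mem_set ?mulr1//= /A/=.
    rewrite -ler_pdivrMr//; near: k.
    by exists (Num.truncn (`|f x| / G 1 x)).+1 => // k /= kn; apply/ltW;
      rewrite (lt_le_trans (Num.Theory.truncnS_gt _))// ler_nat.
  - by move=> k x; exact: ufd.
  - by rewrite (_ : sqint mu _ = sqint mu f)//; apply: eq_integral => x _;
      rewrite real_normK ?num_real.
have [k /(_ _ (leqnn k)) kP] := cvg_vanish cv e0.
exists (u k); split => //.
  have := integrableZl measurableT k%:R (iG ltr01); apply: le_integrable => //.
    exact/measurable_EFinP.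
  move=> x _; rewrite /= lee_fin /u indicE.
  have [/[!inE] Ax|_] := boolP (x \in A k); last by rewrite mulr0 normr0.
  by rewrite mulr1 (le_trans Ax)// ler_norm.
apply: le_lt_trans foo; apply: ge0_le_integral => //.
- exact: sq0.
- exact: measurable_sqr.
- exact: measurable_sqr.
move=> x _; rewrite lee_fin -(real_normK (num_real (f x))) -(real_normK (num_real (u k x))).
by rewrite lerXn2r ?nnegrE.
Unshelve. all: end_near.
Qed.

(** Riesz-Fischer: by Plancherel the transforms of truncations of [f] that converge
    geometrically fast form a geometrically Cauchy sequence. *)
Lemma ex_is_ktransform (f : T -> R) : measurable_fun setT f -> (sqint mu f < +oo)%E ->
  exists g, is_ktransform f g.
Proof.
move=> mf foo.
have e0 j : 0 < (4^-1 : R) ^+ j by rewrite exprn_gt0.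
pose u j : T -> R := sval (cid (truncation (e0 j) mf foo)).
have uP j : [/\ mu.-integrable setT (EFin \o u j), (sqint mu (u j) < +oo)%E &
    (sqint mu (fun x => (u j x - f x)%R) <= (4^-1 ^+ j)%:E)%E].
  exact: (svalP (cid (truncation (e0 j) mf foo))).
have iu j : mu.-integrable setT (EFin \o u j) by have [] := uP j.
have uf j : (sqint mu (fun x => (u j x - f x)%R) <= (4^-1 ^+ j)%:E)%E by have [] := uP j.
have mu_ j : measurable_fun setT (u j) by exact: mu_int.
pose v j := ktransform (u j).
have mv j : measurable_fun setT (v j) by exact: measurable_ktransform.
have diff i j : (sqint mu (fun x => (v i x - v j x)%R) <=
    (2 * 4^-1 ^+ i + 2 * 4^-1 ^+ j)%:E)%E.
  have -> : (fun x => v i x - v j x) = ktransform (fun x => 1 * u i x + (-1) * u j x).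
    by apply/funext => x; rewrite ktransform_comb// mul1r mulN1r.
  have iuu : mu.-integrable setT (EFin \o (fun x => 1 * u i x + (-1) * u j x)).
    have := integrableB measurableT (iu i) (iu j).
    by apply: eq_integrable => // x _ /=; rewrite mul1r mulN1r.
  apply: le_trans (sqint_ktransform_le iuu) _.
  have mB (a b : T -> R) : measurable_fun setT a -> measurable_fun setT b ->
    measurable_fun setT (fun x => a x - b x) by exact: measurable_funB.
  have := @sqint_le2 _ _ _ mu (fun x => u i x - u j x) (fun x => u i x - f x).
  move=> /(_ (mB _ _ (mu_ i) (mu_ j)) (mB _ _ (mu_ i) mf)) H.
  have -> : (fun x => 1 * u i x + (-1) * u j x) = (fun x => u i x - u j x).
    by apply/funext => x; rewrite mul1r mulN1r.
  have -> : (2 * 4^-1 ^+ i + 2 * 4^-1 ^+ j)%:E =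
      (2%:E * (4^-1 ^+ i)%:E + 2%:E * (4^-1 ^+ j)%:E)%E by [].
  apply: le_trans H _; apply: leeD; apply: lee_wpmul2l => //.
  rewrite (_ : (fun x => _) = (fun x => u j x - f x))//.
  by apply/funext => x; ring.
have C0 : 0 <= 4 :> R by [].
have [j|g [mg vg]] := @ae_cvg_geometric _ _ _ mu v 4 C0 mv.
  apply: le_trans (diff _ _) _; rewrite lee_fin exprS.
  by have := e0 j; lra.
have vgj j : (sqint mu (fun x => (v j x - g x)%R) <= (4 * 4^-1 ^+ j)%:E)%E.
  apply: (@ge0_integral_le_lim _ _ _ mu (fun k x => ((v j x - v (j + k)%N x) ^+ 2)%:E)).
  - by move=> k; apply: measurable_sqr; exact: measurable_funB.
  - by apply: measurable_sqr; exact: measurable_funB.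
  - by move=> k x; rewrite lee_fin sqr_ge0.
  - by move=> x; rewrite lee_fin sqr_ge0.
  - apply: filterS vg => x vgx; apply: cvg_EFin; first exact: nearW.
    have : (v j x - v (j + k)%N x) @[k --> \oo] --> v j x - g x.
      apply: cvgB; first exact: cvg_cst.
      rewrite (_ : (fun k => _) = (fun k => v (k + j)%N x)); last first.
        by apply/funext => k; rewrite addnC.
      by rewrite (cvg_shiftn j (v ^~ x)).
    by move=> cvx; apply: cvgM.
  - move=> k; apply: le_trans (diff _ _) _; rewrite lee_fin.
    have : (4^-1 : R) ^+ (j + k) <= 4^-1 ^+ j.
      by rewrite exprD ler_piMr ?(ltW (e0 j))// exprn_ile1//; lra.
    have := e0 j; lra.
have goo : (sqint mu g < +oo)%E.
  apply: le_lt_trans (sqint_le2 mu mg (mv 0%N)) _.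
  apply: lte_add_pinfty; rewrite lte_mul_pinfty//.
    by rewrite (le_lt_trans (sqint_ktransform_le (iu 0%N)))//; have [] := uP 0%N.
  by rewrite (le_lt_trans (vgj 0%N))// ltry.
exists g; split => // e e0'.
have : (4 * 4^-1 ^+ j : R) @[j --> \oo] --> (4 * 0 : R).
  by apply: cvgMr; apply: cvg_expr; rewrite ger0_norm ?invr_ge0//; lra.
rewrite mulr0 => /cvgrPdist_le /(_ _ e0')[j _ /(_ _ (leqnn j))].
rewrite /= sub0r normrN ger0_norm; last by rewrite mulr_ge0// ltW.
move=> je; exists (u j); split => //; first by have [] := uP j.
  apply: le_trans (uf j) _; rewrite lee_fin; apply: le_trans je.
  by have := e0 j; lra.
by apply: le_trans (vgj j) _; rewrite lee_fin.
Qed.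

End transform.

(** * The heat semigroup of the Bessel transform *)

Section bessel.
Context (R : realType) (n : nat) (a : n.-tuple R).
Hypothesis a0 : forall i, - 2^-1 < tnth a i.
Hypothesis n0 : (0 < n)%N.
Local Notation mu := (bessel_measure a).
Local Notation TT := (n.-tuple R).

Definition normsq (x : TT) : R := \sum_(i < n) tnth x i ^+ 2.

Definition heat (t : R) (z : TT * TT) : R := heatN a (fun=> t) z.1 z.2.

(** Half the homogeneous dimension of the Bessel measure. *)
Definition half_dim : R := \sum_(i < n) (tnth a i + 1).

Let c0 i : 0 < tnth a i + 1. Proof. by have := a0 i => ?; lra. Qed.

Let e0 : 'I_n := Ordinal n0.

Lemma half_dim_gt0 : 0 < half_dim.
Proof.
rewrite /half_dim (bigD1 e0)//=; apply: ltr_pwDl => //.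
by apply: sumr_ge0 => i _; exact: ltW.
Qed.

Lemma normsq_ge0 x : 0 <= normsq x.
Proof. by apply: sumr_ge0 => i _; exact: sqr_ge0. Qed.

Lemma measurable_normsq : measurable_fun setT normsq.
Proof.
apply: measurable_sum => i; apply: measurable_funX.
exact: (@measurable_tnth _ R n i).
Qed.

#[local] Hint Resolve normsq_ge0 measurable_normsq half_dim_gt0 : core.

Let gaussE t x : gauss_q normsq t x = gaussN (fun=> t) x.
Proof.
rewrite /gauss_q /gaussN /tprod -expR_sum /normsq mulr_sumr.
by congr expR; rewrite sumrN.
Qed.

Let integrable_gauss t : 0 < t -> mu.-integrable setT (EFin \o gauss_q normsq t).
Proof.
move=> t0; rewrite (_ : gauss_q normsq t = gaussN (fun=> t)); last exact/funext/gaussE.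
by have [] := integral_gaussN a0 (fun i : 'I_n => t0).
Qed.

Let heat_ge0 t z : 0 < t -> 0 <= heat t z.
Proof. by move=> t0; exact: heatN_ge0. Qed.

Let heat_sym t x y : heat t (x, y) = heat t (y, x).
Proof. exact: heatNC. Qed.

Let measurable_heat t : measurable_fun setT (heat t).
Proof. exact: measurable_heatN. Qed.

Let heat_kernel t x y : 0 < t ->
  \int[mu]_l (gauss_q normsq t l * (bessel_kernel a l x * bessel_kernel a l y)) =
  heat t (x, y).
Proof.
move=> t0; have [_ W] := weberN a0 x y (fun i : 'I_n => t0).
by rewrite /Rintegral; under eq_integral do rewrite gaussE; rewrite W.
Qed.

Let prod_powR (u : R) : 0 < u ->
  \prod_(i < n) u `^ (- (tnth a i + 1)) = expR (- (half_dim * ln u)).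
Proof.
move=> u0; rewrite /half_dim mulr_suml -sumrN expR_sum; apply: eq_bigr => i _.
by rewrite /powR gt_eqF// mulNr.
Qed.

Let heat_gauss c t x : 0 < c -> 0 < t ->
  (\int[mu]_y (heat t (x, y) * gauss_q normsq c y)%:E =
   (expR (- (half_dim * ln (1 + 4 * c * t))) *
     gauss_q normsq (c / (1 + 4 * c * t)) x)%:E)%E.
Proof.
move=> c_0 t0; under eq_integral do rewrite gaussE.
rewrite (integral_heatN_gaussN a0 x (fun=> t0) (fun=> c_0)) gaussE prod_powR//.
by rewrite addr_gt0// !mulr_gt0.
Qed.

Let ln_le (u : R) : 0 <= u -> ln (1 + u) <= u.
Proof.
move=> u0; have h : 0 < 1 + u by rewrite ltr_pwDl.
by rewrite -ler_expR lnK ?posrE// expR_ge1Dx.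
Qed.

(** Gaussians of small exponent [b] increase to 1; the lower bound compares
    [(1 + 4 b t)^(- half_dim)] with its first order expansion in [b]. *)
Let heat_mass t x : 0 < t -> (\int[mu]_y (heat t (x, y))%:E = 1)%E.
Proof.
move=> t0.
have mx : measurable_fun setT (fun y => (heat t (x, y))%:E).
  by apply/measurable_EFinP; exact: (measurableT_comp (measurable_heat t) (measurable_pair1 x)).
have mg c : measurable_fun setT (gauss_q normsq c).
  apply: measurableT_comp => //; apply: measurableT_comp => //; exact: measurable_funM.
have g1 c y : 0 < c -> gauss_q normsq c y <= 1.
  by move=> ?; rewrite -expR0 ler_expR oppr_le0 mulr_ge0// ltW.
have mxg c : measurable_fun setT (fun y => (heat t (x, y) * gauss_q normsq c y)%:E).
  apply/measurable_EFinP; apply: measurable_funM => //; exact/measurable_EFinP.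
have h_0 y : (0 <= (heat t (x, y))%:E)%E by rewrite lee_fin heat_ge0.
have hg0 c y : (0 <= (heat t (x, y) * gauss_q normsq c y)%:E)%E.
  by rewrite lee_fin mulr_ge0 ?heat_ge0// expR_ge0.
have iV N : 0 < N.+1%:R^-1 :> R by rewrite invr_gt0.
apply/eqP; rewrite eq_le; apply/andP; split.
  apply: (@ge0_integral_le_lim _ _ _ mu
    (fun N y => (heat t (x, y) * gauss_q normsq N.+1%:R^-1 y)%:E)) => //.
  - apply: nearW => y; apply: cvg_EFin; first exact: nearW.
    rewrite -[X in _ --> X]mulr1; apply: cvgMr.
    rewrite -[X in _ --> X]expR0; apply: continuous_cvg; first exact: continuous_expR.
    rewrite -oppr0; apply: cvgN; rewrite -(mul0r (normsq y)); apply: cvgMl.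
    exact: cvg_harmonic.
  - move=> N; rewrite heat_gauss// lee_fin mulr_ile1 ?expR_ge0//.
      rewrite -[leRHS]expR0 ler_expR oppr_le0 mulr_ge0 ?(ltW half_dim_gt0)// ln_ge0//.
      by rewrite lerDl !mulr_ge0// ltW.
    by rewrite g1// divr_gt0// addr_gt0// !mulr_gt0.
pose C := 4 * half_dim * t + normsq x.
have C0 : 0 <= C.
  apply: addr_ge0 => //; apply: mulr_ge0; last exact: ltW.
  by apply: mulr_ge0 => //; exact: ltW.
apply/lee_addgt0Pr => e e_0.
pose b := e / (C + 1).
have b0 : 0 < b by rewrite divr_gt0// ltr_wpDl.
have bC : b * C <= e.
  rewrite /b mulrAC ler_pdivrMr ?ltr_wpDl// ler_wpM2l ?(ltW e_0)//; lra.
apply: (@le_trans _ _ (\int[mu]_y (heat t (x, y) * gauss_q normsq b y)%:E + e%:E)%E); last first.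
  rewrite leeD2r//; apply: ge0_le_integral => // y _.
  by rewrite lee_fin ler_piMr ?heat_ge0// g1.
rewrite heat_gauss// -EFinD lee_fin -expRD.
have bt0 : 0 <= 4 * b * t by apply: mulr_ge0; [apply: mulr_ge0 => //|]; exact: ltW.
have D1 : 1 <= 1 + 4 * b * t by rewrite lerDl.
apply: (@le_trans _ _ (1 - b * C + e)); first lra.
rewrite lerD2r; apply: le_trans (expR_ge1Dx _) _; rewrite ler_expR.
have l1 : half_dim * ln (1 + 4 * b * t) <= half_dim * (4 * b * t).
  by rewrite ler_wpM2l ?(ltW half_dim_gt0)// ln_le.
have l2 : b / (1 + 4 * b * t) * normsq x <= b * normsq x.
  by rewrite ler_wpM2r// ler_pdivrMr ?(lt_le_trans ltr01)// ler_peMr// (ltW b0).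
rewrite /C; lra.
Qed.

Let sqint_gaussN s : (forall i, 0 < s i) ->
  sqint mu (gaussN s) = (gauss_cst a (fun i => s i + s i))%:E.
Proof.
move=> s0; have ss0 i : 0 < s i + s i by rewrite addr_gt0.
have [_ <-] := integral_gaussN a0 ss0.
by apply: eq_integral => x _; rewrite gaussND expr2.
Qed.

(** Applied to a Gaussian, the semigroup lowers the exponent and multiplies by a factor
    [1 - O(t)]; hence the form is [O(t)]. *)
Let quad_gaussN s t : (forall i, 0 < s i) -> 0 < t ->
  (quad mu (heat t) (gaussN s) <=
   (2 * gauss_cst a (fun i => s i + s i) * \sum_(i < n) (tnth a i + 1) * (4 * s i) * t)%:E)%E.
Proof.
move=> s0 t0; set I := gauss_cst a _; set C := \sum_(i < n) _.
have I0 : 0 < I by apply: gauss_cst_gt0 => i; rewrite addr_gt0.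
have mg : measurable_fun setT (gaussN s) := @measurable_gaussN R n s.
have g0 x : 0 < gaussN s x by exact: gaussN_gt0.
have g20 x : 0 <= gaussN s x ^+ 2 by exact: sqr_ge0.
have mg2 : measurable_fun setT (fun x => gaussN s x ^+ 2) by exact: measurable_funX.
have IE : (\int[mu]_x (gaussN s x ^+ 2)%:E = I%:E)%E by exact: sqint_gaussN.
have I1 := @integral_markov1 _ _ _ mu (fun=> heat t) (fun _ z => heat_ge0 z t0)
  (fun=> measurable_heat t) (fun _ x => heat_mass x t0) 0%N _ g20 mg2.
have I2 := @integral_markov2 _ _ _ mu (fun=> heat t) (fun _ z => heat_ge0 z t0)
  (fun _ x y => heat_sym t x y) (fun=> measurable_heat t) (fun _ x => heat_mass x t0) 0%N _ g20 mg2.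
rewrite IE in I1 I2.
pose A := (\int[mu \x mu]_z (heat t z * (gaussN s z.1 * gaussN s z.2))%:E)%E.
have m1 := measurable_pull1 mg; have m2 := measurable_pull2 mg.
have mh := measurable_heat t.
have mAA : measurable_fun setT (fun z : TT * TT => (heat t z * (gaussN s z.1 * gaussN s z.2))%:E).
  by apply/measurable_EFinP; apply: measurable_funM => //; exact: measurable_funM.
have A0 (z : TT * TT) : (0 <= (heat t z * (gaussN s z.1 * gaussN s z.2))%:E)%E.
  by rewrite lee_fin mulr_ge0 ?heat_ge0// mulr_ge0// ltW.
have AI : ((expR (- C) * I)%:E <= A)%E.
  rewrite /A fubini_tonelli1// EFinM -IE -ge0_integralZl//; last 2 first.
  - exact/measurable_EFinP.
  - by move=> x _; rewrite lee_fin.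
  apply: ge0_le_integral => //.
  - by move=> x _; rewrite -EFinM lee_fin mulr_ge0 ?expR_ge0.
  - by apply: measurable_funeM; exact/measurable_EFinP.
  - exact: measurable_fun_fubini_tonelli_F.
  move=> x _; rewrite /fubini_F/=.
  have -> : (\int[mu]_y (heat t (x, y) * (gaussN s x * gaussN s y))%:E =
      (gaussN s x)%:E * \int[mu]_y (heatN a (fun=> t) x y * gaussN s y)%:E)%E.
    rewrite -ge0_integralZl//; last 3 first.
    - apply/measurable_EFinP; apply: measurable_funM => //.
      exact: (measurableT_comp mh (measurable_pair1 x)).
    - by move=> y _; rewrite lee_fin mulr_ge0 ?(ltW (g0 _))// (heat_ge0 (x, y) t0).
    - by rewrite lee_fin ltW.
    by apply: eq_integral => y _; rewrite -EFinM /heat; congr EFin; ring.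
  rewrite (integral_heatN_gaussN a0 x (fun=> t0) s0) -!EFinM lee_fin.
  rewrite expr2 mulrCA ler_wpM2l ?(ltW (g0 x))//.
  have st i : 0 <= 4 * s i * t by apply: mulr_ge0; [apply: mulr_ge0 => //|]; exact: ltW.
  apply: ler_pM; rewrite ?expR_ge0 ?(ltW (g0 x))//.
    rewrite /C -sumrN expR_sum; apply: ler_prod => i _; rewrite expR_ge0/=.
    rewrite /powR gt_eqF; last by rewrite ltr_pwDl.
    rewrite ler_expR mulNr lerN2 -(mulrA (tnth a i + 1)) ler_wpM2l ?(ltW (c0 i))//.
    exact: ln_le.
  rewrite /gaussN /tprod; apply: ler_prod => i _; rewrite expR_ge0/=.
  rewrite ler_expR lerN2 ler_wpM2r ?sqr_ge0//.
  by rewrite ler_pdivrMr ?ler_peMr ?lerDl ?(ltW (s0 i))// ltr_pwDl.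
have mq := measurable_quad mh mg.
have q0 (z : TT * TT) : (0 <= (heat t z * (gaussN s z.1 - gaussN s z.2) ^+ 2)%:E)%E.
  by rewrite lee_fin mulr_ge0 ?heat_ge0// sqr_ge0.
have E : (quad mu (heat t) (gaussN s) + (A + A) = (I + I)%:E)%E.
  rewrite EFinD -{1}I1 -I2 /quad /A -!ge0_integralD//.
  all: try (by move=> z _; rewrite lee_fin mulr_ge0 ?heat_ge0).
  all: try (by move=> z _; exact: adde_ge0).
  all: try (exact: emeasurable_funD).
  all: try (apply/measurable_EFinP; apply: measurable_funM => //; exact: measurable_funX).
  by apply: eq_integral => z _; rewrite -!EFinD; congr EFin; ring.
have : (quad mu (heat t) (gaussN s) + (expR (- C) * I + expR (- C) * I)%:E <= (I + I)%:E)%E.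
  by rewrite -E leeD2l// EFinD leeD.
rewrite -leeBrDr// -EFinB => H; apply: le_trans H _; rewrite lee_fin.
have := expR_ge1Dx (- C) => h1.
have : 0 <= (expR (- C) - (1 - C)) * I by rewrite mulr_ge0 ?(ltW I0)//; lra.
by move=> h2; lra.
Qed.

Let vanish_gaussN s : (forall i, 0 < s i) ->
  vanish (fun N => quad mu (heat N.+1%:R^-1) (gaussN s)).
Proof.
move=> s0; have iV N : 0 < N.+1%:R^-1 :> R by rewrite invr_gt0.
pose D := 2 * gauss_cst a (fun i => s i + s i) * \sum_(i < n) (tnth a i + 1) * (4 * s i).
apply: vanish_le (fun N => quad_gaussN s0 (iV N)) _.
apply: cvg_vanish; apply: cvg_EFin; first exact: nearW.
have -> : fine \o (fun N => (2 * gauss_cst a (fun i => s i + s i) *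
    \sum_(i < n) (tnth a i + 1) * (4 * s i) * N.+1%:R^-1)%:E) = (fun N => D * N.+1%:R^-1).
  by apply/funext => N /=; rewrite /D -mulr_suml mulrA.
by rewrite -(mulr0 D); apply: cvgMr; exact: cvg_harmonic.
Qed.

Let coord_psi (i : 'I_n) (x : TT) : R := expR (- (tnth x i ^+ 2)).

(** The measure charges only the orthant, where the level sets of [coord_psi i] are the
    half-spaces bounded by the i-th coordinate. *)
Let coord_generates (S : set (set TT)) :
  (forall A, S A -> S (~` A)) -> (forall A B, S A -> S B -> S (A `|` B)) ->
  (forall F : nat -> set TT, (forall k, S (F k)) -> nondecreasing_seq F ->
    S (\bigcup_k F k)) ->
  (forall A B, S A -> measurable B -> {ae mu, forall x, A x <-> B x} -> S B) ->
  (forall psi c, (exists i, psi = coord_psi i) -> S [set x | psi x <= c]) ->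
  forall A, measurable A -> S A.
Proof.
move=> SC SU Sbig Sae Spsi.
have S0 : S set0.
  have := Spsi (coord_psi e0) (-1) (ex_intro _ e0 erefl).
  rewrite (_ : [set x | _] = set0)//; apply/seteqP; split => // x /=.
  by have := expR_gt0 (- (tnth x e0 ^+ 2)); rewrite /coord_psi => ? ?; lra.
have SbigU (F : nat -> set TT) : (forall k, S (F k)) -> S (\bigcup_k F k).
  move=> SF; rewrite -bigcup_bigsetU_bigcup; apply: Sbig.
    by elim=> [|k IH]; rewrite big_ord_recr/= ?big_ord0; exact: SU.
  move=> i j ij; apply/subsetPset; exact: subset_bigsetU.
have sigS : sigma_algebra setT S.
  by split => // A SA; rewrite setTD; exact: SC.
have Sray i r : S [set x | r <= tnth x i].
  have mray : measurable [set x : TT | r <= tnth x i].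
    rewrite -[X in measurable X]setTI.
    exact: (measurable_fun_le measurableT (measurable_cst r) (@measurable_tnth _ R n i)).
  have aeO : {ae mu, forall x, orthant x} by exact: ae_mdensity.
  have [r0|r0] := ltP r 0.
    apply: Sae (SC _ S0) mray _; apply: filterS aeO => x ox; split=> [_|_ []].
    by rewrite /= (le_trans (ltW r0))// ltW.
  apply: Sae (Spsi _ (expR (- r ^+ 2)) (ex_intro _ i erefl)) mray _.
  apply: filterS aeO => x ox /=; rewrite /coord_psi ler_expR lerN2.
  by rewrite ler_pXn2r// nnegrE// ltW.
move=> A; apply: smallest_sub => //.
apply: (@big_ind _ (fun B : set (set TT) => B `<=` S)) => //.
  by move=> B C BS CS X [/BS|/CS].
move=> i _ B [C mC <-]; rewrite setTI.
suff : (@measurable _ (measurableTypeR R)) `<=` [set C | S ((fun x : TT => tnth x i) @^-1` C)].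
  exact.
rewrite RGenCInfty.measurableE; apply: smallest_sub.
  split; rewrite /= ?preimage_set0//.
    by move=> D SD; rewrite setTD preimage_setC; exact: SC.
  by move=> F SF; rewrite preimage_bigcup; exact: SbigU.
move=> D [r ->] /=; have := Sray i r; congr S.
by apply/seteqP; split => x /=; rewrite in_itv/= andbT.
Qed.

Let heat_vanish (u : TT -> R) : measurable_fun setT u -> (sqint mu u < +oo)%E ->
  vanish (fun N => quad mu (heat N.+1%:R^-1) u).
Proof.
have iV N : 0 < N.+1%:R^-1 :> R by rewrite invr_gt0.
apply: (@vanish_quad _ _ _ mu (fun N => heat N.+1%:R^-1) _ _ _ _ (gaussN (fun=> 1)) _ _ _ _
  [set psi | exists i, psi = coord_psi i]) => //.
- by move=> N z; exact: heat_ge0.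
- by move=> N x; exact: heat_mass.
- by move=> x; exact: gaussN_gt0.
- exact: measurable_gaussN.
- by rewrite sqint_gaussN ?ltry.
- exact: vanish_gaussN.
move=> psi [i ->]; split.
- apply: measurableT_comp => //; apply: measurableT_comp => //; apply: measurable_funX.
  exact: (@measurable_tnth _ R n i).
- move=> x; rewrite ger0_norm ?expR_ge0// -expR0 ler_expR oppr_le0.
  exact: sqr_ge0.
have -> : (fun x => gaussN (fun=> 1) x * coord_psi i x) =
    gaussN (fun j => 1 + (if j == i then 1 else 0)).
  apply/funext => x; rewrite gaussND; congr (_ * _).
  rewrite /gaussN /tprod (bigD1 i)//= eqxx mul1r big1 ?mulr1// => j /negbTE ->.
  by rewrite mul0r oppr0 expR0.
by apply: vanish_gaussN => j; case: ifP => _; rewrite ?addr0// addr_gt0.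
Qed.

Local Notation K := (bessel_kernel a).

Let mK := measurable_bessel_kernel a0.
Let K1 := bessel_kernel_le1 a0.

Lemma measurable_bessel_ktransform (u : TT -> R) : mu.-integrable setT (EFin \o u) ->
  measurable_fun setT (ktransform mu K u).
Proof. exact: (measurable_ktransform mK K1 measurable_normsq integrable_gauss). Qed.

Lemma bessel_plancherel (f g : TT -> R) : is_ktransform mu K f g -> sqint mu g = sqint mu f.
Proof.
exact: (sqint_is_ktransform mK K1 measurable_normsq normsq_ge0 integrable_gauss heat_ge0 heat_sym
  measurable_heat heat_mass heat_kernel heat_vanish).
Qed.

Lemma ex_bessel_ktransform (f : TT -> R) : measurable_fun setT f -> (sqint mu f < +oo)%E ->
  exists g, is_ktransform mu K f g.
Proof.
exact: (ex_is_ktransform mK K1 measurable_normsq integrable_gauss heat_ge0 heat_sym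
  measurable_heat heat_mass heat_kernel).
Qed.

Lemma bessel_heisenberg (c : R) (f g : TT -> R) : 0 < c -> is_ktransform mu K f g ->
  ((4 * c * half_dim)%:E * sqint mu f <=
   \int[mu]_x (normsq x * g x ^+ 2)%:E +
   (4 * c ^+ 2)%:E * \int[mu]_x (normsq x * f x ^+ 2)%:E)%E.
Proof.
exact: (heisenberg mK K1 measurable_normsq normsq_ge0 integrable_gauss heat_ge0 heat_sym
  measurable_heat heat_mass heat_kernel heat_vanish half_dim_gt0 heat_gauss).
Qed.

End bessel.

(** * Complex-valued functions and the Bessel transform *)

Section complex_square_integrals.
Context d (T : measurableType d) (R : realType).
Variable mu : {measure set T -> \bar R}.
Implicit Types f g : T -> R[i].
Local Notation Re := complex.Re.
Local Notation Im := complex.Im.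
Local Notation normc := Normc.normc.

(** The square of the L^2 norm, which is easier to integrate and to add. *)
Definition csqint f : \bar R := (\int[mu]_x (normc (f x) ^+ 2)%:E)%E.

Lemma sqr_normc (z : R[i]) : normc z ^+ 2 = Re z ^+ 2 + Im z ^+ 2.
Proof. by case: z => u v /=; rewrite sqr_sqrtr// addr_ge0 ?sqr_ge0. Qed.

Lemma normc_ge0 (z : R[i]) : 0 <= normc z.
Proof. by case: z => u v /=; exact: sqrtr_ge0. Qed.

Lemma measurable_sqr_normc f : cmeasurable f ->
  measurable_fun setT (fun x => normc (f x) ^+ 2).
Proof.
move=> [mr mi]; rewrite (_ : (fun _ => _) = (fun x => Re (f x) ^+ 2 + Im (f x) ^+ 2)).
  by apply: measurable_funD; exact: measurable_funX.
by apply/funext => x; rewrite sqr_normc.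
Qed.

Lemma csqint_ge0 f : (0 <= csqint f)%E.
Proof. by apply: integral_ge0 => x _; rewrite lee_fin sqr_ge0. Qed.

Lemma cLnorm_ge0 f : (0 <= cLnorm mu 2%:E f)%E.
Proof. exact: Lnorm_ge0. Qed.

Lemma cLnorm_sqr f : (cLnorm mu 2%:E f * cLnorm mu 2%:E f)%E = csqint f.
Proof.
have H : (cLnorm mu 2%:E f `^ 2 = csqint f)%E.
  rewrite /cLnorm poweR_Lnorm//; apply: eq_integral => x _ /=.
  by rewrite (ger0_norm (normc_ge0 _)) powR_mulrn// normc_ge0.
rewrite -H; have := cLnorm_ge0 f; case: (cLnorm mu 2%:E f) => [r| |]//.
  by rewrite lee_fin => r0; rewrite poweR_EFin powR_mulrn// -EFinM expr2.
by move=> _; rewrite poweRyr.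
Qed.

Lemma cLnorm_lty f : (cLnorm mu 2%:E f < +oo)%E = (csqint f < +oo)%E.
Proof.
rewrite -cLnorm_sqr; have := cLnorm_ge0 f; case: (cLnorm mu 2%:E f) => [r| |]//.
by move=> _; rewrite -EFinM !ltry.
Qed.

Lemma cLnorm_le (e : R) f : 0 <= e -> (csqint f <= (e ^+ 2)%:E)%E ->
  (cLnorm mu 2%:E f <= e%:E)%E.
Proof.
move=> e0; rewrite -cLnorm_sqr; have := cLnorm_ge0 f.
case: (cLnorm mu 2%:E f) => [r| |]//.
by rewrite -EFinM !lee_fin => r0; rewrite -expr2 ler_pXn2r.
Qed.

Lemma csqint_le (e : R) f : (cLnorm mu 2%:E f <= e%:E)%E -> (csqint f <= (e ^+ 2)%:E)%E.
Proof.
rewrite -cLnorm_sqr; have := cLnorm_ge0 f.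
case: (cLnorm mu 2%:E f) => [r| |]//.
by rewrite -EFinM !lee_fin => r0 re; rewrite -expr2 lerXn2r// nnegrE// (le_trans r0).
Qed.

Lemma inL2P f : inLp mu 2%:E f <-> cmeasurable f /\ (csqint f < +oo)%E.
Proof. by rewrite /inLp cLnorm_lty. Qed.

Let abs_le_normc (z : R[i]) : `|Re z| <= normc z /\ `|Im z| <= normc z.
Proof.
have n0 := normc_ge0 z.
split; rewrite -(@ler_pXn2r _ 2)// ?nnegrE// real_normK ?num_real// sqr_normc.
  by rewrite lerDl sqr_ge0.
by rewrite lerDr sqr_ge0.
Qed.

Lemma measurable_normc f : cmeasurable f -> measurable_fun setT (fun x => normc (f x)).
Proof.
move=> mf; rewrite (_ : (fun _ => _) = (fun x => Num.sqrt (normc (f x) ^+ 2))).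
  have ms : measurable_fun setT (@Num.sqrt R) by apply: continuous_measurable_fun; exact: sqrt_continuous.
  exact: (measurableT_comp ms (measurable_sqr_normc mf)).
by apply/funext => x; rewrite sqrtr_sqr ger0_norm// normc_ge0.
Qed.

Lemma inL1_integrable f : inLp mu 1%:E f ->
  mu.-integrable setT (EFin \o (fun x => Re (f x))) /\
  mu.-integrable setT (EFin \o (fun x => Im (f x))).
Proof.
move=> [[mr mi] foo].
have mn : measurable_fun setT (fun x => normc (f x)) by exact: measurable_normc.
have n0 x := normc_ge0 (f x).
have inn : mu.-integrable setT (fun x => (normc (f x))%:E).
  apply/integrableP; split; first exact/measurable_EFinP.
  by move: foo; rewrite /cLnorm Lnorm1.
split; apply: le_integrable inn => //; try exact/measurable_EFinP.
- move=> x _; rewrite /= lee_fin (ger0_norm (n0 x)).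
  by have [] := abs_le_normc (f x).
- move=> x _; rewrite /= lee_fin (ger0_norm (n0 x)).
  by have [] := abs_le_normc (f x).
Qed.

End complex_square_integrals.

Lemma csqintE d (T : measurableType d) (R : realType)
    (mu : {sigma_finite_measure set T -> \bar R}) (f : T -> R[i]) : cmeasurable f ->
  (csqint mu f = sqint mu (fun x => complex.Re (f x)) +
                 sqint mu (fun x => complex.Im (f x)))%E.
Proof.
move=> [mr mi]; rewrite /csqint /sqint -ge0_integralD//.
- by apply: eq_integral => x _; rewrite sqr_normc EFinD.
- by move=> x _; rewrite lee_fin sqr_ge0.
- exact: measurable_sqr.
- by move=> x _; rewrite lee_fin sqr_ge0.
- exact: measurable_sqr.
Qed.

Section bessel_transform_theory.
Context (R : realType) (n : nat) (a : n.-tuple R).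
Hypothesis a0 : forall i, - 2^-1 < tnth a i.
Hypothesis n0 : (0 < n)%N.
Local Notation mu := (bessel_measure a).
Local Notation K := (bessel_kernel a).
Local Notation Re := complex.Re.
Local Notation Im := complex.Im.
Local Notation normc := Normc.normc.
Implicit Types f g : n.-tuple R -> R[i].

Definition re_part f x : R := Re (f x).
Definition im_part f x : R := Im (f x).

Lemma re_bessel_transform1 f l :
  Re (bessel_transform1 a f l) = ktransform mu K (re_part f) l.
Proof.
rewrite /bessel_transform1 /cintegral /ktransform /=; apply: eq_Rintegral => x _.
by rewrite /re_part; case: (f x) => u v /=; rewrite mulr0 subr0.
Qed.

Lemma im_bessel_transform1 f l :
  Im (bessel_transform1 a f l) = ktransform mu K (im_part f) l.
Proof.
rewrite /bessel_transform1 /cintegral /ktransform /=; apply: eq_Rintegral => x _.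
by rewrite /im_part; case: (f x) => u v /=; rewrite mulr0 add0r.
Qed.

Let cmeasurableB f g : cmeasurable f -> cmeasurable g -> cmeasurable (fun x => f x - g x).
Proof.
move=> [f1 f2] [g1 g2]; split.
  rewrite (_ : (fun _ => _) = (fun x => Re (f x) - Re (g x))); first exact: measurable_funB.
  by apply/funext => x; case: (f x) (g x) => ? ? [].
rewrite (_ : (fun _ => _) = (fun x => Im (f x) - Im (g x))); first exact: measurable_funB.
by apply/funext => x; case: (f x) (g x) => ? ? [].
Qed.

Let csqintB f g : cmeasurable f -> cmeasurable g ->
  (csqint mu (fun x => (f x - g x)%R) =
   sqint mu (fun x => (re_part f x - re_part g x)%R) +
   sqint mu (fun x => (im_part f x - im_part g x)%R))%E.
Proof.
move=> mf mg; rewrite csqintE; last exact: cmeasurableB.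
congr (_ + _)%E; apply: eq_integral => x _; rewrite /re_part /im_part;
  by case: (f x) (g x) => ? ? [].
Qed.

Let sqint_lty f : cmeasurable f -> (csqint mu f < +oo)%E ->
  (sqint mu (re_part f) < +oo)%E /\ (sqint mu (im_part f) < +oo)%E.
Proof.
move=> mf; rewrite csqintE// => foo; split; apply: le_lt_trans foo.
  by rewrite leeDl// sqint_ge0.
by rewrite leeDr// sqint_ge0.
Qed.

Let cmeasurable_bessel_transform1 f :
  mu.-integrable setT (EFin \o re_part f) -> mu.-integrable setT (EFin \o im_part f) ->
  cmeasurable (bessel_transform1 a f).
Proof.
move=> i1 i2; split.
  rewrite (_ : (fun _ => _) = ktransform mu K (re_part f)).
    exact: measurable_bessel_ktransform.
  by apply/funext => l; exact: re_bessel_transform1.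
rewrite (_ : (fun _ => _) = ktransform mu K (im_part f)).
  exact: measurable_bessel_ktransform.
by apply/funext => l; exact: im_bessel_transform1.
Qed.

(** The kernel is real, so real and imaginary parts are transformed separately. *)
Lemma is_bessel_transform_parts f g : inLp mu 2%:E f -> is_bessel_transform a f g ->
  is_ktransform mu K (re_part f) (re_part g) /\ is_ktransform mu K (im_part f) (im_part g).
Proof.
move=> /inL2P[mf foo] [/inL2P[mg goo] [u [u12 uf ug]]].
have [[mfr mfi] [mgr mgi]] := (mf, mg).
have [fr fi] := sqint_lty mf foo; have [gr gi] := sqint_lty mg goo.
have app (e : R) : 0 < e -> exists k,
    (csqint mu (fun x => (u k x - f x)%R) <= e%:E)%E /\
    (csqint mu (fun l => (bessel_transform1 a (u k) l - g l)%R) <= e%:E)%E.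
  move=> e0; pose e' := Num.min e 1.
  have e'0 : 0 < e' by rewrite lt_min e0 ltr01.
  have e'2 : e' ^+ 2 <= e.
    rewrite expr2 (@le_trans _ _ e')// ?ler_piMl ?(ltW e'0)// ?ge_min ?lexx ?orbT//.
  have [N1 H1] := cvg_vanish uf e'0; have [N2 H2] := cvg_vanish ug e'0.
  exists (maxn N1 N2); split.
    by apply: le_trans (csqint_le (H1 _ (leq_maxl _ _))) _; rewrite lee_fin.
  by apply: le_trans (csqint_le (H2 _ (leq_maxr _ _))) _; rewrite lee_fin.
have ui k := inL1_integrable (u12 k).1.
have um k : cmeasurable (u k) by have [[]] := u12 k.
have uoo k := sqint_lty (um k) (proj2 ((inL2P mu (u k)).1 (u12 k).2)).
have bm k : cmeasurable (bessel_transform1 a (u k)).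
  by have [i1 i2] := ui k; exact: cmeasurable_bessel_transform1.
split; split => // e /app[k [uke bke]]; move: uke bke; rewrite !csqintB// => uke bke.
- exists (re_part (u k)); split; [exact: (ui k).1|exact: (uoo k).1|..].
    by apply: le_trans uke; rewrite leeDl// sqint_ge0.
  have -> : ktransform mu K (re_part (u k)) = re_part (bessel_transform1 a (u k)).
    by apply/funext => l; rewrite -re_bessel_transform1.
  by apply: le_trans bke; rewrite leeDl// sqint_ge0.
- exists (im_part (u k)); split; [exact: (ui k).2|exact: (uoo k).2|..].
    by apply: le_trans uke; rewrite leeDr// sqint_ge0.
  have -> : ktransform mu K (im_part (u k)) = im_part (bessel_transform1 a (u k)).
    by apply/funext => l; rewrite -im_bessel_transform1.
  by apply: le_trans bke; rewrite leeDr// sqint_ge0.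
Qed.

Let integrable_inL1 f : mu.-integrable setT (EFin \o re_part f) ->
  mu.-integrable setT (EFin \o im_part f) -> inLp mu 1%:E f.
Proof.
move=> i1 i2.
have mr : measurable_fun setT (re_part f) by have /integrableP[/measurable_EFinP] := i1.
have mi : measurable_fun setT (im_part f) by have /integrableP[/measurable_EFinP] := i2.
have mf : cmeasurable f by [].
split => //; rewrite /cLnorm Lnorm1.
have iD := integrableD measurableT (integrable_norm i1) (integrable_norm i2).
have mn : measurable_fun setT (fun x => (normc (f x))%:E).
  apply/measurable_EFinP; exact: measurable_normc.
apply: le_lt_trans (integrable_lty measurableT iD).
apply: ge0_le_integral => //.
- exact: measurableT_comp.
- by have /integrableP[] := iD.
move=> x _ /=; rewrite (ger0_norm (normc_ge0 _)) lee_fin.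
rewrite -(@ler_pXn2r _ 2)// ?nnegrE ?normc_ge0 ?addr_ge0//.
rewrite sqr_normc /re_part /im_part sqrrD !real_normK ?num_real//.
by rewrite lerD2r lerDl mulrn_wge0// mulr_ge0.
Qed.

(** Approximations with square error [(k + 1)^-2 / 2] in both parts. *)
Lemma ex_bessel_transform f : inLp mu 2%:E f -> exists g, is_bessel_transform a f g.
Proof.
move=> /inL2P[mf foo]; have [fr fi] := sqint_lty mf foo; have [mfr mfi] := mf.
have [gr Hr] := ex_bessel_ktransform a0 n0 mfr fr.
have [gi Hi] := ex_bessel_ktransform a0 n0 mfi fi.
have [_ mgr _ grfin appr] := Hr; have [_ mgi _ gifin appi] := Hi.
pose g x : R[i] := (gr x +i* gi x)%C.
have mg : cmeasurable g by [].
have e0 k : 0 < (k.+1%:R^-1 : R) ^+ 2 / 2 by rewrite divr_gt0// exprn_gt0.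
have /choice[ur urP] := fun k => appr _ (e0 k).
have /choice[ui uiP] := fun k => appi _ (e0 k).
pose u k x : R[i] := (ur k x +i* ui k x)%C.
have iur k : mu.-integrable setT (EFin \o ur k) by have [] := urP k.
have iui k : mu.-integrable setT (EFin \o ui k) by have [] := uiP k.
have u1 k : inLp mu 1%:E (u k) by exact: (@integrable_inL1 (u k) (iur k) (iui k)).
have um k : cmeasurable (u k) by have [] := u1 k.
have halves k : ((k.+1%:R^-1 ^+ 2)%:E = (k.+1%:R^-1 ^+ 2 / 2)%:E + (k.+1%:R^-1 ^+ 2 / 2)%:E :> \bar R)%E.
  by rewrite -EFinD -splitr.
have to0 (F : nat -> \bar R) : (forall k, 0 <= F k)%E ->
    (forall k, F k <= (k.+1%:R^-1)%:E)%E -> F k @[k --> \oo] --> 0%E.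
  move=> F0 Fk; apply: (@squeeze_cvge _ _ _ _ (fun=> 0%E) _ (fun k => (k.+1%:R^-1)%:E)).
  - by apply: nearW => k; rewrite F0 Fk.
  - exact: cvg_cst.
  - by apply: cvg_EFin; [exact: nearW|exact: cvg_harmonic].
exists g; split.
  apply/inL2P; split => //; rewrite csqintE//; exact: lte_add_pinfty.
exists u; split.
- move=> k; split => //; apply/inL2P; split => //; rewrite csqintE//.
  by apply: lte_add_pinfty; [have [] := urP k|have [] := uiP k].
- apply: to0 => [k|k]; first exact: cLnorm_ge0.
  apply: cLnorm_le; first by rewrite invr_ge0.
  rewrite csqintB// halves; apply: leeD; [have [] := urP k => // |have [] := uiP k => //].
- apply: to0 => [k|k]; first exact: cLnorm_ge0.
  apply: cLnorm_le; first by rewrite invr_ge0.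
  have bm := @cmeasurable_bessel_transform1 (u k) (iur k) (iui k).
  rewrite csqintB// halves; apply: leeD.
    rewrite (_ : re_part (bessel_transform1 a (u k)) = ktransform mu K (ur k)).
      by have [] := urP k.
    by apply/funext => l; exact: re_bessel_transform1.
  rewrite (_ : im_part (bessel_transform1 a (u k)) = ktransform mu K (ui k)).
    by have [] := uiP k.
  by apply/funext => l; exact: im_bessel_transform1.
Qed.

Lemma bessel_transformP f : inLp mu 2%:E f ->
  is_bessel_transform a f (bessel_transform a f).
Proof. by move=> /ex_bessel_transform[g gP]; exact: (@xgetPex _ (fun=> 0) [set g | is_bessel_transform a f g] (ex_intro _ g gP)). Qed.

(** The squared L^2 norm of [|x| f]. *)
Definition cmoment f : \bar R := (\int[mu]_x (normsq x * normc (f x) ^+ 2)%:E)%E.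

Lemma csqint_bessel_transform f : inLp mu 2%:E f ->
  csqint mu (bessel_transform a f) = csqint mu f.
Proof.
move=> fL2; have gP := bessel_transformP fL2.
have [trr tri] := is_bessel_transform_parts fL2 gP.
have [mf _] := fL2; have [[mg _] _] := gP.
by rewrite !csqintE// (bessel_plancherel a0 n0 trr) (bessel_plancherel a0 n0 tri).
Qed.

Lemma measurable_moment (f : n.-tuple R -> R) : measurable_fun setT f ->
  measurable_fun setT (fun x => (normsq x * f x ^+ 2)%:E).
Proof.
move=> mf; apply/measurable_EFinP; apply: measurable_funM; last exact: measurable_funX.
exact: measurable_normsq.
Qed.

Let cmomentE f : cmeasurable f -> (cmoment f =
  \int[mu]_x (normsq x * re_part f x ^+ 2)%:E +
  \int[mu]_x (normsq x * im_part f x ^+ 2)%:E)%E.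
Proof.
move=> [mr mi]; rewrite -ge0_integralD//.
- by apply: eq_integral => x _; rewrite sqr_normc -EFinD -mulrDr.
- by move=> x _; rewrite lee_fin mulr_ge0 ?sqr_ge0// normsq_ge0.
- exact: measurable_moment.
- by move=> x _; rewrite lee_fin mulr_ge0 ?sqr_ge0// normsq_ge0.
- exact: measurable_moment.
Qed.

Lemma bessel_transform_heisenberg (c : R) f : 0 < c -> inLp mu 2%:E f ->
  ((4 * c * half_dim a)%:E * csqint mu f <=
   cmoment (bessel_transform a f) + (4 * c ^+ 2)%:E * cmoment f)%E.
Proof.
move=> c0 fL2; have gP := bessel_transformP fL2.
have [trr tri] := is_bessel_transform_parts fL2 gP.
have [mf _] := fL2; have [[mg _] _] := gP.
have := leeD (bessel_heisenberg a0 n0 c0 trr) (bessel_heisenberg a0 n0 c0 tri).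
have m0 (f1 : n.-tuple R -> R) : (0 <= \int[mu]_x (normsq x * f1 x ^+ 2)%:E)%E.
  by apply: integral_ge0 => x _; rewrite lee_fin mulr_ge0 ?sqr_ge0// normsq_ge0.
rewrite csqintE// !cmomentE// -ge0_muleDr ?sqint_ge0//.
move=> H; rewrite (ge0_muleDr _ (m0 (re_part f)) (m0 (im_part f))) [leRHS]addeACA.
exact: H.
Qed.

End bessel_transform_theory.

(** * Multiplier operators *)

Section optimization.
Context {R : realType}.
Local Open Scope ereal_scope.

(** The choice [c = B / (2 A)] balances the two terms; it requires [A] and [B] to be
    positive and finite, and the degenerate cases are hypotheses or trivial. *)
Lemma geometric_of_arithmetic (N A B : \bar R) (h k : R) : (0 < h)%R ->
  0 <= N -> N < +oo -> 0 <= A -> 0 <= B -> (A = 0 -> N = 0) -> (B = 0 -> N = 0) ->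
  (forall c : R, (0 < c)%R -> (4 * c * h)%:E * N <= B * B + (4 * c ^+ 2)%:E * (A * A)) ->
  (h^-1 <= k)%R -> N <= k%:E * A * B.
Proof.
move=> h0 N0 Noo A0 B0 AN BN H hk.
have k0 : (0 < k)%R by apply: lt_le_trans hk; rewrite invr_gt0.
have [->|Nn0] := eqVneq N 0; first by rewrite !mule_ge0// lee_fin ltW.
have Ap : 0 < A by rewrite lt_neqAle A0 andbT eq_sym; apply: contra_neq Nn0 => /AN.
have Bp : 0 < B by rewrite lt_neqAle B0 andbT eq_sym; apply: contra_neq Nn0 => /BN.
have kp : 0 < k%:E by rewrite lte_fin.
move: A B {A0 B0 AN BN} H Ap Bp => [x| |]// [y| |]//; rewrite ?lte_fin; last 3 first.
- by move=> _ x0 _; rewrite muleC gt0_mulye ?leey// mule_gt0.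
- by move=> _ _ y0; rewrite gt0_muley// gt0_mulye ?leey// lte_fin.
- by move=> _ _ _; rewrite (gt0_muley kp) gt0_muley// leey.
case: N {Nn0} N0 Noo => [N| |]// _ _ H x0 y0.
have c0 : (0 < y / (2 * x))%R by rewrite divr_gt0// mulr_gt0.
have := H _ c0; rewrite -!EFinM -EFinD !lee_fin => le1.
apply: (@le_trans _ _ (h^-1 * x * y)%R); last first.
  by rewrite ler_wpM2r ?(ltW y0)// ler_wpM2r ?(ltW x0).
have e1 : (4 * (y / (2 * x)) * h * N = 2 * y * h / x * N)%R by field; rewrite gt_eqF.
have e2 : (y * y + 4 * (y / (2 * x)) ^+ 2 * (x * x) = 2 * y ^+ 2)%R.
  by field; rewrite gt_eqF.
move: le1; rewrite e1 e2 => le1.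
have f0 : (0 < x / (2 * y * h))%R by rewrite divr_gt0// !mulr_gt0.
have := ler_wpM2l (ltW f0) le1.
rewrite (_ : x / (2 * y * h) * (2 * y * h / x * N) = N)%R; last first.
  by field; rewrite !gt_eqF.
rewrite (_ : x / (2 * y * h) * (2 * y ^+ 2) = h^-1 * x * y)%R//.
by field; rewrite !gt_eqF.
Qed.

End optimization.

Section multipliers.
Context (R : realType) (n : nat) (a : n.-tuple R).
Hypothesis a0 : forall i, - 2^-1 < tnth a i.
Hypothesis n0 : (0 < n)%N.
Local Notation mu := (bessel_measure a).
Local Notation ls := (@log_measure R).
Local Notation RR := (measurableTypeR R).
Local Notation TT := (n.-tuple R).
Local Notation normc := Normc.normc.
Implicit Types f g m : TT -> R[i].

Let e0 : 'I_n := Ordinal n0.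

Let normsq_gt0 (x : TT) : orthant x -> 0 < normsq x.
Proof.
move=> ox; rewrite /normsq (bigD1 e0)//=; apply: ltr_pwDl.
  by rewrite exprn_gt0.
by apply: sumr_ge0 => i _; exact: sqr_ge0.
Qed.

Let ae_orthant : {ae mu, forall x, orthant x}.
Proof. exact: ae_mdensity. Qed.

Lemma measurable_dilation :
  measurable_fun setT (fun z : RR * TT => dilation z.1 z.2).
Proof.
apply/measurable_fun_tnthP => i.
rewrite (_ : _ \o _ = fun z : RR * TT => z.1 * tnth z.2 i).
  apply: measurable_funM => //.
  exact: (measurableT_comp (@measurable_tnth _ R n i)).
by apply/funext => z /=; rewrite tnth_mktuple.
Qed.

(** [normsq] is positive on the orthant. *)
Lemma cmoment_eq0 f : cmeasurable f -> cmoment a f = 0%E -> csqint mu f = 0%E.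
Proof.
move=> mf f0; have mn := measurable_normc mf.
have mm := measurable_moment mn.
have pos x : (0 <= (normsq x * normc (f x) ^+ 2)%:E)%E.
  by rewrite lee_fin mulr_ge0 ?sqr_ge0// normsq_ge0.
have : (\int[mu]_x `|(normsq x * normc (f x) ^+ 2)%:E| = 0)%E.
  by rewrite -[RHS]f0; apply: eq_integral => x _; rewrite gee0_abs.
move=> /(ae_eq_integral_abs mu measurableT mm) ae0.
rewrite /csqint (@ge0_ae_eq_integral _ _ _ mu setT _ (cst 0%E))//.
- by rewrite integral0.
- exact: measurable_sqr.
- by move=> x _; rewrite lee_fin sqr_ge0.
apply: filterS2 ae0 ae_orthant => x /(_ I) /= [E] ox _.
apply/eqP; rewrite eqe; move/eqP: E; rewrite mulf_eq0 gt_eqF//.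
exact: normsq_gt0.
Qed.

Section admissible.
Variables (m F : TT -> R[i]).
Hypotheses (mm : cmeasurable m) (mF : cmeasurable F).
Hypothesis madm : forall x, orthant x ->
  (\int[ls]_s ((normc (m (dilation s x))) ^+ 2)%:E = 1)%E.

(** The part of the function [F] that is seen at scale [s]. *)
Definition band (s : R) (x : TT) : R[i] := m (dilation s x) * F x.

Let measurable_comp2 (u : TT -> R) : measurable_fun setT u ->
  measurable_fun setT (fun z : RR * TT => u (dilation z.1 z.2)).
Proof. by move=> mu_; exact: (measurableT_comp mu_ measurable_dilation). Qed.

Lemma cmeasurable_band s : cmeasurable (band s).
Proof.
have [m1 m2] := mm; have [F1 F2] := mF.
have md : measurable_fun setT (fun x : TT => dilation s x).
  exact: (measurableT_comp measurable_dilation (measurable_pair1 (s : RR))).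
have c1 := measurableT_comp m1 md; have c2 := measurableT_comp m2 md.
split.
  rewrite (_ : (fun _ => _) = fun x =>
    complex.Re (m (dilation s x)) * complex.Re (F x) -
    complex.Im (m (dilation s x)) * complex.Im (F x)).
    by apply: measurable_funB; apply: measurable_funM.
  by apply/funext => x; rewrite /band; case: (m _) (F x) => ? ? [].
rewrite (_ : (fun _ => _) = fun x =>
    complex.Re (m (dilation s x)) * complex.Im (F x) +
    complex.Im (m (dilation s x)) * complex.Re (F x)).
  by apply: measurable_funD; apply: measurable_funM.
by apply/funext => x; rewrite /band; case: (m _) (F x) => ? ? [].
Qed.

Lemma measurable_band_weight (w : TT -> R) : measurable_fun setT w ->
  measurable_fun setT (fun z : RR * TT => (w z.2 * normc (band z.1 z.2) ^+ 2)%:E).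
Proof.
move=> mw; apply/measurable_EFinP.
rewrite (_ : (fun _ => _) = fun z : RR * TT =>
    w z.2 * (normc (m (dilation z.1 z.2)) ^+ 2 * normc (F z.2) ^+ 2)).
  apply: measurable_funM; first exact: (measurableT_comp mw).
  apply: measurable_funM; apply: measurable_funX.
    exact: measurable_comp2 (measurable_normc mm).
  exact: (measurableT_comp (measurable_normc mF)).
by apply/funext => z; rewrite /band Normc.normcM exprMn.
Qed.

(** By Tonelli the scale is integrated first, where admissibility gives 1. *)
Lemma integral_band (w : TT -> R) : measurable_fun setT w -> (forall x, 0 <= w x) ->
  (\int[ls]_s \int[mu]_x (w x * normc (band s x) ^+ 2)%:E =
   \int[mu]_x (w x * normc (F x) ^+ 2)%:E)%E.
Proof.
move=> mw w0; have mb := measurable_band_weight mw.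
have b0 (z : RR * TT) : (0 <= (w z.2 * normc (band z.1 z.2) ^+ 2)%:E)%E.
  by rewrite lee_fin; apply: mulr_ge0 => //; exact: sqr_ge0.
rewrite (@fubini_tonelli _ _ RR TT R ls mu
  (fun z : RR * TT => (w z.2 * normc (band z.1 z.2) ^+ 2)%:E))//.
apply: ge0_ae_eq_integral => //.
- exact: (@measurable_fun_fubini_tonelli_G _ _ RR TT R ls
    (fun z : RR * TT => (w z.2 * normc (band z.1 z.2) ^+ 2)%:E)).
- apply/measurable_EFinP; apply: measurable_funM => //; apply: measurable_funX.
  exact: measurable_normc.
- by move=> x _; apply: integral_ge0 => s _; exact: (b0 (s, x)).
- by move=> x _; rewrite lee_fin; apply: mulr_ge0 => //; exact: sqr_ge0.
apply: filterS ae_orthant => x ox _.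
have wF0 : 0 <= w x * normc (F x) ^+ 2 by apply: mulr_ge0 => //; exact: sqr_ge0.
transitivity (\int[ls]_s ((w x * normc (F x) ^+ 2)%:E *
    (normc (m (dilation s x)) ^+ 2)%:E))%E.
  by apply: eq_integral => s _; rewrite /band Normc.normcM -EFinM; congr EFin; ring.
rewrite ge0_integralZl//; last 2 first.
- apply/measurable_EFinP; apply: measurable_funX.
  exact: (measurableT_comp (measurable_comp2 (measurable_normc mm)) (measurable_pair2 x)).
- by move=> s _; rewrite lee_fin sqr_ge0.
by rewrite madm// mule1.
Qed.

Variable U : RR * TT -> R[i].
Hypotheses (Foo : (csqint mu F < +oo)%E) (mU : cmeasurable U)
  (UE : forall s : R, 0 < s ->
    {ae mu, forall x, U (s, x) = bessel_transform a (band s) x}).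

Let X : \bar R := (\int[(Omega_measure a)]_z (normsq z.2 * normc (U z) ^+ 2)%:E)%E.

Let mUX : measurable_fun setT (fun z : RR * TT => (normsq z.2 * normc (U z) ^+ 2)%:E).
Proof.
apply/measurable_EFinP; apply: measurable_funM.
  exact: (measurableT_comp (@measurable_normsq R n)).
by apply: measurable_funX; exact: measurable_normc.
Qed.

Let U0 (z : RR * TT) : (0 <= (normsq z.2 * normc (U z) ^+ 2)%:E)%E.
Proof. by rewrite lee_fin mulr_ge0 ?sqr_ge0// normsq_ge0. Qed.

Let mUs s : cmeasurable (fun x => U (s, x)).
Proof.
have [U1 U2] := mU; have mp := @measurable_pair1 _ _ RR TT (s : RR).
by split; [exact: (measurableT_comp U1 mp)|exact: (measurableT_comp U2 mp)].
Qed.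

Let XE : X = (\int[ls]_s cmoment a (fun x => U (s, x)))%E.
Proof. by rewrite /X /Omega_measure fubini_tonelli1. Qed.

Let mXs : measurable_fun setT (fun s : RR => cmoment a (fun x => U (s, x))).
Proof. exact: (@measurable_fun_fubini_tonelli_F _ _ RR TT R mu _ mUX U0). Qed.

Let w1 : TT -> R := cst 1.

Let mw1 : measurable_fun setT w1. Proof. exact: measurable_cst. Qed.

Let csqint_w1 f : (\int[mu]_x (w1 x * normc (f x) ^+ 2)%:E)%E = csqint mu f.
Proof. by apply: eq_integral => x _; rewrite mul1r. Qed.

Let integral_csqint_band : (\int[ls]_s csqint mu (band s) = csqint mu F)%E.
Proof.
rewrite -csqint_w1 -(integral_band mw1 (fun=> ler01)).
by apply: eq_integral => s _; rewrite csqint_w1.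
Qed.

Let measurable_slice (w : TT -> R) : measurable_fun setT w -> (forall x, 0 <= w x) ->
  measurable_fun setT (fun s : RR => (\int[mu]_x (w x * normc (band s x) ^+ 2)%:E)%E).
Proof.
move=> mw w0; apply: (@measurable_fun_fubini_tonelli_F _ _ RR TT R mu
  (fun z : RR * TT => (w z.2 * normc (band z.1 z.2) ^+ 2)%:E)).
  exact: measurable_band_weight.
by move=> z; rewrite lee_fin mulr_ge0 ?sqr_ge0.
Qed.

Let measurable_csqint_band : measurable_fun setT (fun s : RR => csqint mu (band s)).
Proof.
have := measurable_slice mw1 (fun=> ler01); congr measurable_fun.
by apply/funext => s; rewrite csqint_w1.
Qed.

Let measurable_cmoment_band : measurable_fun setT (fun s : RR => cmoment a (band s)).
Proof. exact: measurable_slice (@measurable_normsq R n) (@normsq_ge0 R n). Qed.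

Let ae_log_filter : Filter (nbhs (almost_everywhere ls)).
Proof. exact: (ae_filter_ringOfSetsType ls). Qed.

Let ae_band : {ae ls, forall s, 0 < s /\ inLp mu 2%:E (band s)}.
Proof.
have ipos : {ae ls, forall s, (`]0%R, +oo[%classic : set R) s} by exact: ae_mdensity.
have ib : ls.-integrable setT (fun s => csqint mu (band s)).
  apply/integrableP; split => //.
  under eq_integral do rewrite gee0_abs ?csqint_ge0//.
  by rewrite integral_csqint_band.
apply: (@filterS2 _ _ ae_log_filter _ _ _ _ ipos (integrable_ae measurableT ib)) => s + /(_ I) bfin.
rewrite /= in_itv/= andbT => s0; split => //; apply/inL2P; split.
  exact: cmeasurable_band.
by rewrite ltey_eq bfin.
Qed.

Let cmoment_ge0 f : (0 <= cmoment a f)%E.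
Proof. by apply: integral_ge0 => x _; rewrite lee_fin mulr_ge0 ?sqr_ge0// normsq_ge0. Qed.

Let cmoment_U s : 0 < s -> inLp mu 2%:E (band s) ->
  cmoment a (fun x => U (s, x)) = cmoment a (bessel_transform a (band s)).
Proof.
move=> s0 bs; have [[mg _] _] := bessel_transformP a0 n0 bs.
apply: ge0_ae_eq_integral => //.
- exact: measurable_moment (measurable_normc (mUs s)).
- exact: measurable_moment (measurable_normc mg).
- by move=> x _; rewrite lee_fin mulr_ge0 ?sqr_ge0// normsq_ge0.
- by move=> x _; rewrite lee_fin mulr_ge0 ?sqr_ge0// normsq_ge0.
by apply: filterS (UE s0) => x /= -> _.
Qed.

(** The uncertainty inequality of almost every [band s], integrated in [s]. *)
Lemma multiplier_heisenberg (c : R) : 0 < c ->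
  ((4 * c * half_dim a)%:E * csqint mu F <= X + (4 * c ^+ 2)%:E * cmoment a F)%E.
Proof.
move=> c0; have h0 := half_dim_gt0 a0 n0.
have ch0 : 0 <= 4 * c * half_dim a by apply: mulr_ge0; [rewrite mulr_ge0// ltW|exact: ltW].
have c20 : 0 <= 4 * c ^+ 2 by rewrite mulr_ge0// sqr_ge0.
have YE : (\int[ls]_s cmoment a (band s) = cmoment a F)%E.
  exact: integral_band (@measurable_normsq R n) (@normsq_ge0 R n).
rewrite -integral_csqint_band -YE XE -!ge0_integralZl//.
all: try by move=> s _; rewrite ?csqint_ge0 ?cmoment_ge0.
rewrite -ge0_integralD//.
all: try by move=> s _; rewrite ?mule_ge0 ?csqint_ge0 ?cmoment_ge0.
all: try by exact: measurable_funeM.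
apply: ae_ge0_le_integral => //.
- by move=> s _; rewrite mule_ge0 ?csqint_ge0.
- exact: measurable_funeM.
- by move=> s _; rewrite adde_ge0 ?mule_ge0 ?cmoment_ge0.
- by apply: emeasurable_funD => //; exact: measurable_funeM.
apply: (@filterS _ _ ae_log_filter _ _ _ ae_band) => s [s0 bs] _.
by rewrite cmoment_U//; exact: bessel_transform_heisenberg.
Qed.

(** Almost every [band s] then has a transform of moment 0, hence vanishes. *)
Lemma multiplier_moment_eq0 : X = 0%E -> csqint mu F = 0%E.
Proof.
move=> X0; rewrite -integral_csqint_band.
have : (\int[ls]_s `|cmoment a (fun x => U (s, x))| = 0)%E.
  by rewrite -[RHS]X0 XE; apply: eq_integral => s _; rewrite gee0_abs.
move=> /(ae_eq_integral_abs ls measurableT mXs) ae0.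
rewrite (@ge0_ae_eq_integral _ _ _ ls setT _ (cst 0%E))//.
- by rewrite integral0.
- by move=> s _; exact: csqint_ge0.
apply: (@filterS2 _ _ ae_log_filter _ _ _ _ ae0 ae_band) => s /(_ I) /= E [s0 bs] _.
have [[mg _] _] := bessel_transformP a0 n0 bs.
rewrite -(csqint_bessel_transform a0 n0 bs); apply: cmoment_eq0 => //.
by rewrite -cmoment_U.
Qed.

End admissible.

End multipliers.

Lemma normc_real_mul (R : realType) (r : R) (z : R[i]) :
  Normc.normc (r%:C%C * z) ^+ 2 = r ^+ 2 * Normc.normc z ^+ 2.
Proof.
by rewrite Normc.normcM exprMn /= expr0n addr0 sqrtr_sqr real_normK ?num_real.
Qed.

Lemma euclid_norm_sqr (R : realType) n (x : n.-tuple R) : euclid_norm x ^+ 2 = normsq x.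
Proof. by rewrite sqr_sqrtr// normsq_ge0. Qed.

(** [2 half_dim = (2 |alpha| + n) + n]; the hypothesis on [a] makes the denominator
    positive. *)
Lemma half_dim_inv_le (R : realType) n (a : n.-tuple R) : (0 < n)%N ->
  (forall i, - 2^-1 < tnth a i) -> (half_dim a)^-1 <= 2 / (2 * tsum a + n%:R).
Proof.
move=> n0 a0.
have D0 : 0 < \sum_(i < n) (2 * tnth a i + 1).
  rewrite (bigD1 (Ordinal n0))//=; apply: ltr_pwDl.
    by have := a0 (Ordinal n0) => ?; lra.
  by apply: sumr_ge0 => i _; have := a0 i => ?; lra.
have nE : \sum_(i < n) (1 : R) = n%:R by rewrite sumr_const card_ord.
have DE : \sum_(i < n) (2 * tnth a i + 1) = 2 * tsum a + n%:R.
  by rewrite big_split/= -mulr_sumr nE.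
have hE : half_dim a = tsum a + n%:R by rewrite /half_dim big_split/= nE.
rewrite {}DE in D0; rewrite hE.
have nn : 0 < (n%:R : R) by rewrite ltr0n.
have h0 : 0 < tsum a + n%:R by lra.
rewrite ler_pdivlMr// ler_pdivrMl//; lra.
Qed.

Theorem theorem3p1 (R : realType) (n : nat) (a : n.-tuple R)
    (m f : n.-tuple R -> R[i])
    (T : measurableTypeR R * n.-tuple R -> R[i]) :
  (1 <= n)%N ->
  (forall i, - 2^-1 < tnth a i) ->
  inLp (bessel_measure a) 2%:E m ->
  inLp (bessel_measure a) +oo%E m ->
  (forall x, orthant x ->
    \int[@log_measure R]_s ((Normc.normc (m (dilation s x))) ^+ 2)%:E = 1)%E ->
  inLp (bessel_measure a) 2%:E f ->
  cmeasurable T ->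
  (forall s : R, 0 < s ->
    {ae bessel_measure a, forall x, T (s, x) = multiplier_op a m s f x}) ->
  (cLnorm (bessel_measure a) 2%:E f ^+ 2 <=
   (2 / (2 * tsum a + n%:R))%:E *
   cLnorm (bessel_measure a) 2%:E
     (fun y => (euclid_norm y)%:C%C * bessel_transform a f y)%R *
   cLnorm (Omega_measure a) 2%:E
     (fun p => (euclid_norm p.2)%:C%C * T p)%R)%E.
Proof.
move=> n0 a0 [mm _] _ madm fL2 mT TE.
set F := bessel_transform a f.
have NE : csqint (bessel_measure a) F = csqint (bessel_measure a) f.
  exact: csqint_bessel_transform.
have [[mF _] _] := bessel_transformP a0 n0 fL2.
have [_ foo] := (inL2P _ _).1 fL2.
have Foo : (csqint (bessel_measure a) F < +oo)%E by rewrite NE.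
rewrite expe2 cLnorm_sqr -NE.
have YE : (cLnorm (bessel_measure a) 2%:E (fun y => (euclid_norm y)%:C%C * F y)%R *
    cLnorm (bessel_measure a) 2%:E (fun y => (euclid_norm y)%:C%C * F y)%R)%E = cmoment a F.
  rewrite cLnorm_sqr; apply: eq_integral => y _.
  by rewrite normc_real_mul euclid_norm_sqr.
have XE : (cLnorm (Omega_measure a) 2%:E (fun p => (euclid_norm p.2)%:C%C * T p)%R *
    cLnorm (Omega_measure a) 2%:E (fun p => (euclid_norm p.2)%:C%C * T p)%R =
    \int[(Omega_measure a)]_z (normsq z.2 * Normc.normc (T z) ^+ 2)%:E)%E.
  rewrite cLnorm_sqr; apply: eq_integral => z _.
  by rewrite normc_real_mul euclid_norm_sqr.
apply: (geometric_of_arithmetic (half_dim_gt0 a0 n0)).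
- exact: csqint_ge0.
- exact: Foo.
- exact: cLnorm_ge0.
- exact: cLnorm_ge0.
- move=> A0; apply: (cmoment_eq0 n0 mF); by rewrite -YE A0 mule0.
- move=> B0; apply: (multiplier_moment_eq0 a0 n0 mm mF madm Foo mT TE).
  by rewrite -XE B0 mule0.
- move=> c c0; rewrite YE XE.
  exact: (multiplier_heisenberg a0 n0 mm mF madm Foo mT TE).
- exact: half_dim_inv_le.
Qed.
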